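(* Let $\mathcal{C}$ be a super-modular category with fermionic symmetry action $[\rho]:G_b\to\mathrm{Aut}_{LR}(\mathcal{C})$ for the fermionic symmetry group $G_f$ determined by $\omega_2=(-1)^{\tilde\omega_2}\in Z^2(G_b,\mathbb{Z}_2)$. Suppose $G_b$ contains at least one anti-unitary symmetry. Assume that $\ker r=\mathbb{Z}_2$ and that the nontrivial element of $\ker r$ has a nontrivial permutation action on anyons. Then the obstruction $[o_2]\in\mathcal{H}^2(G_b,\ker r)=\mathcal{H}^2(G_b,\mathbb{Z}_2)$ is identical for every $\nu$ for which there exists, for every ${\bf g}\in G_b$, a lift $\check{\rho}^{(\nu)}_{\bf g}:\check{\mathcal{C}}_\nu\to\check{\mathcal{C}}_\nu$ of $\rho_{\bf g}$.
   Context: A super-modular category $\mathcal{C}$ is a unitary braided fusion category with exactly one nontrivial simple object $\psi$ that braids trivially with all objects, where $\psi$ is a fermion: $\theta_\psi=-1$, $\psi\times\psi=1$. A minimal modular extension of $\mathcal{C}$ is a UMTC containing $\mathcal{C}$ as a full braided fusion subcategory, with $\mathcal{D}_{\check{\mathcal{C}}}^2=2\mathcal{D}_{\mathcal{C}}^2$; there are exactly 16, $\check{\mathcal{C}}_\nu$, $\nu\in\mathbb{Z}/16$, with chiral central charges satisfying $c_\nu-c_{\nu'}=(\nu-\nu')/2\bmod8$. $\check{\mathcal{C}}_{\nu'}$ is obtained from $\check{\mathcal{C}}_\nu$ by taking $\check{\mathcal{C}}_\nu\boxtimes\mathcal{I}(\nu'-\nu)$, with $\mathcal{I}(\mu)$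 the minimal modular extension of $\{1,\psi\}$ of central charge $\mu/2\bmod8$, and condensing the bound state of the two fermions. For $\mathcal{B}=\mathcal{C}$ or $\check{\mathcal{C}}_\nu$: a topological autoequivalence is a braided autoequivalence (unitary) or braided anti-autoequivalence (anti-unitary) fixing $\psi$. Natural isomorphisms act on fusion vertices as $|a,b;c;\mu\rangle\mapsto\frac{\gamma_a\gamma_b}{\gamma_c}|a,b;c;\mu\rangle$, $\gamma_a\in\mathrm{U}(1)$; one ''respects locality'' if it can be written with $\gamma_\psi=+1$. $\mathrm{Aut}_{LR}(\mathcal{B})$ is the group of topological autoequivalences acting trivially on the vertex $|\psi,\psi;1\rangle$, modulo locality-respecting natural isomorphisms. $\Upsilon_\psi$ (on $\mathcal{C}$) and $\check{\Upsilon}_\psi$ (on $\check{\mathcal{C}}_\nu$) are the natural isomorphisms with $\gamma_\psi=-1$ and $\gamma_a=1$ for all other $a$. $r:\mathrm{Aut}_{LR}(\check{\mathcal{C}}_\nu)\to\mathrm{Aut}_{LR}(\mathcal{C})$ is restriction; the hypotheses on $\ker r$ are imposed for each $\nu$ under consideration, and $\ker r\simeq\mathbb{Z}_2$ is then identified with $\mathbb{Z}_2$ in the unique way. Symmetry action: $G_f$ is a central extension of $G_b$ by $\mathbb{Z}_2^f$ (fermion parity) with cocycle $\omega_2$, and elements of $G_b$ are unitary or anti-unitary according to a homomorphism $s_1:G_b\to\mathbb{Z}_2$, with $\rho_{\bf g}$ unitary or anti-unitary accordingly. $[\rho]$ comes from consistent $G_f$ symmetry fractionalization on $\mathcal{C}$;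 in particular $[\rho]$ is a group homomorphism if $\Upsilon_\psi$ respects locality, and $[\Upsilon_\psi]^{\tilde\omega_2({\bf g,h})}[\rho_{\bf g}][\rho_{\bf h}]=[\rho_{\bf gh}]$ if $\Upsilon_\psi$ does not respect locality. A lift of $\rho_{\bf g}$ to $\check{\mathcal{C}}_\nu$ is $[\check{\rho}_{\bf g}]\in\mathrm{Aut}_{LR}(\check{\mathcal{C}}_\nu)$ with $r([\check{\rho}_{\bf g}])=[\rho_{\bf g}]$. Given lifts for all ${\bf g}$, define $o_2({\bf g,h})=[\check{\rho}_{\bf gh}\check{\rho}_{\bf h}^{-1}\check{\rho}_{\bf g}^{-1}]$ if $\check{\Upsilon}_\psi$ respects locality in $\check{\mathcal{C}}_\nu$, and $o_2({\bf g,h})=[\check{\rho}_{\bf gh}\check{\rho}_{\bf h}^{-1}\check{\rho}_{\bf g}^{-1}\check{\Upsilon}_\psi^{\tilde\omega_2({\bf g,h})}]$ otherwise. Then $o_2\in Z^2(G_b,\ker r)$, and its class $[o_2]$ does not depend on the choice of lifts (for fixed $\nu$). *)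

(* Defs.v *)
From HB Require Import structures.
From mathcomp Require Import all_boot all_order all_algebra all_fingroup.
From mathcomp Require Import boolp reals trigo.
From mathcomp Require Import complex.

Set Implicit Arguments.
Unset Strict Implicit.
Unset Printing Implicit Defensive.

Import Order.TTheory GRing.Theory Num.Theory.
Local Open Scope ring_scope.

(* Categories are given by skeletal data.  [N a b c] is the dimension of the
   vertex space V^{ab}_c, whose chosen orthonormal basis is |a,b;c;mu> with
   mu < N a b c.  Vertex labels are plain naturals; the values of [F], [Rs], ...
   at out-of-range labels are junk and are never used.  Conventions:
     |a,b;e;al> |e,c;d;be>
       = \sum_(f,mu,nu) F a b c d (e,al,be) (f,mu,nu) |b,c;f;mu> |a,f;d;nu>,
     R^{ab} |b,a;c;mu> = \sum_nu Rs a b c mu nu |a,b;c;nu>. *)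
Record braidData (R : realType) := BraidData {
  obj : finType;
  vac : obj;
  dual : obj -> obj;
  N : obj -> obj -> obj -> nat;
  F : obj -> obj -> obj -> obj -> obj * nat * nat -> obj * nat * nat -> R[i];
  Rs : obj -> obj -> obj -> nat -> nat -> R[i] }.

Arguments vac {R} b.

Definition phase {R : realType} (z : R[i]) : Prop := `|z| = 1.

(* The inverse braiding, which sends |b,a;c;mu> to |a,b;c;nu>, has matrix
   (R^{ba}_c)^{-1}, i.e. the adjoint of R^{ba}_c. *)
Definition Rinv {R : realType} (B : braidData R) (a b c : obj B) (mu nu : nat)
  : R[i] := (Rs b a c nu mu)^*.

Definition fusion_axioms {R : realType} (B : braidData R) : Prop :=
  [/\ forall a b : obj B, N (vac B) a b = (a == b) :> nat,
      forall a b : obj B, N a (vac B) b = (a == b) :> nat,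
      forall a b : obj B, N a b (vac B) = (b == dual a) :> nat,
      forall a b c : obj B, N a b c = N b a c
    & (* rigidity *)
      forall a : obj B,
        F a (dual a) a a (vac B, 0, 0)%N (vac B, 0, 0)%N != 0].

Definition F_unitary {R : realType} (B : braidData R) : Prop :=
  forall a b c d : obj B,
    (forall (e e' : obj B) (al : 'I_(N a b e)) (be : 'I_(N e c d))
            (al' : 'I_(N a b e')) (be' : 'I_(N e' c d)),
       \sum_f \sum_(mu < N b c f) \sum_(nu < N a f d)
          F a b c d (e, val al, val be) (f, val mu, val nu)
          * (F a b c d (e', val al', val be') (f, val mu, val nu))^*
       = ((e, val al, val be) == (e', val al', val be'))%:R)
    /\
    (forall (f f' : obj B) (mu : 'I_(N b c f)) (nu : 'I_(N a f d))
            (mu' : 'I_(N b c f')) (nu' : 'I_(N a f' d)),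
       \sum_e \sum_(al < N a b e) \sum_(be < N e c d)
          (F a b c d (e, val al, val be) (f, val mu, val nu))^*
          * F a b c d (e, val al, val be) (f', val mu', val nu')
       = ((f, val mu, val nu) == (f', val mu', val nu'))%:R).

(* The vacuum vertices |1,a;a> and |a,1;a> are the unit constraints. *)
Definition triangle {R : realType} (B : braidData R) : Prop :=
  [/\ forall (a b c : obj B) (be mu : 'I_(N a b c)),
        F (vac B) a b c (a, 0%N, val be) (c, val mu, 0%N) = (be == mu)%:R,
      forall (a b c : obj B) (be nu : 'I_(N a b c)),
        F a (vac B) b c (a, 0%N, val be) (b, 0%N, val nu) = (be == nu)%:R
    & forall (a b c : obj B) (al nu : 'I_(N a b c)),
        F a b (vac B) c (c, val al, 0%N) (b, 0%N, val nu) = (al == nu)%:R].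

Definition pentagon {R : realType} (B : braidData R) : Prop :=
  forall (a b c d e f g k l : obj B)
         (al : 'I_(N a b f)) (be : 'I_(N f c g)) (ga : 'I_(N g d e))
         (la : 'I_(N c d l)) (mu : 'I_(N b l k)) (nu : 'I_(N a k e)),
    \sum_(de < N f l e)
       F f c d e (g, val be, val ga) (l, val la, val de)
       * F a b l e (f, val al, val de) (k, val mu, val nu)
    = \sum_h \sum_(si < N b c h) \sum_(ta < N a h g) \sum_(rh < N h d k)
       F a b c g (f, val al, val be) (h, val si, val ta)
       * F a h d e (g, val ta, val ga) (k, val rh, val nu)
       * F b c d k (h, val si, val rh) (l, val la, val mu).

(* Hexagon equation for the braiding matrices [S]; both S = Rs and S = Rinv
   are required. *)
Definition hexagon {R : realType} (B : braidData R)
    (S : obj B -> obj B -> obj B -> nat -> nat -> R[i]) : Prop :=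
  forall (a b c d e g : obj B)
         (al : 'I_(N c a e)) (be : 'I_(N e b d))
         (mu : 'I_(N b c g)) (nu : 'I_(N a g d)),
    \sum_(al' < N a c e) \sum_(mu' < N c b g)
       S a c e al al'
       * F a c b d (e, val al', val be) (g, val mu', val nu)
       * S b c g mu' mu
    = \sum_f \sum_(si < N a b f) \sum_(ta < N c f d) \sum_(ta' < N f c d)
       F c a b d (e, val al, val be) (f, val si, val ta)
       * S f c d ta ta'
       * F a b c d (f, val si, val ta') (g, val mu, val nu).

Definition R_unitary {R : realType} (B : braidData R) : Prop :=
  forall (a b c : obj B) (mu mu' : 'I_(N b a c)),
    \sum_(nu < N a b c) Rs a b c mu nu * (Rs a b c mu' nu)^* = (mu == mu')%:R.

Record unitary_braided_fusion {R : realType} (B : braidData R) : Prop := {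
  ubf_fusion : fusion_axioms B;
  ubf_F_unitary : F_unitary B;
  ubf_R_unitary : R_unitary B;
  ubf_triangle : triangle B;
  ubf_pentagon : pentagon B;
  ubf_hexagon : hexagon (@Rs R B);
  ubf_hexagon_inv : hexagon (@Rinv R B) }.

Definition qdim {R : realType} (B : braidData R) (a : obj B) : R[i] :=
  `|F a (dual a) a a (vac B, 0, 0)%N (vac B, 0, 0)%N|^-1.

Definition total_dim2 {R : realType} (B : braidData R) : R[i] :=
  \sum_(a : obj B) qdim a ^+ 2.

Definition theta {R : realType} (B : braidData R) (a : obj B) : R[i] :=
  \sum_(c : obj B) qdim c / qdim a * \sum_(mu < N a a c) Rs a a c mu mu.

Definition braids_trivially {R : realType} (B : braidData R) (a b : obj B)
  : Prop :=
  forall (c : obj B) (mu la : 'I_(N b a c)),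
    \sum_(nu < N a b c) Rs a b c mu nu * Rs b a c nu la = (mu == la)%:R.

Definition transparent {R : realType} (B : braidData R) (a : obj B) : Prop :=
  forall x : obj B, braids_trivially a x.

Definition super_modular {R : realType} (B : braidData R) (psi : obj B)
  : Prop :=
  [/\ unitary_braided_fusion B,
      psi <> vac B,
      forall a : obj B, transparent a <-> a = vac B \/ a = psi,
      theta psi = -1
    & forall c : obj B, N psi psi c = (c == vac B) :> nat].

Definition modular {R : realType} (B : braidData R) : Prop :=
  unitary_braided_fusion B /\
  forall a : obj B, transparent a -> a = vac B.

(* The chiral central charge (mod 8), through the Gauss sum
   D^{-1} \sum_a d_a^2 theta_a = exp(2 pi i c / 8). *)
Definition central_charge {R : realType} (B : braidData R) (c : R) : Prop :=
  (sqrtC (total_dim2 B))^-1 * \sum_(a : obj B) qdim a ^+ 2 * theta a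
  = Complex (cos (2%:R * pi * c / 8%:R)) (sin (2%:R * pi * c / 8%:R)).

Definition eq_mod8 {R : realType} (x y : R) : Prop :=
  exists k : int, x - y = 8%:R * k%:~R.

(* A subcategory is literally a subset of the anyons, closed under fusion, with
   the same vertex bases and the same F- and R-symbols. *)
Record full_braided_subcategory {R : realType} (A B : braidData R)
    (i : obj A -> obj B) : Prop := {
  sub_inj : injective i;
  sub_vac : i (vac A) = vac B;
  sub_N : forall a b c : obj A, N (i a) (i b) (i c) = N a b c;
  sub_closed : forall (a b : obj A) (x : obj B),
    (0 < N (i a) (i b) x)%N -> exists c : obj A, x = i c;
  sub_F : forall (a b c d e f : obj A) (al : 'I_(N a b e)) (be : 'I_(N e c d))
                 (mu : 'I_(N b c f)) (nu : 'I_(N a f d)),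
    F (i a) (i b) (i c) (i d) (i e, val al, val be) (i f, val mu, val nu)
    = F a b c d (e, val al, val be) (f, val mu, val nu);
  sub_R : forall (a b c : obj A) (mu : 'I_(N b a c)) (nu : 'I_(N a b c)),
    Rs (i a) (i b) (i c) mu nu = Rs a b c mu nu }.

Definition minimal_modular_extension {R : realType} (A M : braidData R)
    (i : obj A -> obj M) : Prop :=
  [/\ modular M, full_braided_subcategory i
    & total_dim2 M = 2%:R * total_dim2 A].

(* The super-modular category {1, psi}; psi is [true]. *)
Definition sVec (R : realType) : braidData R :=
  @BraidData R bool false id
    (fun a b c => (c == a (+) b) : nat)
    (fun _ _ _ _ _ _ => 1)
    (fun a b _ _ _ => (-1) ^+ (a && b)).

(* Deligne product.  The vertex |x,y;z;mu> of the product stands for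
   |x.1,y.1;z.1;mu %/ n> (x) |x.2,y.2;z.2;mu %% n>, n = N x.2 y.2 z.2. *)
Definition boxtimes {R : realType} (A B : braidData R) : braidData R :=
  @BraidData R (obj A * obj B)%type (vac A, vac B)
    (fun x => (dual x.1, dual x.2))
    (fun x y z => (N x.1 y.1 z.1 * N x.2 y.2 z.2)%N)
    (fun x y z w l r =>
       let: (e, al, be) := l in
       let: (f, mu, nu) := r in
       let nal := N x.2 y.2 e.2 in let nbe := N e.2 z.2 w.2 in
       let nmu := N y.2 z.2 f.2 in let nnu := N x.2 f.2 w.2 in
       F x.1 y.1 z.1 w.1 (e.1, al %/ nal, be %/ nbe)%N
                         (f.1, mu %/ nmu, nu %/ nnu)%N
       * F x.2 y.2 z.2 w.2 (e.2, al %% nal, be %% nbe)%N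
                           (f.2, mu %% nmu, nu %% nnu)%N)
    (fun x y z mu nu =>
       let nmu := N y.2 x.2 z.2 in let nnu := N x.2 y.2 z.2 in
       Rs x.1 y.1 z.1 (mu %/ nmu)%N (nu %/ nnu)%N
       * Rs x.2 y.2 z.2 (mu %% nmu)%N (nu %% nnu)%N).

(* A unitary braided functor Phi, defined on the fusion subcategory of A spanned
   by the anyons satisfying P.  Phi(a) is the sum of [mult a x] copies of x
   (copies labelled by k < mult a x), and Phi(|a,b;c;mu>) has, for the copies
   (x,i), (y,j), (z,k) of Phi(a), Phi(b), Phi(c), the component
   \sum_nu lift a b c mu (x,i) (y,j) (z,k) nu |x,y;z;nu>. *)
Record functorData {R : realType} (A B : braidData R) := FunctorData {
  mult : obj A -> obj B -> nat;
  lift_vertex : obj A -> obj A -> obj A -> nat ->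
    obj B * nat -> obj B * nat -> obj B * nat -> nat -> R[i] }.

Record unitary_braided_functor {R : realType} (A B : braidData R)
    (P : obj A -> Prop) (Phi : functorData A B) : Prop := {
  fun_vac : forall t : obj B, mult Phi (vac A) t = (t == vac B) :> nat;
  fun_unitl : forall (b : obj A) (y : obj B) (j k : 'I_(mult Phi b y)), P b ->
    lift_vertex Phi (vac A) b b 0%N (vac B, 0%N) (y, val j) (y, val k) 0%N
    = (j == k)%:R;
  fun_unitr : forall (a : obj A) (x : obj B) (i k : 'I_(mult Phi a x)), P a ->
    lift_vertex Phi a (vac A) a 0%N (x, val i) (vac B, 0%N) (x, val k) 0%N
    = (i == k)%:R;
  (* Phi induces a unitary isomorphism Phi(a (x) b) -> Phi(a) (x) Phi(b) *)
  fun_isometry : forall (a b c c' : obj A) (z : obj B)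
      (mu : 'I_(N a b c)) (k : 'I_(mult Phi c z))
      (mu' : 'I_(N a b c')) (k' : 'I_(mult Phi c' z)), P a -> P b ->
    \sum_x \sum_y \sum_(i < mult Phi a x) \sum_(j < mult Phi b y)
      \sum_(nu < N x y z)
        lift_vertex Phi a b c mu (x, val i) (y, val j) (z, val k) nu
        * (lift_vertex Phi a b c' mu' (x, val i) (y, val j) (z, val k') nu)^*
    = ((c, val mu, val k) == (c', val mu', val k'))%:R;
  fun_coisometry : forall (a b : obj A) (x x' y y' z : obj B)
      (i : 'I_(mult Phi a x)) (j : 'I_(mult Phi b y)) (nu : 'I_(N x y z))
      (i' : 'I_(mult Phi a x')) (j' : 'I_(mult Phi b y'))
      (nu' : 'I_(N x' y' z)), P a -> P b ->
    \sum_c \sum_(mu < N a b c) \sum_(k < mult Phi c z)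
      (lift_vertex Phi a b c mu (x, val i) (y, val j) (z, val k) nu)^*
      * lift_vertex Phi a b c mu (x', val i') (y', val j') (z, val k) nu'
    = ((x, val i, (y, val j), val nu) == (x', val i', (y', val j'), val nu'))%:R;
  fun_F : forall (a b c d e : obj A) (al : 'I_(N a b e)) (be : 'I_(N e c d))
      (x y z w v : obj B) (i : 'I_(mult Phi a x)) (j : 'I_(mult Phi b y))
      (k : 'I_(mult Phi c z)) (l : 'I_(mult Phi d w))
      (mu' : 'I_(N y z v)) (nu' : 'I_(N x v w)), P a -> P b -> P c ->
    \sum_u \sum_(al' < N x y u) \sum_(be' < N u z w) \sum_(m < mult Phi e u)
      lift_vertex Phi a b e al (x, val i) (y, val j) (u, val m) al'
      * lift_vertex Phi e c d be (u, val m) (z, val k) (w, val l) be'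
      * F x y z w (u, val al', val be') (v, val mu', val nu')
    = \sum_f \sum_(mu < N b c f) \sum_(nu < N a f d) \sum_(m < mult Phi f v)
      F a b c d (e, val al, val be) (f, val mu, val nu)
      * lift_vertex Phi b c f mu (y, val j) (z, val k) (v, val m) mu'
      * lift_vertex Phi a f d nu (x, val i) (v, val m) (w, val l) nu';
  fun_R : forall (a b c : obj A) (mu : 'I_(N b a c)) (x y z : obj B)
      (i : 'I_(mult Phi a x)) (j : 'I_(mult Phi b y)) (k : 'I_(mult Phi c z))
      (la : 'I_(N x y z)), P a -> P b ->
    \sum_(nu < N a b c) Rs a b c mu nu
      * lift_vertex Phi a b c nu (x, val i) (y, val j) (z, val k) la
    = \sum_(la' < N y x z)
      lift_vertex Phi b a c mu (y, val j) (x, val i) (z, val k) la'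
      * Rs x y z la' la }.

Definition dominant {R : realType} (A B : braidData R) (P : obj A -> Prop)
    (Phi : functorData A B) : Prop :=
  forall t : obj B, exists a : obj A, P a /\ (0 < mult Phi a t)%N.

(* Phi is the identity on a category C contained in both A and B. *)
Definition identity_on {R : realType} (C A B : braidData R)
    (i : obj C -> obj A) (j : obj C -> obj B) (Phi : functorData A B) : Prop :=
  (forall (a : obj C) (t : obj B), mult Phi (i a) t = (t == j a) :> nat) /\
  (forall (a b c : obj C) (mu nu : 'I_(N a b c)),
     lift_vertex Phi (i a) (i b) (i c) mu (j a, 0%N) (j b, 0%N) (j c, 0%N) nu
     = (mu == nu)%:R).

(* Equivalence of extensions of C: a fully faithful and dominant functor. *)
Definition equivalent_extensions {R : realType} (C M M' : braidData R)
    (i : obj C -> obj M) (i' : obj C -> obj M') : Prop :=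
  exists Phi : functorData M M',
    [/\ unitary_braided_functor (fun=> True) Phi,
        dominant (fun=> True) Phi,
        forall a b : obj M,
          (\sum_t mult Phi a t * mult Phi b t)%N = (a == b) :> nat
      & identity_on i i' Phi].

(* D is the phase obtained from A by condensing the boson b: the unconfined
   anyons, i.e. those braiding trivially with b, map onto D by a braided functor
   for which exactly 1 and b restrict to the vacuum, each with multiplicity one
   (the condensate, i.e. the algebra of which D is the category of local
   modules, is 1 + b).  The copies i and j of C in A and D are identified. *)
Definition condensation {R : realType} (C A D : braidData R)
    (i : obj C -> obj A) (j : obj C -> obj D) (b : obj A) : Prop :=
  exists Phi : functorData A D,
    [/\ unitary_braided_functor (braids_trivially b) Phi,
        dominant (braids_trivially b) Phi,
        forall a : obj A, braids_trivially b a ->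
          mult Phi a (vac D) = ((a == vac A) || (a == b)) :> nat
      & identity_on i j Phi].

(* The sixteen minimal modular extensions M nu of C (containing C through
   [inc nu] and with central charges [cc nu]).  The last field: M nu' is obtained
   from M nu by stacking with I = I(nu' - nu), the minimal modular extension of
   {1, psi} of central charge (nu' - nu)/2, and condensing the bound state of the
   two fermions. *)
Record sixteenfold_way {R : realType} (C : braidData R) (psi : obj C)
    (M : 'Z_16 -> braidData R) (inc : forall nu, obj C -> obj (M nu))
    (cc : 'Z_16 -> R) : Prop := {
  sw_ext : forall nu, minimal_modular_extension (inc nu);
  sw_all : forall (M' : braidData R) (i' : obj C -> obj M'),
    minimal_modular_extension i' ->
    exists! nu : 'Z_16, equivalent_extensions i' (inc nu);
  sw_cc : forall nu, central_charge (M nu) (cc nu);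
  sw_cc_diff : forall nu nu' : 'Z_16,
    eq_mod8 (cc nu - cc nu') (((nu : nat)%:R - (nu' : nat)%:R) / 2%:R);
  sw_stack : forall (nu nu' : 'Z_16) (I : braidData R)
      (i : obj (sVec R) -> obj I),
    minimal_modular_extension i ->
    central_charge I ((nat_of_ord (nu' - nu)%R)%:R / 2%:R) ->
    @condensation R C (boxtimes (M nu) I) (M nu')
      (fun a => (inc nu a, vac I)) (inc nu') (inc nu psi, i true) }.

(* A (possibly anti-linear) map acting as
     |a,b;c;mu> |-> \sum_nu U a b c mu nu |a',b';c';nu>,   x' = pact x,
   extended anti-linearly when [anti] holds.  U is indexed by the source
   anyons. *)
Record autData {R : realType} (B : braidData R) := AutData {
  pact : {perm obj B};
  anti : bool;
  U : obj B -> obj B -> obj B -> nat -> nat -> R[i] }.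

Definition conj_if {R : realType} (q : bool) (z : R[i]) : R[i] :=
  if q then z^* else z.

(* Braided (anti-)autoequivalence fixing psi. *)
Record topological_autoequivalence {R : realType} (B : braidData R)
    (psi : obj B) (phi : autData B) : Prop := {
  aut_vac : pact phi (vac B) = vac B;
  aut_psi : pact phi psi = psi;
  aut_N : forall a b c : obj B,
    N (pact phi a) (pact phi b) (pact phi c) = N a b c;
  aut_unitary : forall (a b c : obj B) (mu mu' : 'I_(N a b c)),
    \sum_(nu < N a b c) U phi a b c mu nu * (U phi a b c mu' nu)^*
    = (mu == mu')%:R;
  aut_unit : forall a : obj B,
    U phi (vac B) a a 0%N 0%N = 1 /\ U phi a (vac B) a 0%N 0%N = 1;
  aut_F : forall (a b c d e f : obj B) (al : 'I_(N a b e)) (be : 'I_(N e c d))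
      (mu' : 'I_(N b c f)) (nu' : 'I_(N a f d)),
    \sum_(al' < N a b e) \sum_(be' < N e c d)
      U phi a b e al al' * U phi e c d be be'
      * F (pact phi a) (pact phi b) (pact phi c) (pact phi d)
          (pact phi e, val al', val be') (pact phi f, val mu', val nu')
    = \sum_(mu < N b c f) \sum_(nu < N a f d)
      conj_if (anti phi) (F a b c d (e, val al, val be) (f, val mu, val nu))
      * U phi b c f mu mu' * U phi a f d nu nu';
  aut_R : forall (a b c : obj B) (mu : 'I_(N b a c)) (nu' : 'I_(N a b c)),
    \sum_(mu' < N b a c)
      U phi b a c mu mu' * Rs (pact phi a) (pact phi b) (pact phi c) mu' nu'
    = \sum_(nu < N a b c)
      conj_if (anti phi) (Rs a b c mu nu) * U phi a b c nu nu' }.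

(* The elements of Aut_LR are the classes, for [eqLR] below, of the following
   maps. *)
Definition AutLR {R : realType} (B : braidData R) (psi : obj B)
    (phi : autData B) : Prop :=
  topological_autoequivalence psi phi /\ U phi psi psi (vac B) 0%N 0%N = 1.

Definition aut_id {R : realType} (B : braidData R) : autData B :=
  AutData 1%g false (fun _ _ _ mu nu => (mu == nu)%:R).

(* phi after chi; note that s * t in {perm _} is t after s. *)
Definition aut_comp {R : realType} (B : braidData R) (phi chi : autData B)
  : autData B :=
  AutData (pact chi * pact phi)%g (anti phi (+) anti chi)
    (fun a b c mu la =>
       \sum_(nu < N (pact chi a) (pact chi b) (pact chi c))
         conj_if (anti phi) (U chi a b c mu nu)
         * U phi (pact chi a) (pact chi b) (pact chi c) nu la).

(* The matrices U being unitary, U^{-1} is the adjoint. *)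
Definition aut_inv {R : realType} (B : braidData R) (phi : autData B)
  : autData B :=
  let s := (pact phi)^-1%g in
  AutData s (anti phi)
    (fun a b c nu mu => conj_if (anti phi) (U phi (s a) (s b) (s c) mu nu)^*).

Definition nat_iso {R : realType} (B : braidData R) (gamma : obj B -> R[i])
  : autData B :=
  AutData 1%g false
    (fun a b c mu nu => gamma a * gamma b / gamma c * (mu == nu)%:R).

(* Equality as maps, i.e. ignoring out-of-range vertex labels. *)
Definition aut_eq {R : realType} (B : braidData R) (phi chi : autData B)
  : Prop :=
  [/\ pact phi = pact chi, anti phi = anti chi
    & forall (a b c : obj B) (mu nu : 'I_(N a b c)),
        U phi a b c mu nu = U chi a b c mu nu].

Definition respects_locality {R : realType} (B : braidData R) (psi : obj B)
    (phi : autData B) : Prop :=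
  exists gamma : obj B -> R[i],
    [/\ forall a, phase (gamma a), gamma psi = 1 & aut_eq phi (nat_iso gamma)].

(* [phi] = [chi] in Aut_LR. *)
Definition eqLR {R : realType} (B : braidData R) (psi : obj B)
    (phi chi : autData B) : Prop :=
  exists2 upsilon : autData B,
    respects_locality psi upsilon & aut_eq phi (aut_comp upsilon chi).

Definition Upsilon {R : realType} (B : braidData R) (psi : obj B) : autData B :=
  nat_iso (fun a => if a == psi then -1 else 1).

Definition Upsilon_pow {R : realType} (B : braidData R) (psi : obj B) (q : bool)
  : autData B := if q then Upsilon psi else aut_id B.

Definition is_restriction {R : realType} (C M : braidData R)
    (i : obj C -> obj M) (phi : autData M) (phi0 : autData C) : Prop :=
  [/\ forall a : obj C, pact phi (i a) = i (pact phi0 a),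
      anti phi = anti phi0
    & forall (a b c : obj C) (mu nu : 'I_(N a b c)),
        U phi (i a) (i b) (i c) mu nu = U phi0 a b c mu nu].

(* r([phi]) = [chi]. *)
Definition restricts_to {R : realType} (C M : braidData R) (psi : obj C)
    (i : obj C -> obj M) (phi : autData M) (chi : autData C) : Prop :=
  exists phi0 : autData C,
    [/\ AutLR psi phi0, is_restriction i phi phi0 & eqLR psi phi0 chi].

Definition in_ker_r {R : realType} (C M : braidData R) (psi : obj C)
    (i : obj C -> obj M) (phi : autData M) : Prop :=
  AutLR (i psi) phi /\ restricts_to psi i phi (aut_id C).

(* ker r = Z_2, and its nontrivial element permutes anyons nontrivially. *)
Definition ker_r_Z2_permuting {R : realType} (C M : braidData R) (psi : obj C)
    (i : obj C -> obj M) : Prop :=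
  exists kappa : autData M,
    [/\ in_ker_r psi i kappa,
        ~ eqLR (i psi) kappa (aut_id M),
        forall phi : autData M, in_ker_r psi i phi ->
          eqLR (i psi) phi (aut_id M) \/ eqLR (i psi) phi kappa
      & exists a : obj M, pact kappa a <> a].

(* The identification of ker r with Z_2 = bool: the class of the identity is
   sent to [false] and the other class to [true]. *)
Definition ker_r_to_Z2 {R : realType} (M : braidData R) (psi : obj M)
    (phi : autData M) : bool := ~~ `[< eqLR psi phi (aut_id M) >].

(* Z_2-valued cochains (trivial action), Z_2 being [bool] with [addb]. *)
Definition cocycle2 (G : groupType) (w : G -> G -> bool) : Prop :=
  forall g h k : G,
    w g h (+) w (g * h)%g k = w h k (+) w g (h * k)%g.

Definition cohomologous (G : groupType) (w w' : G -> G -> bool) : Prop :=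
  exists b : G -> bool, forall g h : G,
    w g h (+) w' g h = b g (+) b h (+) b (g * h)%g.

Definition Z2_homomorphism (G : groupType) (s : G -> bool) : Prop :=
  forall g h : G, s (g * h)%g = s g (+) s h.

(* G_f symmetry fractionalization: rho_g rho_h and rho_gh differ by the natural
   isomorphism with phases eta(g,h), which satisfy the twisted cocycle condition
   and carry the extension class on the fermion, eta_psi = omega_2 = (-1)^w. *)
Definition symmetry_fractionalization {R : realType} (C : braidData R)
    (psi : obj C) (G : groupType) (w : G -> G -> bool) (rho : G -> autData C)
    (eta : G -> G -> obj C -> R[i]) : Prop :=
  [/\ forall g h a, phase (eta g h a),
      forall g h, eta g h psi = (-1) ^+ w g h,
      forall g h, aut_eq (aut_comp (rho g) (rho h))
                         (aut_comp (nat_iso (eta g h)) (rho (g * h)%g))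
    & forall g h k a,
        eta g h a * eta (g * h)%g k a
        = eta g (h * k)%g a
          * conj_if (anti (rho g)) (eta h k ((pact (rho g))^-1%g a))].

(* [rho g] is a representative of the class [rho_g]. *)
Record fermionic_symmetry_action {R : realType} (C : braidData R)
    (psi : obj C) (G : groupType) (s1 : G -> bool) (w : G -> G -> bool)
    (rho : G -> autData C) : Prop := {
  fsa_aut : forall g, AutLR psi (rho g);
  fsa_anti : forall g, anti (rho g) = s1 g;
  fsa_frac : exists eta, symmetry_fractionalization psi w rho eta;
  fsa_hom : respects_locality psi (Upsilon psi) ->
    forall g h, eqLR psi (aut_comp (rho g) (rho h)) (rho (g * h)%g);
  fsa_twisted_hom : ~ respects_locality psi (Upsilon psi) ->
    forall g h,
      eqLR psi (aut_comp (aut_comp (Upsilon_pow psi (w g h)) (rho g)) (rho h))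
               (rho (g * h)%g) }.

(* A choice of lifts of all the rho_g. *)
Definition is_lift {R : realType} (C M : braidData R) (psi : obj C)
    (i : obj C -> obj M) (G : groupType) (rho : G -> autData C)
    (rhoM : G -> autData M) : Prop :=
  forall g, AutLR (i psi) (rhoM g) /\ restricts_to psi i (rhoM g) (rho g).

Definition o2_aut {R : realType} (M : braidData R) (psi : obj M)
    (G : groupType) (w : G -> G -> bool) (rhoM : G -> autData M) (g h : G)
  : autData M :=
  let x := aut_comp (aut_comp (rhoM (g * h)%g) (aut_inv (rhoM h)))
                    (aut_inv (rhoM g)) in
  if `[< respects_locality psi (Upsilon psi) >] then x
  else aut_comp x (Upsilon_pow psi (w g h)).

Definition o2 {R : realType} (M : braidData R) (psi : obj M)
    (G : groupType) (w : G -> G -> bool) (rhoM : G -> autData M) (g h : G)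
  : bool := ker_r_to_Z2 psi (o2_aut psi w rhoM g h).

(* Main.v *)
(* For a fixed extension, o_2 changes by a coboundary when the lifts change: two
   lifts of rho_g differ by an element of ker r = {1, kappa}, and kappa is
   central among the lifts since ker r is normal of order 2.

   For nu <> nu', an anti-unitary lift identifies the Gauss sum of M_nu with its
   complex conjugate, and similarly for M_nu'; hence nu' = nu + 8 mod 16.  Let
   the twist of M_nu have the same fusion rules and F-symbols, but with R^{ab}
   multiplied by -1 when both a and b have monodromy -1 with psi.  Monodromies
   are unchanged, so it is again a minimal modular extension of C, hence is
   equivalent to some M_mu.  For a with trivial monodromy with psi one has
   d_{psi a} theta_{psi a} = - d_a theta_a and d_{psi a} = d_a, so these anyons
   do not contribute to the Gauss sum, and the twist changes its sign.
   Therefore mu = nu + 8 = nu'.  Since Aut_LR and r only see the braiding through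
   the condition to preserve it, and every element of Aut_LR preserves the
   monodromy with psi, conjugation by the equivalence carries lifts on M_nu to
   lifts on M_nu' with the same o_2. *)
Require Import Defs.
From HB Require Import structures.
From mathcomp Require Import all_boot all_order all_algebra all_fingroup.
From mathcomp Require Import boolp reals trigo.
From mathcomp Require Import complex ring lra zify.

Set Implicit Arguments.
Unset Strict Implicit.
Unset Printing Implicit Defensive.

Import Order.TTheory GRing.Theory Num.Theory.
Local Open Scope ring_scope.

(** * Matrices indexed by finite types *)

(** Twists are traces of R-matrices and quantum dimensions are inverse moduli of F-symbols; no
    ribbon or spherical structure is at hand. The relations between a and psi a must therefore be
    extracted from the pentagon and the two hexagons. This is possible because fusion with psi
    leaves a single intermediate channel, so every F-symbol involved is a unitary block or a phase.
    A real Gauss sum makes the angle 2 pi c / 8 a multiple of pi, and one step of nu turns this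
    angle by pi / 8: this is where the shift by 8 comes from. The twist keeps vertices and
    F-symbols, so the equivalence from the twist to M_mu is also a map V from M_nu that preserves F
    and is braided only up to a sign depending on the monodromies with psi. In V phi V^-1 this sign
    occurs at a pair of anyons and at its image under phi, and the two cancel. *)

Section Kernels.
Variable T : numClosedFieldType.
Implicit Types I J K L : finType.

(** Kernels instead of matrices: the indices are dependent sums and ordinals whose bounds often
    agree only propositionally. *)
Definition fmul I J K (X : I -> J -> T) (Y : J -> K -> T) : I -> K -> T :=
  fun i k => \sum_j X i j * Y j k.
Definition fid I : I -> I -> T := fun i j => (i == j)%:R.
Definition fadj I J (X : I -> J -> T) : J -> I -> T := fun j i => (X i j)^*.
Definition fscale I J (c : T) (X : I -> J -> T) : I -> J -> T :=
  fun i j => c * X i j.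
Definition ftrace I (X : I -> I -> T) : T := \sum_i X i i.

Lemma fmulA I J K L (X : I -> J -> T) (Y : J -> K -> T) (Z : K -> L -> T) :
  fmul X (fmul Y Z) = fmul (fmul X Y) Z.
Proof.
apply/funext => i; apply/funext => l; rewrite /fmul.
under eq_bigr do rewrite mulr_sumr.
rewrite exchange_big; apply: eq_bigr => k _ /=.
by rewrite mulr_suml; apply: eq_bigr => j _; rewrite mulrA.
Qed.

Lemma sum_deltal I (i : I) (g : I -> T) : \sum_j (i == j)%:R * g j = g i.
Proof.
rewrite (bigD1 i) //= eqxx mul1r big1 ?addr0 // => j ji.
by rewrite eq_sym (negbTE ji) mul0r.
Qed.

Lemma sum_deltar I (i : I) (g : I -> T) : \sum_j g j * (j == i)%:R = g i.
Proof.
by rewrite -[RHS](sum_deltal i); apply: eq_bigr => j _; rewrite mulrC eq_sym.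
Qed.

Lemma fmul1l I J (X : I -> J -> T) : fmul (@fid I) X = X.
Proof. by apply/funext => i; apply/funext => j; apply: sum_deltal. Qed.

Lemma fmul1r I J (X : I -> J -> T) : fmul X (@fid J) = X.
Proof. by apply/funext => i; apply/funext => j; apply: sum_deltar. Qed.

Lemma fadjK I J (X : I -> J -> T) : fadj (fadj X) = X.
Proof. by apply/funext => i; apply/funext => j; rewrite /fadj conjCK. Qed.

Lemma fadjM I J K (X : I -> J -> T) (Y : J -> K -> T) :
  fadj (fmul X Y) = fmul (fadj Y) (fadj X).
Proof.
apply/funext => i; apply/funext => j; rewrite /fadj /fmul rmorph_sum.
by apply: eq_bigr => k _; rewrite rmorphM mulrC.
Qed.

Lemma fadj_scale I J c (X : I -> J -> T) : fadj (fscale c X) = fscale c^* (fadj X).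
Proof. by apply/funext => i; apply/funext => j; rewrite /fadj /fscale rmorphM. Qed.

Lemma fscale1 I J (X : I -> J -> T) : fscale 1 X = X.
Proof. by apply/funext => i; apply/funext => j; rewrite /fscale mul1r. Qed.

Lemma fscaleA I J c d (X : I -> J -> T) :
  fscale c (fscale d X) = fscale (c * d) X.
Proof. by apply/funext => i; apply/funext => j; rewrite /fscale mulrA. Qed.

Lemma fscalel I J K c (X : I -> J -> T) (Y : J -> K -> T) :
  fmul (fscale c X) Y = fscale c (fmul X Y).
Proof.
apply/funext => i; apply/funext => j; rewrite /fscale /fmul mulr_sumr.
by apply: eq_bigr => k _; rewrite mulrA.
Qed.

Lemma fscaler I J K c (X : I -> J -> T) (Y : J -> K -> T) :
  fmul X (fscale c Y) = fscale c (fmul X Y).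
Proof.
apply/funext => i; apply/funext => j; rewrite /fscale /fmul mulr_sumr.
by apply: eq_bigr => k _; rewrite mulrCA.
Qed.

Lemma ftraceC I J (X : I -> J -> T) (Y : J -> I -> T) :
  ftrace (fmul X Y) = ftrace (fmul Y X).
Proof.
rewrite /ftrace /fmul exchange_big; apply: eq_bigr => j _.
by apply: eq_bigr => i _; rewrite mulrC.
Qed.

Lemma ftrace_scale I c (X : I -> I -> T) : ftrace (fscale c X) = c * ftrace X.
Proof. by rewrite /ftrace mulr_sumr. Qed.

Definition funitary I J (X : I -> J -> T) :=
  fmul X (fadj X) = @fid I /\ fmul (fadj X) X = @fid J.

Lemma funitary_adj I J (X : I -> J -> T) : funitary X -> funitary (fadj X).
Proof. by case=> h1 h2; split; rewrite fadjK. Qed.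

Lemma funitaryM I J K (X : I -> J -> T) (Y : J -> K -> T) :
  funitary X -> funitary Y -> funitary (fmul X Y).
Proof.
case=> X1 X2 [Y1 Y2]; split; rewrite fadjM.
  by rewrite fmulA -(fmulA X) Y1 fmul1r.
by rewrite fmulA -(fmulA _ _ X) X2 fmul1r.
Qed.

(** The equation n = m is a hypothesis because it is applied to bounds such as [N a b c] and
    [N b a c]. *)
Lemma fmul1C n m (X : 'I_n -> 'I_m -> T) (Y : 'I_m -> 'I_n -> T) :
  n = m -> fmul X Y = @fid _ -> fmul Y X = @fid _.
Proof.
move=> nm; subst m => XY.
have /mulmx1C h : (\matrix_(i, j) X i j) *m (\matrix_(i, j) Y i j) = 1%:M.
  apply/matrixP => i j; rewrite !mxE -[RHS](congr1 (fun f => f i j) XY).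
  by apply: eq_bigr => k _; rewrite !mxE.
apply/funext => i; apply/funext => j.
have := congr1 (fun A : 'M_n => A i j) h; rewrite !mxE /fid => <-.
by apply: eq_bigr => k _; rewrite !mxE.
Qed.

Lemma funitary_sq n m (X : 'I_n -> 'I_m -> T) :
  n = m -> fmul X (fadj X) = @fid _ -> funitary X.
Proof. by move=> nm h; split=> //; apply: fmul1C nm h. Qed.

(** The traces of X X^* and X^* X coincide and count the two index sets. This yields equalities
    between fusion multiplicities. *)
Lemma funitary_card I J (X : I -> J -> T) : funitary X -> #|I| = #|J|.
Proof.
case=> X1 X2; apply/eqP; rewrite -(eqr_nat T); apply/eqP.
have trid K : ftrace (@fid K) = #|K|%:R.
  rewrite /ftrace /fid -sum1_card natr_sum.
  by apply: eq_bigr => i _; rewrite eqxx.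
by rewrite -!trid -X1 -X2 ftraceC.
Qed.

End Kernels.

(** * Block matrices on fusion trees *)

Section Blocks.
Variable T : numClosedFieldType.

Lemma sum_tagged (I : finType) (J : I -> finType) (g : forall i, J i -> T) :
  \sum_(x : {i : I & J i}) g (tag x) (tagged x) = \sum_i \sum_(j : J i) g i j.
Proof. by rewrite sig_big_dep. Qed.

Variable I : finType.

Definition idx (n m : I -> nat) := {i : I & ('I_(n i) * 'I_(m i))%type}.

Definition Idx n m i (k : 'I_(n i)) (l : 'I_(m i)) : idx n m :=
  Tagged (fun i => ('I_(n i) * 'I_(m i))%type) (k, l).

Lemma sum_idx n m (g : idx n m -> T) :
  \sum_x g x = \sum_i \sum_(k < n i) \sum_(l < m i) g (Idx k l).
Proof.
transitivity (\sum_i \sum_(j : 'I_(n i) * 'I_(m i))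
   g (Tagged (fun i => ('I_(n i) * 'I_(m i))%type) j)).
  by rewrite -sum_tagged; apply: eq_bigr => -[].
by apply: eq_bigr => i _; rewrite pair_big; apply: eq_bigr => -[].
Qed.

Lemma idxP n m (x : idx n m) : x = Idx (tagged x).1 (tagged x).2.
Proof. by case: x => i [k l]. Qed.

Lemma Idx_eq n m i j (k : 'I_(n i)) (l : 'I_(m i)) (k' : 'I_(n j)) (l' : 'I_(m j)) :
  (Idx k l == Idx k' l') = ((i, val k, val l) == (j, val k', val l')).
Proof.
apply/eqP/eqP => [h|[ij]].
  by have := congr1 (fun x : idx n m =>
    (tag x, val (tagged x).1, val (tagged x).2)) h.
by subst j => /val_inj-> /val_inj->.
Qed.

Lemma card_idx n m : #|{: idx n m}| = (\sum_i n i * m i)%N.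
Proof.
rewrite card_tagged sumnE big_map big_enum /=.
by apply: eq_bigr => i _; rewrite card_prod !card_ord.
Qed.

(* [idx] labels fusion trees (intermediate anyon, two vertices). *)
Definition block n m n' m' (p q : I -> nat -> nat -> T)
    (x : idx n m) (y : idx n' m') : T :=
  (tag x == tag y)%:R * p (tag x) (tagged x).1 (tagged y).1
  * q (tag x) (tagged x).2 (tagged y).2.

Definition vertex_id (_ : I) (k l : nat) : T := (k == l)%:R.

Lemma sum_dltl n (k : 'I_n) (g : 'I_n -> T) :
  \sum_(l < n) ((k : nat) == l)%:R * g l = g k.
Proof. exact: sum_deltal. Qed.

Lemma sum_dltr n (k : 'I_n) (g : 'I_n -> T) :
  \sum_(l < n) g l * ((l : nat) == k)%:R = g k.
Proof. exact: sum_deltar. Qed.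

Lemma block_adj n m n' m' p q :
  fadj (@block n m n' m' p q)
  = @block n' m' n m (fun i k l => (p i l k)^*) (fun i k l => (q i l k)^*).
Proof.
apply/funext => -[i [k l]]; apply/funext => -[j [k' l']]; rewrite /fadj /block /=.
rewrite !rmorphM /= eq_sym; have [ij|_] := eqVneq i j; last first.
  by rewrite rmorph0 !mul0r.
by subst j; rewrite rmorph1.
Qed.

Lemma blockM n m n' m' n'' m'' p q p' q' (x : idx n m) (z : idx n'' m'') :
  fmul (@block n m n' m' p q) (@block n' m' n'' m'' p' q') x z
  = block (fun i k l => \sum_(j < n' i) p i k j * p' i j l)
        (fun i k l => \sum_(j < m' i) q i k j * q' i j l) x z.
Proof.
case: x z => i [k l] [j [k' l']]; rewrite /fmul sum_idx /block /=.
rewrite (bigD1 i) //= [X in _ + X]big1 => [|e ei]; last first.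
  by rewrite big1 // => ? _; rewrite big1 // => ? _; rewrite eq_sym (negbTE ei) !mul0r.
rewrite addr0 eqxx -mulrA mulr_suml mulr_sumr; apply: eq_bigr => a _.
rewrite !mulr_sumr; apply: eq_bigr => b _; rewrite mul1r.
have [ij|_] := eqVneq i j; last by rewrite !mul0r !mulr0.
by subst j; rewrite !mul1r mulrACA.
Qed.

Lemma block_id n m : @block n m n m vertex_id vertex_id = @fid T _.
Proof.
apply/funext => -[i [k l]]; apply/funext => -[j [k' l']].
rewrite /fid /block /vertex_id /= (Idx_eq k l k' l') !xpair_eqE.
by rewrite -!mulnb !natrM.
Qed.

(** A block acting on one of the two vertices turns the triple sum over trees into a single sum,
    which is the form of the sums in [hexagon]. *)
Lemma block1_mull n m n' (J : Type) p (X : idx n' m -> J -> T) (x : idx n m) z :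
  \sum_y @block n m n' m p vertex_id x y * X y z
  = \sum_(k < n' (tag x)) p (tag x) (tagged x).1 k * X (Idx k (tagged x).2) z.
Proof.
case: x => i [k l]; rewrite sum_idx /block /=.
rewrite (bigD1 i) //= [X in _ + X]big1 => [|e ei]; last first.
  by rewrite big1 // => ? _; rewrite big1 // => ? _; rewrite eq_sym (negbTE ei) !mul0r.
rewrite addr0 eqxx; apply: eq_bigr => a _; rewrite mul1r.
under eq_bigr do rewrite -mulrA.
by rewrite -mulr_sumr /vertex_id sum_dltl.
Qed.

Lemma block1_mulr n m n' (J : Type) p (X : J -> idx n m -> T) (x : J)
    (z : idx n' m) :
  \sum_y X x y * @block n m n' m p vertex_id y z
  = \sum_(k < n (tag z)) X x (Idx k (tagged z).2) * p (tag z) k (tagged z).1.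
Proof.
case: z => i [k l]; rewrite sum_idx /block /=.
rewrite (bigD1 i) //= [X in _ + X]big1 => [|e ei]; last first.
  by rewrite big1 // => ? _; rewrite big1 // => ? _; rewrite (negbTE ei) !mul0r mulr0.
rewrite addr0 eqxx; apply: eq_bigr => a _.
under eq_bigr do rewrite mul1r mulrA.
by rewrite /vertex_id sum_dltr.
Qed.

Lemma block2_mulr n m m' (J : Type) q (X : J -> idx n m -> T) (x : J)
    (z : idx n m') :
  \sum_y X x y * @block n m n m' vertex_id q y z
  = \sum_(l < m (tag z)) X x (Idx (tagged z).1 l) * q (tag z) l (tagged z).2.
Proof.
case: z => i [k l]; rewrite sum_idx /block /=.
rewrite (bigD1 i) //= [X in _ + X]big1 => [|e ei]; last first.
  by rewrite big1 // => ? _; rewrite big1 // => ? _; rewrite (negbTE ei) !mul0r mulr0.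
rewrite addr0 eqxx exchange_big; apply: eq_bigr => a _ /=.
under eq_bigr do rewrite mul1r mulrCA mulrC.
by rewrite /vertex_id sum_dltr.
Qed.

End Blocks.

(** * Fusion trees and monodromy *)

Section Monodromy.
Variables (R : realType) (B : braidData R).

Definition lidx (a b c d : obj B) := idx (fun e => N a b e) (fun e => N e c d).
Definition ridx (a b c d : obj B) := idx (fun f => N b c f) (fun f => N a f d).

Definition Fker (a b c d : obj B) : lidx a b c d -> ridx a b c d -> R[i] :=
  fun x y => F a b c d (tag x, val (tagged x).1, val (tagged x).2)
                       (tag y, val (tagged y).1, val (tagged y).2).

Lemma Fker_unitary (hF : F_unitary B) a b c d : funitary (@Fker a b c d).
Proof.
have [h1 h2] := hF a b c d; split; apply/funext => x; apply/funext => y;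
  rewrite /fmul (idxP x) (idxP y) sum_idx /fid Idx_eq.
- exact: h1.
- exact: h2.
Qed.

(** Associativity of fusion: the unitary F is square. *)
Lemma sum_N_assoc (hF : F_unitary B) (a b c d : obj B) :
  (\sum_e N a b e * N e c d = \sum_f N b c f * N a f d)%N.
Proof. by have /funitary_card := @Fker_unitary hF a b c d; rewrite !card_idx. Qed.

Definition monodromy_scalar (x y : obj B) (l : R[i]) : Prop :=
  forall (z : obj B) (mu la : 'I_(N y x z)),
    \sum_(nu < N x y z) Rs x y z mu nu * Rs y x z nu la = l * (mu == la)%:R.

(** On whole spaces of fusion trees the hexagon is a product of matrices, so unitarity of F allows
    solving it for any one braiding. *)
Lemma hexagon_kernel S (hS : hexagon S) a b c d :
  fmul (fmul (@block _ _ (N c a) (fun e => N e b d) (N a c) (fun e => N e b d)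
                   (S a c) (@vertex_id _ _))
             (@Fker a c b d))
       (@block _ _ (N c b) (fun g => N a g d) (N b c) (fun g => N a g d)
                   (S b c) (@vertex_id _ _))
  = fmul (fmul (@Fker c a b d)
       (@block _ _ (N a b) (fun f => N c f d) (N a b) (fun f => N f c d)
                   (@vertex_id _ _) (fun f => S f c d)))
       (@Fker a b c d).
Proof.
apply/funext => -[e [al be]]; apply/funext => -[g [mu nu]].
have := hS a b c d e g al be mu nu.
rewrite /fmul (block1_mulr _ (fun x y => \sum_j block (S a c) (@vertex_id _ _) x j *
  Fker j y)) /=.
rewrite exchange_big /= => h.
transitivity (\sum_(i < N c b g) \sum_(j < N a c e)
  S a c e al j * F a c b d (e, val j, val be) (g, val i, val nu) * S b c g i mu).
  apply: eq_bigr => k _.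
  by rewrite (block1_mull (S a c) (fun x y => Fker x y)) mulr_suml.
rewrite h sum_idx; apply: eq_bigr => f _; apply: eq_bigr => si _.
rewrite exchange_big; apply: eq_bigr => ta' _.
rewrite (block2_mulr _ (fun x y => Fker x y)) mulr_suml.
by apply: eq_bigr => ta _.
Qed.

Hypothesis hB : unitary_braided_fusion B.

Lemma NC (a b c : obj B) : N a b c = N b a c :> nat.
Proof. by case: (ubf_fusion hB). Qed.

Lemma Rs_unitary (a b c : obj B) :
  funitary (fun (k : 'I_(N b a c)) (l : 'I_(N a b c)) => Rs a b c k l).
Proof.
apply: funitary_sq; first exact: NC.
apply/funext => k; apply/funext => l; exact: (ubf_R_unitary hB).
Qed.

(** Since X = R^{xy} is unitary, X Y = l gives Y = l X^*, and then Y X = l. *)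
Lemma monodromy_scalarC x y l : monodromy_scalar x y l -> monodromy_scalar y x l.
Proof.
move=> h z.
pose X (k : 'I_(N y x z)) (l : 'I_(N x y z)) := Rs x y z k l.
pose Y (k : 'I_(N x y z)) (l : 'I_(N y x z)) := Rs y x z k l.
have XY : fmul X Y = fscale l (@fid _ _).
  by apply/funext => mu; apply/funext => la; apply: h.
have [X1 X2] : funitary X := Rs_unitary x y z.
have YX : Y = fscale l (fadj X).
  by rewrite -[Y]fmul1l -X2 -fmulA XY fscaler fmul1r.
move=> mu la; have : fmul Y X mu la = fscale l (@fid _ _) mu la.
  by rewrite YX fscalel X2.
by [].
Qed.

(* Solving the two hexagon equations for [R^{fc}] and [R^{cf}] expresses the
   monodromy of [f] and [c], up to conjugation, through those of [a], [c] and
   [b], [c]. *)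
Lemma monodromy_scalar_fusion (a b c f : obj B) l l' : (0 < N a b f)%N ->
  monodromy_scalar a c l -> monodromy_scalar b c l' -> monodromy_scalar f c (l * l').
Proof.
move=> abf hac hbc d mu la.
have [F1 F1'] := Fker_unitary (ubf_F_unitary hB) c a b d.
have [F2 F2'] := Fker_unitary (ubf_F_unitary hB) a b c d.
have [F3 F3'] := Fker_unitary (ubf_F_unitary hB) a c b d.
have := hexagon_kernel (ubf_hexagon hB) a b c d.
have := hexagon_kernel (ubf_hexagon_inv hB) a b c d.
set A := block (Rs a c) _; set B1 := block (Rs b c) _.
set D := block _ (fun f => Rs f c d).
set A0 := block (Rinv a c) _; set B0 := block (Rinv b c) _.
set D0 := block _ (fun f => Rinv f c d).
pose A' := @block _ _ (N a c) (fun e => N e b d) (N c a) (fun e => N e b d)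
                   (Rs c a) (@vertex_id R[i] _).
pose B' := @block _ _ (N b c) (fun e => N a e d) (N c b) (fun e => N a e d)
                   (Rs c b) (@vertex_id R[i] _).
pose D' := @block _ _ (N a b) (fun f => N f c d) (N a b) (fun f => N c f d)
                   (@vertex_id R[i] _) (fun f => Rs c f d).
have vertex_idC : (fun _ k l => (@vertex_id R[i] _ (vac B) l k)^*) = @vertex_id R[i]
  (obj B).
  apply/funext => i; apply/funext => k; apply/funext => m.
  by rewrite /vertex_id eq_sym rmorph_nat.
(* [Rinv a c] is by definition the adjoint of [Rs c a], so the inverse hexagon speaks of the other
   half of each monodromy. *)
have <- : fadj A' = A0 by rewrite block_adj vertex_idC.
have <- : fadj B' = B0 by rewrite block_adj vertex_idC.
have <- : fadj D' = D0 by rewrite block_adj vertex_idC.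
set G1 := @Fker c a b d; set G2 := @Fker a b c d; set G3 := @Fker a c b d.
have dd n (k l0 : 'I_n) : \sum_(j < n) (k == j :> nat)%:R * (j == l0 :> nat)%:R = (k
  == l0 :> nat)%:R :> R[i].
  exact: sum_dltl.
have scal_block (n m n' : obj B -> nat) (p p' : obj B -> nat -> nat -> R[i]) (t :
  R[i]) :
    (forall i (k m : 'I_(n i)), \sum_(j < n' i) p i k j * p' i j m = t * (k == m)%:R) ->
  fmul (@block _ _ n m n' m p (@vertex_id R[i] _)) (@block _ _ n' m n m p'
    (@vertex_id R[i] _))
    = fscale t (@fid R[i] (idx n m)).
  move=> h; apply/funext => x; apply/funext => y; rewrite blockM /fscale -block_id
    /block.
  have [xy|] := eqVneq (tag x) (tag y); last by rewrite !mul0r mulr0.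
  rewrite !mul1r /vertex_id /=; case: x y xy => i [k0 l0] [j [k1 l1]] /= ij.
  by subst j; rewrite h dd mulrA.
have AA : fmul A A' = fscale l (@fid _ _) by apply: scal_block => e; apply: hac.
have BB : fmul B1 B' = fscale l' (@fid _ _) by apply: scal_block => e; apply: hbc.
(* The inverse hexagon, solved for its middle factor and conjugated, gives [D']; the direct hexagon
   gives [D] just below. *)
move=> /(congr1 (fun X => fadj (fmul (fmul (fadj G1) X) (fadj G2)))).
rewrite -!fmulA F2 fmul1r !fmulA F1' fmul1l !fadjM !fadjK => HD'.
move=> /(congr1 (fun X => fmul (fmul (fadj G1) X) (fadj G2))).
rewrite -!fmulA F2 fmul1r !fmulA F1' fmul1l => HD.
have : fmul D D' = fscale (l * l') (@fid _ _).
  rewrite -HD -HD' -!fmulA (fmulA _ G2) F2' fmul1l (fmulA B1) BB.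
  rewrite fscalel fmul1l !fscaler (fmulA G3) F3 fmul1l (fmulA A) AA.
  by rewrite fscalel fmul1l !fscaler F1' fscaleA mulrC.
(* The scalar is read off on trees with a fixed vertex in V^{ab}_f, which exists by [abf]. *)
move=> /(congr1 (fun X => X (Idx (n := N a b) (m := fun f => N c f d) (Ordinal abf)
  mu) (Idx (n := N a b) (m := fun f => N c f d) (Ordinal abf) la))).
rewrite blockM /block /fscale /fid Idx_eq /= !eqxx /= !mul1r.
rewrite /vertex_id (dd _ (Ordinal abf) (Ordinal abf)) eqxx mul1r => ->.
by rewrite !xpair_eqE !eqxx.
Qed.

End Monodromy.

(** * The vacuum and one-dimensional fusion channels *)

Lemma ord_gt0 n (k : 'I_n) : (0 < n)%N.
Proof. exact: leq_ltn_trans (leq0n k) (ltn_ord k). Qed.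

Lemma ord_eq0 n (k : 'I_n) : n = 1%N -> k = 0%N :> nat.
Proof. by move=> n1; subst n; rewrite ord1. Qed.

Section Collapse.
Variable T : nmodType.

(** For coherence sums in which an abelian anyon leaves [i0] as the only intermediate channel. *)
Lemma sum_collapse (I : finType) (n m : I -> nat) i0
    (g : forall i, 'I_(n i) -> 'I_(m i) -> T) :
  (forall i, i != i0 -> (n i * m i)%N = 0%N) ->
  \sum_i \sum_(k < n i) \sum_(l < m i) g i k l
  = \sum_(k < n i0) \sum_(l < m i0) g i0 k l.
Proof.
move=> h; rewrite (bigD1 i0) //= [X in _ + X]big1 ?addr0 // => i /h nm.
rewrite pair_big big1 // => -[k l] _.
by have := muln_gt0 (n i) (m i); rewrite nm (ord_gt0 k) (ord_gt0 l).
Qed.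

End Collapse.

Lemma phaseV (T : numClosedFieldType) (z : T) : z * z^* = 1 -> `|z| = 1.
Proof. by move=> h; apply/eqP; rewrite -(@pexpr_eq1 _ _ 2) // normCK h. Qed.

Lemma phase_mulC (T : numClosedFieldType) (z : T) : `|z| = 1 -> z * z^* = 1.
Proof. by move=> h; rewrite -normCK h expr1n. Qed.

Section Vacuum.
Variables (R : realType) (B : braidData R).
Hypothesis hB : unitary_braided_fusion B.

Lemma N1l (a b : obj B) : N (vac B) a b = (a == b) :> nat.
Proof. by case: (ubf_fusion hB). Qed.

Lemma N1r (a b : obj B) : N a (vac B) b = (a == b) :> nat.
Proof. by case: (ubf_fusion hB). Qed.

Lemma Ndual (a b : obj B) : N a b (vac B) = (b == dual a) :> nat.
Proof. by case: (ubf_fusion hB). Qed.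

Lemma Rs_phase (x y z : obj B) : N x y z = 1%N -> `|Rs x y z 0%N 0%N| = 1.
Proof.
move=> h; have h' : N y x z = 1%N by rewrite (NC hB).
have l0 : (0 < N y x z)%N by rewrite h'.
have := ubf_R_unitary hB (Ordinal l0) (Ordinal l0).
by rewrite eqxx /= h big_ord1 => /phaseV.
Qed.

Lemma monodromy_scalar_inj (x y z : obj B) l l' : (0 < N y x z)%N ->
  monodromy_scalar x y l -> monodromy_scalar x y l' -> l = l'.
Proof.
move=> h /(_ z (Ordinal h) (Ordinal h)) + /(_ z (Ordinal h) (Ordinal h)).
by rewrite eqxx !mulr1 => -> .
Qed.

Lemma monodromy_scalar_single (x y z : obj B) :
  (forall t, N y x t = (t == z) :> nat) ->
  monodromy_scalar x y (Rs x y z 0%N 0%N * Rs y x z 0%N 0%N).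
Proof.
move=> h t mu la.
have tz : t = z.
  by apply/eqP; have := ord_gt0 mu; rewrite h; case: eqP.
subst t; have h1 : N y x z = 1%N by rewrite h eqxx.
rewrite -val_eqE /= (ord_eq0 mu h1) (ord_eq0 la h1) eqxx mulr1.
by rewrite (NC hB) h1 big_ord1.
Qed.

(** The monodromy t with the vacuum is a phase, and 1 x 1 = 1 makes it satisfy t = t^2. *)
Lemma monodromy_scalar_vac (a : obj B) : monodromy_scalar (vac B) a 1.
Proof.
have N1 t : N a (vac B) t = (t == a) :> nat by rewrite N1r eq_sym.
have h := monodromy_scalar_single N1.
have v0 : (0 < N (vac B) (vac B) (vac B))%N by rewrite N1l eqxx.
have a0 : (0 < N a (vac B) a)%N by rewrite N1 eqxx.
have := monodromy_scalar_inj a0 h (monodromy_scalar_fusion hB v0 h h).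
set t := _ * _ in h * => tt.
have t0 : t != 0.
  rewrite -normr_eq0 normrM !Rs_phase ?mulr1 ?oner_eq0 //.
    by rewrite N1 eqxx.
  by rewrite N1l eqxx.
by rewrite -(mulfV t0) {1}tt mulfK.
Qed.

Lemma F_phase (a b c d e f : obj B) :
  N a b e = 1%N -> N e c d = 1%N -> N b c f = 1%N -> N a f d = 1%N ->
  (forall g, g != f -> (N b c g * N a g d)%N = 0%N) ->
  `|F a b c d (e, 0, 0)%N (f, 0, 0)%N| = 1.
Proof.
move=> h1 h2 h3 h4 hf; apply: phaseV.
have l1 : (0 < N a b e)%N by rewrite h1.
have l2 : (0 < N e c d)%N by rewrite h2.
have := (ubf_F_unitary hB a b c d).1 e e (Ordinal l1) (Ordinal l2)
  (Ordinal l1) (Ordinal l2).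
rewrite eqxx (@sum_collapse _ _ _ _ f (fun f (mu : 'I__) (nu : 'I__) =>
  F a b c d (e, 0, 0)%N (f, val mu, val nu) *
  (F a b c d (e, 0, 0)%N (f, val mu, val nu))^*)) //.
by rewrite h3 h4 !big_ord1.
Qed.

End Vacuum.

(** * Fusion with the fermion and the grading by monodromy with it *)

Section Fermion.
Variables (R : realType) (B : braidData R) (p : obj B).
Hypothesis hB : unitary_braided_fusion B.
Hypothesis hpp : forall c, N p p c = (c == vac B) :> nat.

(** Associativity of psi x psi x a with psi x psi = 1. A sum of naturals equal to 1 will force psi x
    a to be a single anyon. *)
Lemma fermion_assoc (a d : obj B) :
  (\sum_f N p a f * N p f d)%N = (a == d).
Proof.
rewrite -(sum_N_assoc (ubf_F_unitary hB) p p a d) (bigD1 (vac B)) //=.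
rewrite hpp eqxx mul1n (N1l hB) big1 ?addn0 // => e ev.
by rewrite hpp (negbTE ev).
Qed.

(* The anyon psi x a; the default value is never reached, see [N_shift]. *)
Definition shift (a : obj B) : obj B := odflt a [pick f | (0 < N p a f)%N].

Lemma shift_gt0 a : (0 < N p a (shift a))%N.
Proof.
rewrite /shift; case: pickP => //= h; have := fermion_assoc a a.
by rewrite eqxx big1 // => f _; have := h f; case: (N p a f).
Qed.

Lemma N_shift_shift a : (0 < N p (shift a) a)%N.
Proof.
have h := shift_gt0 (shift a); have := fermion_assoc a (shift (shift a)).
rewrite (bigD1 (shift a)) //=; case: eqP => [E _|_ /= /eqP]; first by rewrite {2}E.
rewrite addn_eq0 muln_eq0 => /andP[/orP[]/eqP h0 _].
  by have := shift_gt0 a; rewrite h0.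
by rewrite h0 in h.
Qed.

Lemma N_shift a f : N p a f = (f == shift a) :> nat.
Proof.
have := fermion_assoc a a; rewrite eqxx (bigD1 (shift a)) //= => h.
have g1 := shift_gt0 a; have g2 := N_shift_shift a.
have hs : (N p a (shift a) * N p (shift a) a)%N = 1%N.
  apply/eqP; rewrite eqn_leq muln_gt0 g1 g2 andbT.
  by rewrite -[X in (_ <= X)%N]h leq_addr.
have [->|fs] := eqVneq f (shift a).
  by have /eqP := hs; rewrite muln_eq1 => /andP[/eqP].
move: h; rewrite hs => /eqP; rewrite -[X in _ == X]addn0 eqn_add2l sum_nat_eq0.
move=> /forallP /(_ f); rewrite fs muln_eq0 => /orP[/eqP->//|/eqP h0].
apply/eqP; rewrite -leqn0 leqNgt; apply/negP => paf.
(* If f occurs in psi x a, the term of f is positive for d = [shift f]. Hence a = [shift f], and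
   [N p f a] cannot vanish, contrary to [h0]. *)
have := fermion_assoc a (shift f); rewrite (bigD1 f) //=.
case: eqP => [ae _|_ /= /eqP].
  by move: h0; rewrite ae => h0; have := shift_gt0 f; rewrite h0.
rewrite addn_eq0 muln_eq0 => /andP[/orP[]/eqP h1 _].
  by rewrite h1 in paf.
by have := shift_gt0 f; rewrite h1.
Qed.

Lemma N_shiftr a f : N a p f = (f == shift a) :> nat.
Proof. by rewrite (NC hB) N_shift. Qed.

Lemma shiftK : involutive shift.
Proof.
by move=> a; apply/eqP; have := N_shift_shift a; rewrite N_shift eq_sym; case: eqP.
Qed.

Lemma shift_vac : shift (vac B) = p.
Proof. by apply/eqP; have := N_shiftr (vac B) p; rewrite (N1l hB) eqxx eq_sym; case:
  eqP. Qed.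

(** The value [true] marks the vortices, whose monodromy with psi is -1. *)
Definition grade (a : obj B) : bool := ~~ `[< braids_trivially p a >].

Lemma braids_trivially_scalar1 a : braids_trivially p a <-> monodromy_scalar p a 1.
Proof. by split=> h c mu la; rewrite ?mul1r ?h // -[RHS]mul1r. Qed.

(** Since psi x a is one anyon the monodromy is a scalar l, and psi x psi = 1 gives l^2 = 1. *)
Lemma monodromy_scalar_grade a : monodromy_scalar p a ((-1) ^+ grade a).
Proof.
have h := monodromy_scalar_single hB (N_shiftr a).
set l := _ * _ in h.
have pp0 : (0 < N p p (vac B))%N by rewrite hpp eqxx.
have a0 : (0 < N a (vac B) a)%N by rewrite (N1r hB) eqxx.
have := monodromy_scalar_inj a0 (monodromy_scalar_fusion hB pp0 h h)
  (@monodromy_scalar_vac _ _ hB a).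
move=> /eqP; rewrite -expr2 sqrf_eq1 /grade => /orP[]/eqP l1; rewrite l1 in h.
  by rewrite asboolT ?expr0 //; apply/braids_trivially_scalar1.
rewrite asboolF ?expr1 // => /braids_trivially_scalar1 h1.
have a1 : (0 < N a p (shift a))%N by rewrite N_shiftr eqxx.
have /eqP := monodromy_scalar_inj a1 h h1.
by rewrite eq_sym -subr_eq0 opprK -(natrD _ 1 1) pnatr_eq0.
Qed.

Lemma sign_inj (T : numDomainType) (b c : bool) :
  (-1) ^+ b = (-1) ^+ c :> T -> b = c.
Proof.
by case: b c => -[] // /eqP; rewrite ?expr0 ?expr1 ?[-1 == _]eq_sym -subr_eq0 opprK
  -(natrD _ 1 1) pnatr_eq0.
Qed.

Lemma gradeP a (e : bool) : monodromy_scalar p a ((-1) ^+ e) -> grade a = e.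
Proof.
move=> h; apply: (@sign_inj R[i]).
have a1 : (0 < N a p (shift a))%N by rewrite N_shiftr eqxx.
exact: monodromy_scalar_inj a1 (@monodromy_scalar_grade a) h.
Qed.

(** Monodromy scalars multiply under fusion in the first argument, whence the exchanges of
    arguments. *)
Lemma gradeM (a b c : obj B) : (0 < N a b c)%N -> grade c = grade a (+) grade b.
Proof.
move=> abc; apply: gradeP; apply: (monodromy_scalarC hB).
have ha := monodromy_scalarC hB (@monodromy_scalar_grade a).
have hb := monodromy_scalarC hB (@monodromy_scalar_grade b).
by have := monodromy_scalar_fusion hB abc ha hb; rewrite signr_addb.
Qed.

Hypothesis hRpp : Rs p p (vac B) 0%N 0%N = -1.

Lemma grade_p : grade p = false.
Proof.
apply: gradeP; have := monodromy_scalar_single hB hpp.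
by rewrite hRpp mulrNN mulr1.
Qed.

Lemma grade_shift a : grade (shift a) = grade a.
Proof. by rewrite (gradeM (shift_gt0 a)) grade_p. Qed.

End Fermion.

(** * The twist and the quantum dimension of psi x a *)

Section Ribbon.
Variables (R : realType) (B : braidData R) (p : obj B).
Hypothesis hB : unitary_braided_fusion B.
Hypothesis hpp : forall c, N p p c = (c == vac B) :> nat.

Notation shift := (shift p).
Let shiftK := shiftK hB hpp.
Let Nl := N_shift hB hpp.
Let Nr := N_shiftr hB hpp.

Lemma shift_eq a b : (a == shift b) = (b == shift a).
Proof. by rewrite -(inj_eq (inv_inj shiftK)) shiftK eq_sym. Qed.

(** With psi as an outer anyon only one intermediate anyon survives on each side, so the whole
    F-matrix is this block. The next lemma does the same for psi in the middle. *)
Lemma F_first_unitary a z d e f : e = shift a -> f = shift d ->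
  funitary (fun (i : 'I_(N e z d)) (j : 'I_(N a z f)) =>
              F p a z d (e, 0, val i)%N (f, val j, 0)%N).
Proof.
move=> ea fd.
have pae : N p a e = 1%N by rewrite Nl ea eqxx.
have pfd : N p f d = 1%N by rewrite Nl fd shiftK eqxx.
have le : (0 < N p a e)%N by rewrite pae.
have lf : (0 < N p f d)%N by rewrite pfd.
have [h1 h2] := ubf_F_unitary hB p a z d.
split; apply/funext => i; apply/funext => j; rewrite /fid -val_eqE /fmul /=.
- have := h1 e e (Ordinal le) i (Ordinal le) j.
  rewrite /= (@sum_collapse _ _ _ _ f (fun f mu nu =>
    F p a z d (e, 0, val i)%N (f, val mu, val nu) *
    (F p a z d (e, 0, val j)%N (f, val mu, val nu))^*)) => [|g gf]; last first.
    by rewrite Nl shift_eq -fd (negbTE gf) muln0.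
  rewrite !xpair_eqE !eqxx /= => <-; apply: eq_bigr => k _.
  by rewrite pfd big_ord1.
- have := h2 f f i (Ordinal lf) j (Ordinal lf).
  rewrite /= (@sum_collapse _ _ _ _ e (fun e mu nu =>
    (F p a z d (e, val mu, val nu)%N (f, val i, 0)%N)^* *
    F p a z d (e, val mu, val nu)%N (f, val j, 0)%N)) => [|g ge]; last first.
    by rewrite Nl -ea (negbTE ge).
  by rewrite !xpair_eqE !eqxx /= andbT => <-; rewrite pae big_ord1.
Qed.

Lemma F_middle_unitary x z d e f : e = shift x -> f = shift z ->
  funitary (fun (i : 'I_(N e z d)) (j : 'I_(N x f d)) =>
              F x p z d (e, 0, val i)%N (f, 0, val j)%N).
Proof.
move=> ex fz.
have xpe : N x p e = 1%N by rewrite Nr ex eqxx.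
have pzf : N p z f = 1%N by rewrite Nl fz eqxx.
have le : (0 < N x p e)%N by rewrite xpe.
have lf : (0 < N p z f)%N by rewrite pzf.
have [h1 h2] := ubf_F_unitary hB x p z d.
split; apply/funext => i; apply/funext => j; rewrite /fid -val_eqE /fmul /=.
- have := h1 e e (Ordinal le) i (Ordinal le) j.
  rewrite /= (@sum_collapse _ _ _ _ f (fun f mu nu =>
    F x p z d (e, 0, val i)%N (f, val mu, val nu) *
    (F x p z d (e, 0, val j)%N (f, val mu, val nu))^*)) => [|g gf]; last first.
    by rewrite Nl -fz (negbTE gf).
  by rewrite !xpair_eqE !eqxx /= => <-; rewrite pzf big_ord1.
- have := h2 f f (Ordinal lf) i (Ordinal lf) j.
  rewrite /= (@sum_collapse _ _ _ _ e (fun e mu nu =>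
    (F x p z d (e, val mu, val nu)%N (f, 0, val i)%N)^* *
    F x p z d (e, val mu, val nu)%N (f, 0, val j)%N)) => [|g ge]; last first.
    by rewrite Nr -ex (negbTE ge).
  by rewrite !xpair_eqE !eqxx /= => <-; rewrite xpe big_ord1.
Qed.

Section Twist.
Variables a c : obj B.
Let a' := shift a.
Let c' := shift c.

(** [Z], [Y] and [Q] are the braidings of psi a with psi a, of a with psi a, and of a with a. The
    [X]'s are the F-moves that carry psi from one of these to another; [phi] is a phase. *)
Let X1 (i : 'I_(N a a c)) (j : 'I_(N a' a' c)) :=
  F a' p a c (a, 0, val i)%N (a', 0, val j)%N.
Let X2 (i : 'I_(N a' a' c)) (j : 'I_(N a a' c')) :=
  F p a a' c (a', 0, val i)%N (c', val j, 0)%N.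
Let X3 (i : 'I_(N a a c)) (j : 'I_(N a' a c')) :=
  F p a' a c (a, 0, val i)%N (c', val j, 0)%N.
Let X4 (i : 'I_(N a' a c')) (j : 'I_(N a a' c')) :=
  F a p a c' (a', 0, val i)%N (a', 0, val j)%N.
Let X5 (i : 'I_(N a' a c')) (j : 'I_(N a a c)) :=
  F p a a c' (a', 0, val i)%N (c, val j, 0)%N.
Let Q (i j : 'I_(N a a c)) := Rs a a c (val i) (val j).
Let Y (i : 'I_(N a' a c')) (j : 'I_(N a a' c')) := Rs a a' c' (val i) (val j).
Let Z (i j : 'I_(N a' a' c)) := Rs a' a' c (val i) (val j).
Let phi := F p a p a (a', 0, 0)%N (a', 0, 0)%N.

Let paa' : N p a a' = 1%N. Proof. by rewrite Nl eqxx. Qed.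
Let apa' : N a p a' = 1%N. Proof. by rewrite Nr eqxx. Qed.
Let pa'a : N p a' a = 1%N. Proof. by rewrite Nl shiftK eqxx. Qed.
Let a'pa : N a' p a = 1%N. Proof. by rewrite Nr shiftK eqxx. Qed.
Let pc'c : N p c' c = 1%N. Proof. by rewrite Nl shiftK eqxx. Qed.
Let pcc' : N p c c' = 1%N. Proof. by rewrite Nl eqxx. Qed.

Let o1 : (0 < N p a a')%N. Proof. by rewrite paa'. Qed.
Let o2 : (0 < N a p a')%N. Proof. by rewrite apa'. Qed.
Let o3 : (0 < N p a' a)%N. Proof. by rewrite pa'a. Qed.
Let o4 : (0 < N a' p a)%N. Proof. by rewrite a'pa. Qed.
Let o5 : (0 < N p c' c)%N. Proof. by rewrite pc'c. Qed.
Let o6 : (0 < N p c c')%N. Proof. by rewrite pcc'. Qed.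

(** The pentagon for psi, a, psi, a fusing to c. *)
Lemma twist_pentagon : fmul X1 X2 = fscale phi (fmul X3 X4).
Proof.
apply/funext => i; apply/funext => j.
have := @ubf_pentagon _ _ hB p a p a c a' a c' a' (Ordinal o1) (Ordinal o4) i
  (Ordinal o1) j (Ordinal o5).
rewrite /= (@sum_collapse _ _ _ _ a' (fun h (si : 'I__) (ta : 'I__) =>
   \sum_(rh < N h a c')
       F p a p a (a', 0, 0)%N (h, val si, val ta)
       * F p h a c (a, val ta, val i) (c', val rh, 0)%N
       * F a p a c' (h, val si, val rh) (a', 0, val j)%N)) => [|h ha]; last first.
  by rewrite Nr (negbTE ha).
rewrite apa' pa'a !big_ord1 => h.
rewrite /fmul /fscale mulr_sumr.
rewrite [LHS]h; apply: eq_bigr => k _; by rewrite -mulrA.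
Qed.

(** Braiding psi and a, fused to psi a, with a third strand psi a: this splits [Z] into R^{psi, psi
    a} and [Y]. *)
Lemma twist_hexagon1 :
  fscale (Rs p a' a 0%N 0%N) (fmul X3 Y) = fmul X1 (fmul Z X2).
Proof.
apply/funext => i; apply/funext => j.
have := @ubf_hexagon _ _ hB p a a' c a c' (Ordinal o4) i j (Ordinal o5).
rewrite /= (@sum_collapse _ _ _ _ a' (fun f (si : 'I__) (ta : 'I__) =>
   \sum_(ta' < N f a' c)
       F a' p a c (a, 0, val i)%N (f, val si, val ta)
       * Rs f a' c ta ta'
       * F p a a' c (f, val si, val ta') (c', val j, 0)%N)) => [|h ha]; last first.
  by rewrite Nl (negbTE ha).
rewrite pa'a big_ord1 paa' big_ord1 => h.
rewrite /fmul /fscale mulr_sumr.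
transitivity (\sum_(mu' < N a' a c')
  Rs p a' a 0%N 0%N * F p a' a c (a, 0, val i)%N (c', val mu', 0)%N *
  Rs a a' c' mu' j); first by apply: eq_bigr => k _; rewrite mulrA.
rewrite h; apply: eq_bigr => k _; rewrite mulr_sumr.
by apply: eq_bigr => l _; rewrite mulrA.
Qed.

(** In [Y] the composite psi a is the second strand; it is split by the inverse hexagon, which
    involves the adjoints of [Y] and [Q]. *)
Lemma twist_hexagon2 :
  fscale (Rs a p a' 0%N 0%N)^* (fmul X5 (fadj Q)) = fmul X4 (fmul (fadj Y) X5).
Proof.
apply/funext => i; apply/funext => j.
have := @ubf_hexagon_inv _ _ hB p a a c' a' c (Ordinal o2) i j (Ordinal o6).
rewrite /= (@sum_collapse _ _ _ _ a' (fun f (si : 'I__) (ta : 'I__) =>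
   \sum_(ta' < N f a c')
       F a p a c' (a', 0, val i)%N (f, val si, val ta)
       * Rinv f a c' ta ta'
       * F p a a c' (f, val si, val ta') (c, val j, 0)%N)) => [|h ha]; last first.
  by rewrite Nl (negbTE ha).
rewrite paa' !big_ord1 => h.
rewrite /fmul /fscale mulr_sumr.
transitivity (\sum_(mu' < N a a c)
  Rinv p a a' 0%N 0%N * F p a a c' (a', 0, val i)%N (c, val mu', 0)%N *
  Rinv a a c mu' j); first by apply: eq_bigr => k _; rewrite mulrA.
rewrite h; apply: eq_bigr => k _; rewrite mulr_sumr.
by apply: eq_bigr => l _; rewrite mulrA.
Qed.

(** Braiding psi a with psi: here the exchange phase of psi enters, and a factor [phi] appears. *)
Lemma twist_hexagon3 :
  Rs p p (vac B) 0%N 0%N * Rs a p a' 0%N 0%N = Rs a' p a 0%N 0%N * phi.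
Proof.
have npp : N p p (vac B) = 1%N by rewrite hpp eqxx.
have opp : (0 < N p p (vac B))%N by rewrite npp.
have naa : N (vac B) a a = 1%N by rewrite (N1l hB) eqxx.
have oaa : (0 < N (vac B) a a)%N by rewrite naa.
have := @ubf_hexagon _ _ hB p a p a (vac B) a' (Ordinal opp) (Ordinal oaa)
  (Ordinal o2) (Ordinal o3).
rewrite /= (@sum_collapse _ _ _ _ a' (fun f (si : 'I__) (ta : 'I__) =>
   \sum_(ta' < N f p a)
       F p p a a (vac B, 0, 0)%N (f, val si, val ta)
       * Rs f p a ta ta'
       * F p a p a (f, val si, val ta') (a', 0, 0)%N)) => [|h ha]; last first.
  by rewrite Nl (negbTE ha).
rewrite npp !big_ord1 paa' big_ord1 pa'a big_ord1 a'pa big_ord1 big_ord1 /=.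
have F1 : `|F p p a a (vac B, 0, 0)%N (a', 0, 0)%N| = 1.
  apply: F_phase => // g ga; first by rewrite Nl (negbTE ga).
set f := F p p a a _ _ => h.
have f0 : f != 0 by rewrite -normr_eq0 F1 oner_eq0.
by apply: (mulfI f0); rewrite mulrA (mulrC f) h -mulrA.
Qed.

Hypothesis hRpp : Rs p p (vac B) 0%N 0%N = -1.

(* Conjugating the braiding of [psi a] with itself by [F]-moves reduces it to
   that of [a] with itself, up to the exchange phase -1 of [psi] and the
   monodromy of [psi] with [psi a]. *)
Lemma trace_Rs_shift :
  \sum_(i < N a' a' c) Rs a' a' c i i
  = - (-1) ^+ grade p a * \sum_(i < N a a c) Rs a a c i i.
Proof.
have [U1 U1'] : funitary X1 by apply: F_middle_unitary; rewrite ?shiftK.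
have [U2 U2'] : funitary X2 by apply: F_first_unitary.
have [U3 U3'] : funitary X3 by apply: F_first_unitary; rewrite ?shiftK.
have [U4 U4'] : funitary X4 by apply: F_middle_unitary.
have [U5 U5'] : funitary X5 by apply: F_first_unitary; rewrite ?shiftK.
have hY : Y = fscale (Rs a p a' 0%N 0%N) (fmul X5 (fmul Q (fmul (fadj X5) X4))).
  have := twist_hexagon2 => /(congr1 (fun X => fadj (fmul (fmul (fadj X4) X) (fadj
    X5)))).
  rewrite fscaler fscalel fadj_scale conjCK !fadjM !fadjK.
  by rewrite -!fmulA => ->; rewrite U4' fmul1r fmulA U5 fmul1l.
have hZ : Z = fscale (Rs p a' a 0%N 0%N) (fmul (fadj X1) (fmul X3 (fmul Y (fadj X2)))).
  have := twist_hexagon1 => /(congr1 (fun X => fmul (fmul (fadj X1) X) (fadj X2))).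
  rewrite fscaler fscalel -!fmulA => ->.
  by rewrite U2 fmul1r fmulA U1' fmul1l.
(* Closing up the trace brings these F-moves together; the pentagon reduces them to the scalar
   [phi^*], which will cancel the [phi] of [twist_hexagon3]. *)
have hP : fmul (fmul X4 (fmul (fadj X2) (fadj X1))) X3 = fscale phi^* (@fid _ _).
  rewrite -fadjM twist_pentagon fadj_scale fadjM fscaler fscalel.
  by rewrite (fmulA X4) U4 fmul1l U3'.
have phi1 : phi * phi^* = 1.
  apply: phase_mulC; apply: F_phase => // g ga; by rewrite Nr (negbTE ga).
(* The two remaining braidings with psi form the monodromy of psi with psi a, and [shift] preserves
   the grade. *)
have hr : Rs p a' a 0%N 0%N * Rs a' p a 0%N 0%N = (-1) ^+ grade p a.
  have h : forall t, N a' p t = (t == a) by move=> t; rewrite Nr shiftK.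
  have a0 : (0 < N a' p a)%N by rewrite h eqxx.
  rewrite -(grade_shift hB hpp hRpp a).
  exact: (monodromy_scalar_inj a0 (monodromy_scalar_single hB h)
    (@monodromy_scalar_grade _ _ _ hB hpp a')).
have := twist_hexagon3; rewrite hRpp => h3.
rewrite -[LHS]/(ftrace Z) -[X in _ = _ * X]/(ftrace Q) hZ ftrace_scale hY.
rewrite !(fscalel, fscaler) ftrace_scale.
have -> : ftrace (fmul (fadj X1) (fmul X3 (fmul (fmul X5 (fmul Q (fmul (fadj X5)
  X4))) (fadj X2))))
   = phi^* * ftrace Q.
  have -> : fmul (fadj X1) (fmul X3 (fmul (fmul X5 (fmul Q (fmul (fadj X5) X4)))
    (fadj X2)))
    = fmul (fmul (fadj X1) (fmul X3 (fmul X5 (fmul Q (fadj X5))))) (fmul X4 (fadj X2)).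
    by rewrite -!fmulA.
  rewrite ftraceC (fmulA (fmul X4 _)) -(fmulA X4) (fmulA (fmul X4 _)) hP.
  by rewrite fscalel fmul1l ftrace_scale ftraceC -fmulA U5' fmul1r.
rewrite !mulrA; congr (_ * _).
have -> : Rs a p a' 0%N 0%N = - (Rs a' p a 0%N 0%N * phi) by rewrite -h3 mulN1r opprK.
by rewrite mulrN mulrA hr mulNr -mulrA phi1 mulr1.
Qed.

End Twist.
End Ribbon.

(** * Quantum dimensions and the even part of the Gauss sum *)

Section GaussEven.
Variables (R : realType) (B : braidData R) (p : obj B).
Hypothesis hB : unitary_braided_fusion B.
Hypothesis hpp : forall c, N p p c = (c == vac B) :> nat.

Notation shift := (shift p).
Let shiftK := shiftK hB hpp.
Let Nl := N_shift hB hpp.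
Let Nr := N_shiftr hB hpp.

Lemma dual_shift a : dual (shift a) = shift (dual a).
Proof.
have := sum_N_assoc (ubf_F_unitary hB) a p (shift (dual a)) (vac B).
rewrite (bigD1 (shift a)) //= big1 ?addn0 => [|i ia]; last by rewrite Nr (negbTE ia).
rewrite (bigD1 (dual a)) //= big1 ?addn0 => [|i ia]; last by rewrite Nl shiftK
  (negbTE ia).
by rewrite Nr eqxx mul1n Nl shiftK eqxx mul1n !(Ndual hB) eqxx; case: eqP.
Qed.

Lemma N_dual_p a : N a (shift (dual a)) p = 1%N.
Proof.
have := sum_N_assoc (ubf_F_unitary hB) p a (shift (dual a)) (vac B).
rewrite (bigD1 (shift a)) //= big1 ?addn0 => [|i ia]; last by rewrite Nl (negbTE ia).
have h i : N p i (vac B) = (i == p) :> nat.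
  by rewrite Nl (shift_eq hB hpp) (shift_vac hB hpp).
rewrite (bigD1 p) //= big1 ?addn0 => [|i ia]; last by rewrite h (negbTE ia) muln0.
by rewrite h eqxx muln1 Nl eqxx mul1n (Ndual hB) dual_shift eqxx.
Qed.

Lemma qdim_shift a : qdim (shift a) = qdim a.
Proof.
rewrite /qdim dual_shift; congr (_^-1).
set a' := shift a; set b := dual a; set b' := shift b; set v := vac B.
have n1 : N p a a' = 1%N by rewrite Nl eqxx.
have n2 : N a' b' v = 1%N by rewrite (Ndual hB) dual_shift eqxx.
have n3 : N v a' a' = 1%N by rewrite (N1l hB) eqxx.
have n4 : N b' a' v = 1%N by rewrite (NC hB).
have n5 : N a v a = 1%N by rewrite (N1r hB) eqxx.
have n6 : N p p v = 1%N by rewrite hpp eqxx.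
have n7 : N p a' a = 1%N by rewrite Nl shiftK eqxx.
have n8 : N a b v = 1%N by rewrite (Ndual hB) eqxx.
have n9 : N v p p = 1%N by rewrite (N1l hB) eqxx.
have n10 : N b a v = 1%N by rewrite (NC hB).
have n11 : N a' v a' = 1%N by rewrite (N1r hB) eqxx.
have n12 : N a b' p = 1%N by apply: N_dual_p.
have n13 : N v a a = 1%N by rewrite (N1l hB) eqxx.
have n14 : N b p b' = 1%N by rewrite Nr eqxx.
have Npv i : N p i v = (i == p) :> nat.
  by rewrite Nl (shift_eq hB hpp) (shift_vac hB hpp).
have l1 : (0 < N p a a')%N by rewrite n1.
have l2 : (0 < N a' b' v)%N by rewrite n2.
have l3 : (0 < N v a' a')%N by rewrite n3.
have l4 : (0 < N b' a' v)%N by rewrite n4.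
have l5 : (0 < N a v a)%N by rewrite n5.
have l6 : (0 < N p a' a)%N by rewrite n7.
have l7 : (0 < N a b v)%N by rewrite n8.
have l8 : (0 < N v p p)%N by rewrite n9.
have l9 : (0 < N b a v)%N by rewrite n10.
have [_ _ tri3] := ubf_triangle hB; have [tri1 _ _] := ubf_triangle hB.
(* The middle term passes from the channel psi of a x psi a^* to the vacuum channel. One pentagon
   starting with psi links it to the F-symbol of psi a, another with psi in third place to that of
   a. All other factors are phases or are fixed by the triangle. *)
transitivity `|F a b' a' a (p, 0, 0)%N (v, 0, 0)%N|.
- have := @ubf_pentagon _ _ hB p a b' a' a' a' v a v (Ordinal l1) (Ordinal l2)
    (Ordinal l3) (Ordinal l4) (Ordinal l5) (Ordinal l1).
  rewrite /= (@sum_collapse _ _ _ _ p (fun h (si : 'I__) (ta : 'I__) =>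
     \sum_(rh < N h a' a)
         F p a b' v (a', 0, 0)%N (h, val si, val ta)
         * F p h a' a' (v, val ta, 0)%N (a, val rh, 0)%N
         * F a b' a' a (h, val si, val rh) (v, 0, 0)%N)) => [|h ha]; last first.
    by rewrite Npv (negbTE ha) muln0.
  rewrite n11 n12 n6 n7 !big_ord1 /=.
  rewrite (tri3 p a a' (Ordinal l1) (Ordinal l1)) eqxx mulr1 => ->.
  have e1 : `|F p a b' v (a', 0, 0)%N (p, 0, 0)%N| = 1.
    by apply: F_phase => // g gn; rewrite Npv (negbTE gn) muln0.
  have e2 : `|F p p a' a' (v, 0, 0)%N (a, 0, 0)%N| = 1.
    by apply: F_phase => // g gn; rewrite Nl shiftK (negbTE gn).
  by rewrite !normrM e1 e2 !mul1r.
- have := @ubf_pentagon _ _ hB a b p a' a v p v a (Ordinal l7) (Ordinal l8)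
    (Ordinal l6) (Ordinal l6) (Ordinal l9) (Ordinal l5).
  rewrite /= (@sum_collapse _ _ _ _ b' (fun h (si : 'I__) (ta : 'I__) =>
     \sum_(rh < N h a' v)
         F a b p p (v, 0, 0)%N (h, val si, val ta)
         * F a h a' a (p, val ta, 0)%N (v, val rh, 0)%N
         * F b p a' v (h, val si, val rh) (a, 0, 0)%N)) => [|h ha]; last first.
    by rewrite Nr (negbTE ha).
  rewrite n13 n14 n12 n4 !big_ord1 /=.
  rewrite (tri1 p a' a (Ordinal l6) (Ordinal l6)) eqxx mul1r => ->.
  have e1 : `|F a b p p (v, 0, 0)%N (b', 0, 0)%N| = 1.
    by apply: F_phase => // g gn; rewrite Nr (negbTE gn).
  have e2 : `|F b p a' v (b', 0, 0)%N (a, 0, 0)%N| = 1.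
    by apply: F_phase => // g gn; rewrite Nl shiftK (negbTE gn).
  by rewrite !normrM e1 e2 mul1r mulr1.
Qed.

Hypothesis hRpp : Rs p p (vac B) 0%N 0%N = -1.

Lemma theta_shift a : theta (shift a) = - (-1) ^+ grade p a * theta a.
Proof.
rewrite /theta mulr_sumr; apply: eq_bigr => c _.
by rewrite (trace_Rs_shift hB hpp) // qdim_shift mulrCA.
Qed.

Lemma gauss_even :
  \sum_(a : obj B | ~~ grade p a) qdim a ^+ 2 * theta a = 0.
Proof.
set S := \sum_(_ | _) _.
suff h : S = - S.
  have /eqP : S *+ 2 = 0 by rewrite mulr2n {1}h addNr.
  by rewrite mulrn_eq0 => /eqP.
rewrite {1}/S (reindex_inj (inv_inj shiftK)) /= -sumrN; apply: eq_big => a.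
  by rewrite (grade_shift hB hpp).
rewrite (grade_shift hB hpp) // => /negbTE ga.
by rewrite qdim_shift theta_shift ga expr0 mulN1r mulrN.
Qed.

End GaussEven.

(** * The twisted extension *)

Section Twisting.
Variables (R : realType) (B : braidData R) (g : obj B -> bool).

Definition twist : braidData R :=
  @BraidData R (obj B) (vac B) (@dual R B) (@N R B) (@F R B)
    (fun a b c mu nu => (-1) ^+ (g a && g b) * Rs a b c mu nu).

Hypothesis gM : forall a b c : obj B, (0 < N a b c)%N -> g c = g a (+) g b.

(** The sign is a bicharacter of the grading, so both sides acquire the sign of the pair f, c with f
    in a x b. [S] is arbitrary to cover [Rs] and [Rinv], the sign being real and symmetric. *)
Lemma twist_hexagon (S : obj B -> obj B -> obj B -> nat -> nat -> R[i]) :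
  hexagon S ->
  @hexagon R twist (fun a b c mu nu => (-1) ^+ (g a && g b) * S a b c mu nu).
Proof.
move=> h a b c d e f al be mu nu /=.
have := h a b c d e f al be mu nu.
move=> /(congr1 (fun x => (-1) ^+ ((g a (+) g b) && g c) * x)).
rewrite !mulr_sumr => h'.
transitivity (\sum_(i < N a c e) (-1) ^+ ((g a (+) g b) && g c) *
  \sum_(mu' < N c b f) S a c e al i * F a c b d (e, val i, val be) (f, val mu', val
    nu) * S b c f mu' mu).
  apply: eq_bigr => i _; rewrite mulr_sumr; apply: eq_bigr => j _.
  have -> : (-1) ^+ ((g a (+) g b) && g c) = (-1) ^+ (g a && g c) * (-1) ^+ (g b && g
    c) :> R[i].
    by rewrite -signr_addb; case: (g a) (g b) (g c) => -[] [].
  by rewrite [in LHS]mulrACA -!mulrA; congr (_ * _); rewrite mulrCA.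
rewrite h'; apply: eq_bigr => x _; rewrite mulr_sumr; apply: eq_bigr => si _.
rewrite -(gM (ord_gt0 si)) mulr_sumr; apply: eq_bigr => ta _.
rewrite mulr_sumr; apply: eq_bigr => ta' _.
by rewrite !mulrA; congr (_ * _); rewrite -!mulrA mulrCA.
Qed.

Lemma twist_ubf : unitary_braided_fusion B -> unitary_braided_fusion twist.
Proof.
case=> h1 h2 h3 h4 h5 h6 h7; split=> //.
- move=> a b c mu mu' /=; rewrite -(h3 a b c mu mu').
  apply: eq_bigr => nu _; rewrite rmorphM /= rmorph_sign mulrACA -signr_addb.
  by rewrite addbb mul1r.
- exact: twist_hexagon.
- suff -> : @Rinv R twist = (fun a b c mu nu => (-1) ^+ (g a && g b) * @Rinv R B a b
  c mu nu).
    exact: twist_hexagon.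
  apply/funext => a; apply/funext => b; apply/funext => c.
  apply/funext => mu; apply/funext => nu.
  by rewrite /Rinv /= rmorphM /= rmorph_sign andbC.
Qed.

Lemma twist_monodromy (a b : obj B) :
  @braids_trivially R twist a b <-> braids_trivially a b.
Proof.
suff h (c : obj B) (mu la : 'I_(N b a c)) :
    \sum_(nu < N a b c) @Rs R twist a b c mu nu * @Rs R twist b a c nu la
    = \sum_(nu < N a b c) Rs a b c mu nu * Rs b a c nu la.
  by split=> H c mu la; have := H c mu la; rewrite -?h => //= <-; rewrite -h.
apply: eq_bigr => nu _ /=.
by rewrite mulrACA (andbC (g b)) -signr_addb addbb mul1r.
Qed.

Lemma twist_modular : modular B -> modular twist.
Proof.
case=> h1 h2; split; first exact: twist_ubf.
by move=> a ha; apply: h2 => x; apply/twist_monodromy; apply: ha.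
Qed.

Lemma theta_twist (a : obj B) : @theta R twist a = (-1) ^+ g a * theta a.
Proof.
rewrite /theta mulr_sumr; apply: eq_bigr => c _ /=.
by rewrite andbb -mulr_sumr mulrCA.
Qed.

End Twisting.

(** * Minimal modular extensions and their twist *)

Section SuperModular.
Variables (R : realType) (C : braidData R) (psi : obj C).
Hypothesis hC : super_modular psi.

(** Here theta_psi = x R^{psi psi} with x = d_1 / d_psi nonnegative and R^{psi psi} a phase; taking
    moduli gives x = 1. *)
Lemma Rs_fermion : Rs psi psi (vac C) 0%N 0%N = -1.
Proof.
case: hC => hB _ _ th hpp.
have n1 : N psi psi (vac C) = 1%N by rewrite hpp eqxx.
move: th; rewrite /theta (bigD1 (vac C)) //= [X in _ + X]big1 ?addr0 => [|c cv]; last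
  first.
  by rewrite hpp (negbTE cv) big_ord0 mulr0.
rewrite n1 big_ord1; set x := _ / _; set r := Rs _ _ _ _ _ => xr.
have x0 : 0 <= x by rewrite divr_ge0 // /qdim invr_ge0 normr_ge0.
have r1 : `|r| = 1 by rewrite Rs_phase.
have x1 : x = 1.
  by have := congr1 Num.norm xr; rewrite normrM r1 mulr1 normrN1 ger0_norm.
by move: xr; rewrite x1 mul1r.
Qed.

Variables (M : braidData R) (i : obj C -> obj M).
Hypothesis hM : minimal_modular_extension i.

Let hMB : unitary_braided_fusion M. Proof. by case: hM => -[]. Qed.
Let hi : full_braided_subcategory i. Proof. by case: hM. Qed.

Lemma ext_N_fermion c : N (i psi) (i psi) c = (c == vac M) :> nat.
Proof.
case: hC => _ _ _ _ hpp.
have [n0|n0] := posnP (N (i psi) (i psi) c).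
  rewrite n0; case: eqP => // cv; move: n0.
  by rewrite cv -(sub_vac hi) (sub_N hi) hpp eqxx.
have [c0 cc0] := sub_closed hi n0.
by rewrite cc0 (sub_N hi) hpp -(sub_vac hi) (inj_eq (sub_inj hi)).
Qed.

Lemma ext_Rs_fermion : Rs (i psi) (i psi) (vac M) 0%N 0%N = -1.
Proof.
case: hC => _ _ _ _ hpp.
have n1 : (0 < N psi psi (vac C))%N by rewrite hpp eqxx.
by rewrite -(sub_vac hi) -Rs_fermion; exact: (sub_R hi (Ordinal n1) (Ordinal n1)).
Qed.

Lemma ext_fermion_vac : i psi != vac M.
Proof.
case: hC => _ pv _ _ _; apply/eqP; rewrite -(sub_vac hi) => /(sub_inj hi).
exact: pv.
Qed.

(** Transparency of psi in C, all fusion channels with psi staying in C. Hence the twist does not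
    alter the R-symbols of C. *)
Lemma ext_grade_sub a : grade (i psi) (i a) = false.
Proof.
case: hC => hB _ htr _ hpp.
apply: (gradeP hMB ext_N_fermion); apply/braids_trivially_scalar1 => z mu la.
have [c zc] := sub_closed hi (ord_gt0 mu).
subst z.
have tr : transparent psi by apply/htr; right.
have e1 := sub_N hi a psi c; have e2 := sub_N hi psi a c.
have lm : (mu < N a psi c)%N by rewrite -e1.
have ll : (la < N a psi c)%N by rewrite -e1.
have := tr a c (Ordinal lm) (Ordinal ll); rewrite -!val_eqE /= => <-.
rewrite e2; apply: eq_bigr => nu _.
by have := sub_R hi (Ordinal lm) nu => /= ->; have := sub_R hi nu (Ordinal ll) => /= ->.
Qed.

Let g := grade (i psi).

Lemma twist_extension :
  @minimal_modular_extension R C (twist g) i.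
Proof.
case: (hM) => m1 m2 m3; split => //.
  by apply: twist_modular => // a b c; apply: gradeM hMB ext_N_fermion _ _ _.
case: m2 => h1 h2 h3 h4 h5 h6; split => //= a b c mu nu.
by rewrite /g ext_grade_sub mul1r h6.
Qed.

Definition gauss (B : braidData R) : R[i] :=
  \sum_(a : obj B) qdim a ^+ 2 * theta a.

Lemma gauss_twist : gauss (twist g) = - gauss M.
Proof.
rewrite /gauss [RHS]/= (bigID (fun a => ~~ g a)) [in RHS](bigID (fun a => ~~ g a)) /=.
rewrite [in RHS](gauss_even hMB ext_N_fermion ext_Rs_fermion) add0r.
rewrite (eq_bigr (fun a : obj M => qdim a ^+ 2 * theta a)) => [|a /negbTE ga]; last
  first.
  by rewrite theta_twist ga mul1r.
rewrite [X in X + _](gauss_even hMB ext_N_fermion ext_Rs_fermion) add0r -sumrN.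
apply: eq_bigr => a; rewrite negbK => ga.
by rewrite theta_twist ga mulN1r mulrN.
Qed.

End SuperModular.

(** * Isomorphisms of skeletal data *)

Section ConjIf.
Variable R : realType.
Implicit Types (x y : R[i]) (p q : bool).

Lemma conj_ifM q x y : conj_if q (x * y) = conj_if q x * conj_if q y.
Proof. by case: q; rewrite //= rmorphM. Qed.

Lemma conj_if_sum q (I : finType) (P : pred I) (g : I -> R[i]) :
  conj_if q (\sum_(i | P i) g i) = \sum_(i | P i) conj_if q (g i).
Proof. by case: q; rewrite //= rmorph_sum. Qed.

Lemma conj_if_comp p q x : conj_if p (conj_if q x) = conj_if (p (+) q) x.
Proof. by case: p q => -[]; rewrite //= conjCK. Qed.

Lemma conj_if_conj q x : conj_if q x^* = (conj_if q x)^*.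
Proof. by case: q. Qed.

Lemma conj_if_nat q n : conj_if q n%:R = n%:R :> R[i].
Proof. by case: q; rewrite //= rmorph_nat. Qed.

Lemma conj_if_sign q (b : bool) : conj_if q ((-1) ^+ b) = (-1) ^+ b :> R[i].
Proof. by case: q; rewrite //= rmorph_sign. Qed.

Lemma conj_if1 q : conj_if q 1 = 1 :> R[i].
Proof. exact: (conj_if_nat q 1). Qed.

Lemma conj_ifV q x : conj_if q x^-1 = (conj_if q x)^-1.
Proof. by case: q; rewrite //= fmorphV. Qed.

Lemma norm_conj_if q x : `|conj_if q x| = `|x|.
Proof. by case: q; rewrite //= norm_conjC. Qed.

Definition fconj (I J : Type) q (X : I -> J -> R[i]) : I -> J -> R[i] :=
  fun i j => conj_if q (X i j).

Variables I J K : finType.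

Lemma fconjM q (X : I -> J -> R[i]) (Y : J -> K -> R[i]) :
  fconj q (fmul X Y) = fmul (fconj q X) (fconj q Y).
Proof.
apply/funext => i; apply/funext => j; rewrite /fconj conj_if_sum.
by apply: eq_bigr => k _; rewrite conj_ifM.
Qed.

Lemma fconj_adj q (X : I -> J -> R[i]) : fconj q (fadj X) = fadj (fconj q X).
Proof. by apply/funext => i; apply/funext => j; rewrite /fconj conj_if_conj. Qed.

Lemma fconj_id q : fconj q (@fid _ I) = @fid _ I.
Proof. by apply/funext => i; apply/funext => j; rewrite /fconj conj_if_nat. Qed.

Lemma fconj_comp p q (X : I -> J -> R[i]) :
  fconj p (fconj q X) = fconj (p (+) q) X.
Proof. by apply/funext => i; apply/funext => j; rewrite /fconj conj_if_comp. Qed.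

Lemma fconjK q (X : I -> J -> R[i]) : fconj q (fconj q X) = X.
Proof. by rewrite fconj_comp addbb. Qed.

Lemma fconj_sign q (b : bool) (X : I -> J -> R[i]) :
  fconj q (fscale ((-1) ^+ b) X) = fscale ((-1) ^+ b) (fconj q X).
Proof.
by apply/funext => i; apply/funext => j; rewrite /fconj conj_ifM conj_if_sign.
Qed.

End ConjIf.

Lemma fconj_unitary (R : realType) (I J : finType) q (X : I -> J -> R[i]) :
  funitary X -> funitary (fconj q X).
Proof.
by case=> h1 h2; split; rewrite -fconj_adj -fconjM ?h1 ?h2 fconj_id.
Qed.

Section Kronecker.
Variable T : numClosedFieldType.

Definition kron (I J I' J' : finType) (X : I -> I' -> T) (Y : J -> J' -> T) :
  I * J -> I' * J' -> T := fun x y => X x.1 y.1 * Y x.2 y.2.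

Lemma kronM (I J I' J' I'' J'' : finType) (X : I -> I' -> T) (Y : J -> J' -> T)
    (X' : I' -> I'' -> T) (Y' : J' -> J'' -> T) :
  fmul (kron X Y) (kron X' Y') = kron (fmul X X') (fmul Y Y').
Proof.
apply/funext => x; apply/funext => y; rewrite /fmul /kron big_distrlr /=.
by rewrite pair_big; apply: eq_bigr => k _ /=; rewrite mulrACA.
Qed.

Lemma kron_adj (I J I' J' : finType) (X : I -> I' -> T) (Y : J -> J' -> T) :
  fadj (kron X Y) = kron (fadj X) (fadj Y).
Proof. by apply/funext => x; apply/funext => y; rewrite /fadj /kron rmorphM. Qed.

Lemma kron_id (I J : finType) : kron (@fid T I) (@fid T J) = @fid T _.
Proof.
by apply/funext => -[i j]; apply/funext => -[k l]; rewrite /kron /fid xpair_eqE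
  -natrM mulnb.
Qed.

Lemma kron_unitary (I J I' J' : finType) (X : I -> I' -> T) (Y : J -> J' -> T) :
  funitary X -> funitary Y -> funitary (kron X Y).
Proof.
by case=> X1 X2 [Y1 Y2]; split; rewrite kron_adj kronM ?X1 ?X2 ?Y1 ?Y2 kron_id.
Qed.

(* Vertex labels are naturals, with junk values out of range. *)
Definition cut n m (X : nat -> nat -> T) (i : 'I_n) (j : 'I_m) : T := X i j.

End Kronecker.

Lemma fconj_kron (R : realType) (I J I' J' : finType) q (X : I -> I' -> R[i])
    (Y : J -> J' -> R[i]) :
  fconj q (kron X Y) = kron (fconj q X) (fconj q Y).
Proof. by apply/funext => x; apply/funext => y; rewrite /fconj /kron conj_ifM. Qed.

Section VertexIso.
Variable R : realType.
Implicit Types A B D : braidData R.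

(** Common form of equivalences between extensions and of (anti-)autoequivalences. The braiding is
    kept apart, so that maps braided up to a sign are covered. *)
Record vertex_iso A B (f : obj A -> obj B) (q : bool)
    (V : obj A -> obj A -> obj A -> nat -> nat -> R[i]) : Prop := VertexIso {
  vi_bij : bijective f;
  vi_vac : f (vac A) = vac B;
  vi_N : forall a b c : obj A, N (f a) (f b) (f c) = N a b c;
  vi_unitary : forall a b c : obj A,
    funitary (cut (n := N a b c) (m := N a b c) (V a b c));
  vi_unit : forall a : obj A,
    V (vac A) a a 0%N 0%N = 1 /\ V a (vac A) a 0%N 0%N = 1;
  vi_F : forall (a b c d e g : obj A) (al : 'I_(N a b e)) (be : 'I_(N e c d))
      (mu' : 'I_(N b c g)) (nu' : 'I_(N a g d)),
    \sum_(al' < N a b e) \sum_(be' < N e c d)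
      V a b e al al' * V e c d be be'
      * F (f a) (f b) (f c) (f d) (f e, val al', val be') (f g, val mu', val nu')
    = \sum_(mu < N b c g) \sum_(nu < N a g d)
      conj_if q (F a b c d (e, val al, val be) (g, val mu, val nu))
      * V b c g mu mu' * V a g d nu nu' }.

(** The sign [s] vanishes for braided functors and is nonzero for an equivalence out of the twist,
    reread on the untwisted category. *)
Definition braid_compat A B (s : obj A -> obj A -> bool) (f : obj A -> obj B)
    (q : bool) (V : obj A -> obj A -> obj A -> nat -> nat -> R[i]) : Prop :=
  forall (a b c : obj A) (mu : 'I_(N b a c)) (nu' : 'I_(N a b c)),
    \sum_(mu' < N b a c)
      V b a c mu mu' * Rs (f a) (f b) (f c) mu' nu'
    = (-1) ^+ s a b * \sum_(nu < N a b c)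
      conj_if q (Rs a b c mu nu) * V a b c nu nu'.

(** The bounds are free parameters: multiplicities before and after [f] are equal but not
    convertible. *)
Definition Fcut B (n1 n2 m1 m2 : nat) (a b c d e g : obj B)
    (x : 'I_n1 * 'I_n2) (y : 'I_m1 * 'I_m2) : R[i] :=
  F a b c d (e, val x.1, val x.2) (g, val y.1, val y.2).

Lemma Fcut_eqP A B (f : obj A -> obj B) q
    (V : obj A -> obj A -> obj A -> nat -> nat -> R[i]) (a b c d e g : obj A) n1 n2
      m1 m2 :
  (forall (al : 'I_n1) (be : 'I_n2) (mu' : 'I_m1) (nu' : 'I_m2),
    \sum_(al' < n1) \sum_(be' < n2)
      V a b e al al' * V e c d be be'
      * F (f a) (f b) (f c) (f d) (f e, val al', val be') (f g, val mu', val nu')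
    = \sum_(mu < m1) \sum_(nu < m2)
      conj_if q (F a b c d (e, val al, val be) (g, val mu, val nu))
      * V b c g mu mu' * V a g d nu nu') <->
  fmul (kron (cut (n := n1) (m := n1) (V a b e)) (cut (n := n2) (m := n2) (V e c d)))
       (@Fcut B n1 n2 m1 m2 (f a) (f b) (f c) (f d) (f e) (f g))
  = fmul (fconj q (@Fcut A n1 n2 m1 m2 a b c d e g))
       (kron (cut (n := m1) (m := m1) (V b c g)) (cut (n := m2) (m := m2) (V a g d))).
Proof.
split=> [h|h al be mu nu].
  apply/funext => -[al be]; apply/funext => -[mu nu].
  rewrite /fmul -(pair_bigA _ (fun i j => kron (cut (V a b e)) (cut (V e c d)) (al,
    be) (i, j) * Fcut (f a) (f b) (f c) (f d) (f e) (f g) (i, j) (mu, nu))) /=.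
  rewrite [LHS]h -(pair_bigA _ (fun i j => fconj q (Fcut a b c d e g) (al, be) (i, j)
    * kron (cut (V b c g)) (cut (V a g d)) (i, j) (mu, nu))) /=.
  by apply: eq_bigr => i _; apply: eq_bigr => j _; rewrite -mulrA.
have := congr1 (fun X => X (al, be) (mu, nu)) h.
rewrite /fmul -(pair_bigA _ (fun i j => kron (cut (V a b e)) (cut (V e c d)) (al, be)
  (i, j) * Fcut (f a) (f b) (f c) (f d) (f e) (f g) (i, j) (mu, nu))) /=.
rewrite /kron /Fcut /cut /= => ->.
rewrite -(pair_bigA _ (fun i j => fconj q (Fcut a b c d e g) (al, be) (i, j) * (V b c
  g i mu * V a g d j nu))) /=.
by apply: eq_bigr => i _; apply: eq_bigr => j _; rewrite -mulrA.
Qed.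

Lemma vi_Fcut A B f q V (h : @vertex_iso A B f q V) (a b c d e g : obj A) n1 n2 m1 m2 :
  N a b e = n1 -> N e c d = n2 -> N b c g = m1 -> N a g d = m2 ->
  fmul (kron (cut (n := n1) (m := n1) (V a b e)) (cut (n := n2) (m := n2) (V e c d)))
       (@Fcut B n1 n2 m1 m2 (f a) (f b) (f c) (f d) (f e) (f g))
  = fmul (fconj q (@Fcut A n1 n2 m1 m2 a b c d e g))
       (kron (cut (n := m1) (m := m1) (V b c g)) (cut (n := m2) (m := m2) (V a g d))).
Proof. by move=> <- <- <- <-; apply/Fcut_eqP; apply: vi_F h _ _ _ _ _ _. Qed.

Lemma vi_cut_unitary A B f q V (h : @vertex_iso A B f q V) (a b c : obj A) n :
  N a b c = n -> funitary (cut (n := n) (m := n) (V a b c)).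
Proof. by move=> <-; apply: vi_unitary h _ _ _. Qed.

Lemma braid_compat_cut A B s f q V (h : @braid_compat A B s f q V) (a b c : obj A) n m :
  N b a c = n -> N a b c = m ->
  fmul (cut (n := n) (m := n) (V b a c)) (cut (n := n) (m := m) (Rs (f a) (f b) (f c)))
  = fscale ((-1) ^+ s a b) (fmul (fconj q (cut (n := n) (m := m) (Rs a b c)))
                              (cut (n := m) (m := m) (V a b c))).
Proof.
by move=> <- <-; apply/funext => i; apply/funext => j; apply: h.
Qed.

(** Convertible to the [U] of [aut_comp] when the maps are autoequivalences; [vertex_inv] plays the
    same role for [aut_inv]. *)
Definition vertex_comp A B (f : obj A -> obj B) (r : bool)
    (V : obj A -> obj A -> obj A -> nat -> nat -> R[i])
    (W : obj B -> obj B -> obj B -> nat -> nat -> R[i]) (a b c : obj A) (mu la : nat) :=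
  \sum_(nu < N (f a) (f b) (f c))
    conj_if r (V a b c mu nu) * W (f a) (f b) (f c) nu la.

Definition vertex_inv A B (g : obj B -> obj A) (q : bool)
    (V : obj A -> obj A -> obj A -> nat -> nat -> R[i]) (a b c : obj B) (nu mu : nat) :=
  conj_if q (V (g a) (g b) (g c) mu nu)^*.

Lemma vertex_comp_cut A B f q V (h : @vertex_iso A B f q V) r W (a b c : obj A) n :
  N a b c = n ->
  cut (n := n) (m := n) (vertex_comp f r V W a b c)
  = fmul (fconj r (cut (m := n) (V a b c))) (cut (W (f a) (f b) (f c))).
Proof.
move=> <-; rewrite -(vi_N h).
by apply/funext => i; apply/funext => j.
Qed.

Lemma vertex_inv_cut A B (g : obj B -> obj A) q V (a b c : obj B) n :
  cut (n := n) (m := n) (vertex_inv g q V a b c)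
  = fconj q (fadj (cut (n := n) (V (g a) (g b) (g c)))).
Proof. by []. Qed.

Lemma vertex_iso_comp A B D (fu_A : fusion_axioms A) f q V g r W :
  @vertex_iso A B f q V -> @vertex_iso B D g r W ->
  vertex_iso (g \o f) (r (+) q) (vertex_comp f r V W).
Proof.
move=> hV hW; case: (fu_A) => n1l n1r _ _ _.
split.
- by apply: bij_comp (vi_bij hW) (vi_bij hV).
- by rewrite /= (vi_vac hV) (vi_vac hW).
- by move=> a b c; rewrite /= (vi_N hW) (vi_N hV).
- move=> a b c; rewrite (vertex_comp_cut hV) //; apply: funitaryM.
    exact: fconj_unitary (vi_unitary hV _ _ _).
  exact: vi_cut_unitary hW _ _ _ _ (vi_N hV _ _ _).
- move=> a; rewrite /vertex_comp !(vi_N hV) n1l n1r eqxx !big_ord1.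
  have [-> ->] := vi_unit hV a; have [h1 h2] := vi_unit hW (f a).
  by rewrite (vi_vac hV) h1 h2 conj_if1 mulr1.
- move=> a b c d e x; apply/Fcut_eqP; rewrite !(vertex_comp_cut hV) //=.
  rewrite -!kronM -fmulA (vi_Fcut hW) ?(vi_N hV) // fmulA -fconj_kron -fconjM.
  rewrite (vi_Fcut hV) // fconjM fconj_comp -fmulA fconj_kron.
  by [].
Qed.

(** The signs are real, so they pass unchanged through an anti-linear map and simply add up. *)
Lemma braid_compat_comp A B D f q V g r W s s' :
  @vertex_iso A B f q V -> @vertex_iso B D g r W ->
  @braid_compat A B s f q V -> @braid_compat B D s' g r W ->
  braid_compat (fun a b => s a b (+) s' (f a) (f b)) (g \o f) (r (+) q)
    (vertex_comp f r V W).
Proof.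
move=> hV hW bV bW a b c mu nu.
have : fmul (cut (n := N b a c) (m := N b a c) (vertex_comp f r V W b a c))
    (cut (n := N b a c) (m := N a b c) (Rs (g (f a)) (g (f b)) (g (f c))))
  = fscale ((-1) ^+ (s a b (+) s' (f a) (f b))) (fmul (fconj (r (+) q) (cut (n := N b
    a c) (m := N a b c) (Rs a b c)))
                              (cut (n := N a b c) (m := N a b c) (vertex_comp f r V W
                                a b c))).
  rewrite !(vertex_comp_cut hV) // -fmulA (braid_compat_cut bW) ?(vi_N hV) //.
  rewrite fscaler fmulA -fconjM (braid_compat_cut bV) // fconj_sign fscalel fscaleA.
  by rewrite -signr_addb addbC fconjM fconj_comp fmulA.
by move=> /(congr1 (fun X => X mu nu)).
Qed.

Lemma vertex_iso_inv A B (fu_A : fusion_axioms A) f g q V :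
  cancel f g -> cancel g f -> @vertex_iso A B f q V ->
  @vertex_iso B A g q (vertex_inv g q V).
Proof.
move=> fK gK hV.
have NV x y z : N (g x) (g y) (g z) = N x y z by rewrite -(vi_N hV) !gK.
have gv : g (vac B) = vac A by rewrite -(vi_vac hV) fK.
split=> //.
- by exists f.
- move=> a b c; rewrite vertex_inv_cut; apply: fconj_unitary; apply: funitary_adj.
  exact: vi_cut_unitary hV _ _ _ _ (NV _ _ _).
- move=> a; rewrite /vertex_inv gv; have [-> ->] := vi_unit hV (g a).
  by rewrite conjC1 conj_if1.
- move=> a b c d e x; apply/Fcut_eqP; rewrite !vertex_inv_cut -!fconj_kron.
  have := vi_Fcut hV (NV a b e) (NV e c d) (NV b c x) (NV a x d).
  rewrite !gK -!kron_adj.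
  set K1 := kron _ _; set K2 := kron _ _ => hF.
  have [U1 U1'] : funitary K1 by apply: kron_unitary; apply: vi_cut_unitary hV _ _ _
    _ (NV _ _ _).
  have [U2 U2'] : funitary K2 by apply: kron_unitary; apply: vi_cut_unitary hV _ _ _
    _ (NV _ _ _).
  move/(congr1 (fun X => fconj q (fmul (fmul (fadj K1) X) (fadj K2)))): hF.
  rewrite fmulA U1' fmul1l -!fmulA U2 fmul1r !fconjM fconjK.
  by move=> ->.
Qed.

Lemma braid_compat_inv A B f g q V s :
  cancel f g -> cancel g f -> @vertex_iso A B f q V -> @braid_compat A B s f q V ->
  @braid_compat B A (fun x y => s (g x) (g y)) g q (vertex_inv g q V).
Proof.
move=> fK gK hV bV a b c mu nu.
have NV x y z : N (g x) (g y) (g z) = N x y z by rewrite -(vi_N hV) !gK.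
have : fmul (cut (n := N b a c) (m := N b a c) (vertex_inv g q V b a c))
    (cut (n := N b a c) (m := N a b c) (Rs (g a) (g b) (g c)))
  = fscale ((-1) ^+ s (g a) (g b)) (fmul (fconj q (cut (n := N b a c) (m := N a b c)
    (Rs a b c)))
                              (cut (n := N a b c) (m := N a b c) (vertex_inv g q V a
                                b c))).
  rewrite !vertex_inv_cut.
  have := braid_compat_cut bV (NV b a c) (NV a b c); rewrite !gK.
  have [U1 U1'] := vi_cut_unitary hV (NV b a c).
  have [U2 U2'] := vi_cut_unitary hV (NV a b c).
  set K1 := cut (V _ _ _); set K2 := cut (V _ _ _) => hR.
  move/(congr1 (fun X => fscale ((-1) ^+ s (g a) (g b)) (fconj q (fmul (fmul (fadj
    K1) X) (fadj K2))))): hR.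
  rewrite fmulA U1' fmul1l fscaler fscalel fconj_sign fscaleA -signr_addb addbb fscale1.
  by rewrite -!fmulA U2 fmul1r !fconjM fconjK => ->.
by move=> /(congr1 (fun X => X mu nu)).
Qed.

End VertexIso.

(** * Equivalences of extensions as isomorphisms of skeletal data *)

Lemma sum_mult (T : nmodType) (I : finType) (m : I -> nat) (x : I)
    (g : I -> nat -> T) :
  (forall t, m t = (t == x) :> nat) -> \sum_t \sum_(i < m t) g t i = g x 0%N.
Proof.
move=> hm; rewrite (bigD1 x) //= [X in _ + X]big1 => [|t tx].
  by rewrite hm eqxx big_ord1 addr0.
by rewrite hm (negbTE tx) big_ord0.
Qed.

(** The sum of squares is the dimension of the endomorphisms of the image, so a simple object is
    sent to a simple one. *)
Lemma sum_sqr_eq1 (I : finType) (m : I -> nat) : (\sum_t m t * m t)%N = 1%N ->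
  exists x, forall t, m t = (t == x) :> nat.
Proof.
move=> h; have [x hx|h0] := pickP (fun x => 0 < m x)%N; last first.
  move: h; rewrite big1 // => x _; have := h0 x; by case: (m x).
exists x => t; move: h; rewrite (bigD1 x) //= => h.
have m1 : m x = 1%N.
  by move: h hx; case: (m x) => [|[|k]] // /eqP; rewrite !mulSn addSn.
move: h; rewrite m1 => /eqP; rewrite mul1n -[X in _ == X]addn0 eqn_add2l sum_nat_eq0.
move=> /forallP/(_ t); have [->|tx] /= := eqVneq t x; first by rewrite m1.
by rewrite muln_eq0 orbb => /eqP.
Qed.

Section Equivalence.
Variables (R : realType) (C A B : braidData R).
Variables (i : obj C -> obj A) (j : obj C -> obj B) (Phi : functorData A B).
Hypothesis hPhi : unitary_braided_functor (fun=> True) Phi.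
Hypothesis hdom : dominant (fun=> True) Phi.
Hypothesis hfull : forall a b : obj A,
  (\sum_t mult Phi a t * mult Phi b t)%N = (a == b) :> nat.
Hypothesis hid : identity_on i j Phi.

Let mult_ex a : exists x, forall t, mult Phi a t == (t == x).
Proof.
have [x hx] : exists x, forall t, mult Phi a t = (t == x) :> nat.
  by apply: sum_sqr_eq1; rewrite hfull eqxx.
by exists x => t; apply/eqP.
Qed.

(** The default is never reached, by [mult_ex]. *)
Let f a : obj B := odflt (vac B) [pick x | [forall t, mult Phi a t == (t == x)]].

Let multf a t : mult Phi a t = (t == f a) :> nat.
Proof.
rewrite /f; case: pickP => /= [x /forallP/(_ t)/eqP //|h].
have [x hx] := mult_ex a; have := h x => /negbT/forallP; case.
by move=> s; apply: hx.
Qed.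

Let f_inj : injective f.
Proof.
move=> a b ab; have := hfull a b; rewrite (bigD1 (f a)) //= !multf ab eqxx.
by case: eqP.
Qed.

Let f_bij : bijective f.
Proof.
pose s t := odflt (vac A) [pick a | t == f a].
have sK : cancel s f.
  move=> t; rewrite /s; case: pickP => /= [a /eqP //|h].
  by have [a [_]] := hdom t; rewrite multf h.
by exists s => // a; apply: f_inj; rewrite sK.
Qed.

Let V a b c mu nu := lift_vertex Phi a b c mu (f a, 0%N) (f b, 0%N) (f c, 0%N) nu.

Let m0 a : (0 < mult Phi a (f a))%N. Proof. by rewrite multf eqxx. Qed.
Let o a : 'I_(mult Phi a (f a)) := Ordinal (m0 a).

Let V_unitary a b c :
  funitary (cut (n := N a b c) (m := N (f a) (f b) (f c)) (V a b c)).
Proof.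
split; apply/funext => mu; apply/funext => nu; rewrite /fmul /fid.
- have := @fun_isometry _ _ _ _ _ hPhi a b c c (f c) mu (o c) nu (o c) I I.
  rewrite !xpair_eqE !eqxx /= andbT => <-; symmetry.
  under eq_bigr do rewrite exchange_big.
  rewrite (@sum_mult _ _ _ _ (fun x k => \sum_y \sum_(l < mult Phi b y)
    \sum_(nu0 < N x y (f c)) lift_vertex Phi a b c mu (x, k) (y, val l) (f c, 0%N) nu0 *
     (lift_vertex Phi a b c nu (x, k) (y, val l) (f c, 0%N) nu0)^*) (multf a)).
  by rewrite (@sum_mult _ _ _ _ (fun y l =>
    \sum_(nu0 < N (f a) y (f c)) lift_vertex Phi a b c mu (f a, 0%N) (y, l) (f c,
      0%N) nu0 *
     (lift_vertex Phi a b c nu (f a, 0%N) (y, l) (f c, 0%N) nu0)^*) (multf b)).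
- have := @fun_coisometry _ _ _ _ _ hPhi a b (f a) (f a) (f b) (f b) (f c)
     (o a) (o b) mu (o a) (o b) nu I I.
  rewrite !xpair_eqE !eqxx /= => <-; symmetry.
  under eq_bigr do rewrite exchange_big.
  have mc t : mult Phi t (f c) = (t == c) :> nat by rewrite multf (inj_eq f_inj) eq_sym.
  by rewrite (@sum_mult _ _ _ _ (fun x k => \sum_(l < N a b x)
    (lift_vertex Phi a b x l (f a, 0%N) (f b, 0%N) (f c, k) mu)^* *
     lift_vertex Phi a b x l (f a, 0%N) (f b, 0%N) (f c, k) nu) mc).
Qed.

(** The vertex map is unitary, hence square. *)
Let fN a b c : N (f a) (f b) (f c) = N a b c.
Proof. by have := funitary_card (V_unitary a b c); rewrite !card_ord. Qed.

Let f_vac : f (vac A) = vac B.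
Proof.
have := fun_vac hPhi (f (vac A)); rewrite multf eqxx.
by case: eqP.
Qed.

Lemma equivalence_vertex_iso : exists (f : obj A -> obj B) V,
  [/\ @vertex_iso R A B f false V, @braid_compat R A B (fun _ _ => false) f false V,
      forall a, f (i a) = j a
    & forall (a b c : obj C) (mu nu : 'I_(N a b c)),
        V (i a) (i b) (i c) mu nu = (mu == nu)%:R].
Proof.
have fi a : f (i a) = j a.
  by have := hid.1 a (f (i a)); rewrite multf eqxx; case: eqP.
exists f, V; split=> //.
- split=> //.
  + by move=> a b c; have := V_unitary a b c; rewrite fN.
  + move=> a; rewrite /V f_vac; split.
      by have := @fun_unitl _ _ _ _ _ hPhi a (f a) (o a) (o a) I; rewrite eqxx.
    by have := @fun_unitr _ _ _ _ _ hPhi a (f a) (o a) (o a) I; rewrite eqxx.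
  + move=> a b c d e g al be mu' nu'.
    have lmu : (mu' < N (f b) (f c) (f g))%N by rewrite fN.
    have lnu : (nu' < N (f a) (f g) (f d))%N by rewrite fN.
    have := @fun_F _ _ _ _ _ hPhi a b c d e al be (f a) (f b) (f c) (f d) (f g)
      (o a) (o b) (o c) (o d) (Ordinal lmu) (Ordinal lnu) I I I.
    have mg t : mult Phi t (f g) = (t == g) :> nat by rewrite multf (inj_eq f_inj)
      eq_sym.
    (* The sum over copies is moved next to the sum over anyons, where [sum_mult] leaves only the
       image of e. *)
    under eq_bigr => u _.
      under eq_bigr do rewrite exchange_big.
      rewrite exchange_big; over.
    rewrite (@sum_mult _ _ _ _ (fun u m => \sum_(al' < N (f a) (f b) u)
       \sum_(be' < N u (f c) (f d))
        lift_vertex Phi a b e al (f a, 0%N) (f b, 0%N) (u, m) al'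
      * lift_vertex Phi e c d be (u, m) (f c, 0%N) (f d, 0%N) be'
      * F (f a) (f b) (f c) (f d) (u, val al', val be') (f g, val mu', val nu'))
       (multf e)) !fN => ->.
    under eq_bigr => u _.
      under eq_bigr do rewrite exchange_big.
      rewrite exchange_big; over.
    by rewrite (@sum_mult _ _ _ _ (fun u m => \sum_(mu < N b c u)
       \sum_(nu < N a u d)
        F a b c d (e, val al, val be) (u, val mu, val nu)
      * lift_vertex Phi b c u mu (f b, 0%N) (f c, 0%N) (f g, m) mu'
      * lift_vertex Phi a u d nu (f a, 0%N) (f g, m) (f d, 0%N) nu') mg).
- move=> a b c mu nu'; have lnu : (nu' < N (f a) (f b) (f c))%N by rewrite fN.
  have := @fun_R _ _ _ _ _ hPhi a b c mu (f a) (f b) (f c) (o a) (o b) (o c) (Ordinal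
    lnu) I I.
  by rewrite /= (fN b a c) expr0 mul1r => ->.
- by move=> a b c mu nu; rewrite -(hid.2 a b c mu nu) /V !fi.
Qed.

End Equivalence.

(** * Invariance of dimensions, twists and Gauss sums *)

Lemma sum_ord11 (T : nmodType) (g : 'I_1 * 'I_1 -> T) :
  \sum_x g x = g (ord0, ord0).
Proof.
rewrite (big_pred1 (ord0, ord0)) // => -[i j].
by rewrite /= (ord1 i) (ord1 j) eqxx.
Qed.

Section Invariance.
Variables (R : realType) (A B : braidData R).
Variables (f : obj A -> obj B) (q : bool).
Variable V : obj A -> obj A -> obj A -> nat -> nat -> R[i].
Hypothesis hA : fusion_axioms A.
Hypothesis hB : fusion_axioms B.
Hypothesis hV : vertex_iso f q V.

Lemma vi_dual (a : obj A) : f (dual a) = dual (f a).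
Proof.
case: hA => _ _ dA _ _; case: hB => _ _ dB _ _.
have := vi_N hV a (dual a) (vac A).
by rewrite (vi_vac hV) dA dB eqxx; case: eqP.
Qed.

Lemma vi_phase (a b c : obj A) : N a b c = 1%N -> `|V a b c 0%N 0%N| = 1.
Proof.
move=> n1; have [h _] := vi_cut_unitary hV n1.
apply: phaseV; have := congr1 (fun X => X ord0 ord0) h.
by rewrite /fmul big_ord1 /fid eqxx.
Qed.

(** The F-equation for the vacuum channels is one-dimensional, and the vertex factors are phases. *)
Lemma vi_qdim (a : obj A) : qdim (f a) = qdim a.
Proof.
case: (hA) => n1l n1r nd nC _.
have e1 : N a (dual a) (vac A) = 1%N by rewrite nd eqxx.
have e2 : N (vac A) a a = 1%N by rewrite n1l eqxx.
have e3 : N (dual a) a (vac A) = 1%N by rewrite nC.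
have e4 : N a (vac A) a = 1%N by rewrite n1r eqxx.
have := congr1 (fun X => `|X (ord0, ord0) (ord0, ord0)|) (vi_Fcut hV e1 e2 e3 e4).
rewrite /fmul !sum_ord11 /kron /cut /Fcut /fconj /= !normrM !vi_phase // norm_conj_if
  !mul1r !mulr1.
by rewrite (vi_vac hV) vi_dual /qdim => ->.
Qed.

Hypothesis hR : braid_compat (fun _ _ => false) f q V.

(** The diagonal braidings R^{aa} are conjugated by a unitary, up to complex conjugation, which
    preserves their traces. *)
Lemma vi_theta (a : obj A) : theta (f a) = conj_if q (theta a).
Proof.
rewrite /theta conj_if_sum (reindex f) /=; last first.
  exact: onW_bij (vi_bij hV).
apply: eq_bigr => c _; rewrite conj_ifM !vi_qdim (vi_N hV); congr (_ * _).
  rewrite conj_ifM conj_ifV; have cq b : conj_if q (qdim b) = qdim (b : obj A).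
    case: (q) => //=; rewrite /qdim; apply: geC0_conj.
    by rewrite invr_ge0 normr_ge0.
  by rewrite !cq.
have := braid_compat_cut hR (erefl (N a a c)) (erefl _).
have [U U'] := vi_cut_unitary hV (erefl (N a a c)).
set K := cut (V a a c) in U U' *.
rewrite expr0 fscale1 => h; rewrite conj_if_sum.
rewrite -[LHS]/(ftrace (cut (n := N a a c) (m := N a a c) (Rs (f a) (f a) (f c)))).
rewrite -[RHS]/(ftrace (fconj q (cut (n := N a a c) (m := N a a c) (Rs a a c)))).
rewrite -[X in ftrace X = _]fmul1l -U' -fmulA h ftraceC -fmulA U fmul1r.
by [].
Qed.

Lemma vi_gauss : gauss B = conj_if q (gauss A).
Proof.
rewrite /gauss conj_if_sum (reindex f) /=; last exact: onW_bij (vi_bij hV).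
apply: eq_bigr => a _; rewrite vi_qdim vi_theta conj_ifM; congr (_ * _).
case: q => //=; rewrite rmorphXn /=; congr (_ ^+ _).
by rewrite geC0_conj // /qdim invr_ge0 normr_ge0.
Qed.

End Invariance.

(** * Composition and inversion of autoequivalences *)

Section Autoequivalence.
Variables (R : realType) (B : braidData R) (psi : obj B).

Lemma funitaryP (a b c : obj B) (U : nat -> nat -> R[i]) :
  (forall mu mu' : 'I_(N a b c),
     \sum_(nu < N a b c) U mu nu * (U mu' nu)^* = (mu == mu')%:R) <->
  funitary (cut (n := N a b c) (m := N a b c) U).
Proof.
split=> [h|[h _] mu mu'].
  by apply: funitary_sq => //; apply/funext => i; apply/funext => j; apply: h.
exact: (congr1 (fun X : 'I_(N a b c) -> 'I_(N a b c) -> R[i] => X mu mu') h).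
Qed.

Lemma autoequivalenceP (phi : autData B) :
  topological_autoequivalence psi phi <->
  [/\ vertex_iso (pact phi) (anti phi) (U phi), pact phi psi = psi
    & braid_compat (fun _ _ => false) (pact phi) (anti phi) (U phi)].
Proof.
split=> [[h1 h2 h3 h4 h5 h6 h7]|[[h1 h2 h3 h4 h5 h6] h7 h8]].
  split=> //; last by move=> a b c mu nu; rewrite expr0 mul1r h7.
  split=> //; last by move=> a b c; apply/funitaryP/h4.
  by exists (pact phi)^-1%g; [apply: permK | apply: permKV].
split=> //; first by move=> a b c; apply/funitaryP/h4.
by move=> a b c mu nu; rewrite h8 expr0 mul1r.
Qed.

Hypothesis hB : fusion_axioms B.

Lemma AutLR_comp phi chi : AutLR psi phi -> AutLR psi chi ->
  N psi psi (vac B) = 1%N -> AutLR psi (aut_comp phi chi).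
Proof.
case=> /autoequivalenceP[p1 p2 p3] p4 [/autoequivalenceP[c1 c2 c3] c4] n1.
split; last first.
  rewrite /= (vi_N c1) n1 big_ord1 c4 conj_if1 mul1r c2 (vi_vac c1).
  exact: p4.
apply/autoequivalenceP; rewrite /=.
have e x : (pact chi * pact phi)%g x = (pact phi \o pact chi) x by rewrite permM.
split; last 1 first.
- have := braid_compat_comp c1 p1 c3 p3.
  by move=> h a b c mu nu; rewrite !e; apply: h.
- have := vertex_iso_comp hB c1 p1.
  case=> h1 h2 h3 h4 h5 h6; split=> //.
  + by apply: eq_bij h1 _ _ => x; rewrite e.
  + by rewrite e.
  + by move=> a b c; rewrite !e.
  + by move=> a b c d x g al be mu nu; rewrite !e; apply: h6.
- by rewrite e /= c2.
Qed.

Lemma AutLR_inv phi : AutLR psi phi ->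
  N psi psi (vac B) = 1%N -> AutLR psi (aut_inv phi).
Proof.
case=> /autoequivalenceP[p1 p2 p3] p4 n1.
have ipsi : (pact phi)^-1%g psi = psi by rewrite -{1}p2 permK.
have K1 : cancel (pact phi) (pact phi)^-1%g by apply: permK.
have K2 : cancel (pact phi)^-1%g (pact phi) by apply: permKV.
have i1 := vertex_iso_inv hB K1 K2 p1.
have i3 := braid_compat_inv K1 K2 p1 p3.
split; last by rewrite /= (vi_vac i1) ipsi p4 conjC1 conj_if1.
by apply/autoequivalenceP; split.
Qed.

End Autoequivalence.

(** * The group Aut_LR *)

Section LocalEquivalence.
Variables (R : realType) (B : braidData R) (psi : obj B).

Lemma AutLR_vi (phi : autData B) : AutLR psi phi ->
  vertex_iso (pact phi) (anti phi) (U phi).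
Proof. by case=> /autoequivalenceP[]. Qed.

Lemma AutLR_psi (phi : autData B) : AutLR psi phi -> pact phi psi = psi.
Proof. by case=> /autoequivalenceP[]. Qed.

Lemma AutLR_psiV (phi : autData B) : AutLR psi phi -> (pact phi)^-1%g psi = psi.
Proof. by move=> /AutLR_psi {1}<-; rewrite permK. Qed.

Lemma AutLR_NV (phi : autData B) (a b c : obj B) : AutLR psi phi ->
  N ((pact phi)^-1%g a) ((pact phi)^-1%g b) ((pact phi)^-1%g c) = N a b c.
Proof. by move=> /AutLR_vi/vi_N h; rewrite -h !permKV. Qed.

(* Gauge phases are indexed by the source anyons. *)
Lemma eqLR_gauge (phi chi : autData B) : AutLR psi chi ->
  eqLR psi phi chi <->
  [/\ pact phi = pact chi, anti phi = anti chi
    & exists gamma : obj B -> R[i],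
      [/\ forall a, phase (gamma a), gamma psi = 1
        & forall (a b c : obj B) (mu nu : 'I_(N a b c)),
            U phi a b c mu nu = gamma a * gamma b / gamma c * U chi a b c mu nu]].
Proof.
move=> hchi; have NE := vi_N (AutLR_vi hchi); have pE := AutLR_psi hchi.
split.
  case=> u [gamma [ph gpsi [up ua uU]]] [e1 e2 e3].
  have pE' : pact phi = pact chi by rewrite e1 /= up mulg1.
  split=> //; first by rewrite e2 /= ua.
  exists (gamma \o pact chi); split=> [a||a b c mu nu]; rewrite /= ?pE //.
  rewrite e3 /= ua /= (eq_bigr (fun k : 'I_(N (pact chi a) (pact chi b) (pact chi c)) =>
    U chi a b c mu k * (gamma (pact chi a) * gamma (pact chi b) / gamma (pact chi c)
      * ((k : nat) == nu)%:R))).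
    rewrite NE (eq_bigr (fun k : 'I__ => gamma (pact chi a) * gamma (pact chi b) /
      gamma (pact chi c) * U chi a b c mu k * ((k : nat) == nu)%:R)).
      by rewrite sum_dltr.
    by move=> k _; rewrite mulrCA !mulrA.
  have lnu : (nu < N (pact chi a) (pact chi b) (pact chi c))%N by rewrite NE.
  by move=> k _; rewrite (uU _ _ _ k (Ordinal lnu)).
case=> e1 e2 [gamma [ph gpsi hU]].
exists (nat_iso (gamma \o (pact chi)^-1%g)).
  exists (gamma \o (pact chi)^-1%g); split=> [a||]; rewrite /= ?ph //.
    by rewrite (AutLR_psiV hchi).
split=> [||a b c mu nu]; rewrite /= ?mulg1 // hU !permK NE.
rewrite (eq_bigr (fun k : 'I__ => gamma a * gamma b / gamma c * U chi a b c mu k *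
  ((k : nat) == nu)%:R)).
  by rewrite sum_dltr.
by move=> k _; rewrite mulrCA !mulrA.
Qed.

Lemma phase_neq0 (z : R[i]) : phase z -> z != 0.
Proof. by move=> h; rewrite -normr_eq0 h oner_eq0. Qed.

Lemma eqLR_cut (phi chi : autData B) : AutLR psi chi ->
  pact phi = pact chi -> anti phi = anti chi ->
  (forall (a b c : obj B), cut (n := N a b c) (m := N a b c) (U phi a b c)
     = cut (U chi a b c)) ->
  eqLR psi phi chi.
Proof.
move=> hchi h1 h2 h3; apply/(eqLR_gauge _ hchi); split=> //.
exists (fun=> 1); split=> [a||a b c mu nu] //; first exact: normr1.
by rewrite !mulr1 divr1 mul1r; exact: (congr1 (fun X => X mu nu) (h3 a b c)).
Qed.

Lemma eqLR_refl phi : AutLR psi phi -> eqLR psi phi phi.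
Proof. by move=> h; apply: eqLR_cut. Qed.

Lemma eqLR_sym phi chi : AutLR psi phi -> AutLR psi chi ->
  eqLR psi phi chi -> eqLR psi chi phi.
Proof.
move=> h1 h2 /(eqLR_gauge _ h2)[p1 p2 [gamma [g1 g2 g3]]].
apply/(eqLR_gauge _ h1); split=> //; exists (fun a => (gamma a)^-1); split=> [a||a b
  c mu nu].
- by rewrite /phase normfV g1 invr1.
- by rewrite g2 invr1.
rewrite g3 mulrA -invfM -!invfM mulVf ?mul1r //.
by rewrite !mulf_neq0 ?invr_neq0 // phase_neq0.
Qed.

Lemma eqLR_trans phi chi xi : AutLR psi chi -> AutLR psi xi ->
  eqLR psi phi chi -> eqLR psi chi xi -> eqLR psi phi xi.
Proof.
move=> h1 h2 /(eqLR_gauge _ h1)[p1 p2 [gamma [g1 g2 g3]]].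
move=> /(eqLR_gauge _ h2)[q1 q2 [delta [d1 d2 d3]]].
apply/(eqLR_gauge _ h2); rewrite p1 q1 p2 q2; split=> //.
exists (fun a => gamma a * delta a); split=> [a||a b c mu nu].
- by rewrite /phase normrM g1 d1 mulr1.
- by rewrite g2 d2 mulr1.
rewrite g3 d3 !invfM.
by move: (gamma c)^-1 (delta c)^-1 => x y; ring.
Qed.

Hypothesis hB : fusion_axioms B.
Hypothesis hpp : N psi psi (vac B) = 1%N.

Lemma eqLR_comp phi phi' chi chi' : AutLR psi phi -> AutLR psi phi' ->
  AutLR psi chi -> AutLR psi chi' ->
  eqLR psi phi phi' -> eqLR psi chi chi' ->
  eqLR psi (aut_comp phi chi) (aut_comp phi' chi').
Proof.
move=> h1 h2 h3 h4 /(eqLR_gauge _ h2)[p1 p2 [gamma [g1 g2 g3]]].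
move=> /(eqLR_gauge _ h4)[q1 q2 [delta [d1 d2 d3]]].
have h5 := AutLR_comp hB h2 h4 hpp.
apply/(eqLR_gauge _ h5); rewrite /= p1 q1 p2 q2; split=> //.
exists (fun a => gamma (pact chi' a) * conj_if (anti phi') (delta a)); split=> [a||a
  b c mu nu].
- by rewrite /phase normrM norm_conj_if g1 d1 mulr1.
- by rewrite (AutLR_psi h4) g2 d2 conj_if1 mulr1.
have NE := vi_N (AutLR_vi h4) a b c.
rewrite mulr_sumr; apply: eq_bigr => k _.
have lnu : (nu < N (pact chi' a) (pact chi' b) (pact chi' c))%N by rewrite NE.
have lk : (k < N a b c)%N by rewrite -NE.
have := g3 _ _ _ k (Ordinal lnu) => /= ->.
have := d3 _ _ _ mu (Ordinal lk) => /= ->.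
rewrite !conj_ifM conj_ifV !invfM.
move: (conj_if _ _) (conj_if _ _) (conj_if _ _) => x y z.
move: (conj_if _ _) (U phi' _ _ _ _ _) (gamma _) (gamma _) (gamma _) => t u g h j.
move: z^-1 j^-1 => z' j'.
by ring.
Qed.

End LocalEquivalence.

Section GroupLaws.
Variables (R : realType) (B : braidData R) (psi : obj B).
Hypothesis hB : fusion_axioms B.
Hypothesis hpp : N psi psi (vac B) = 1%N.

Lemma nat_iso_AutLR (gamma : obj B -> R[i]) : (forall a, phase (gamma a)) ->
  gamma (vac B) = 1 -> gamma psi * gamma psi = 1 -> AutLR psi (nat_iso gamma).
Proof.
move=> ph g1 gpsi; case: (hB) => n1l n1r _ _ _.
have g0 a : gamma a != 0 by apply/phase_neq0/ph.
have gg (a b c : obj B) : gamma a * gamma b / gamma c * (gamma a * gamma b / gamma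
  c)^* = 1.
  by apply: phase_mulC; rewrite !normrM normfV !ph invr1 !mulr1.
split; last by rewrite /= gpsi g1 divr1 mulr1.
split; rewrite ?perm1 //=.
- by move=> a b c; rewrite !perm1.
- move=> a b c mu mu'.
  rewrite (eq_bigr (fun k : 'I_(N a b c) => ((mu : nat) == k)%:R * ((k : nat) ==
    mu')%:R)).
    by rewrite sum_dltl.
  move=> k _; rewrite rmorphM /= mulrACA gg mul1r rmorph_nat; congr (_ * _).
  by rewrite eq_sym.
- by move=> a; rewrite g1 mul1r mulr1 mulr1 divff.
- move=> a b c d e f al be mu' nu'; rewrite !perm1.
  (* The gauge factor common to both sides: the phases of the intermediate anyons e and f cancel. *)
  pose G := gamma a * gamma b * gamma c / gamma d.
  rewrite (eq_bigr (fun al' : 'I__ => ((al : nat) == al')%:R *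
    (G * F a b c d (e, val al', val be) (f, val mu', val nu')))) => [|k _]; last first.
    rewrite (eq_bigr (fun be' : 'I__ => ((be : nat) == be')%:R *
      (((al : nat) == k)%:R * (G * F a b c d (e, val k, val be') (f, val mu', val
        nu'))))) => [|l _].
      by rewrite sum_dltl.
    have -> : G = gamma a * gamma b / gamma e * (gamma e * gamma c / gamma d).
      by rewrite /G; field; rewrite !g0.
    by ring.
  rewrite sum_dltl.
  rewrite (eq_bigr (fun mu : 'I__ => (G * F a b c d (e, val al, val be) (f, val mu,
    val nu'))
    * ((mu : nat) == mu')%:R)) ?sum_dltr // => k _.
  rewrite (eq_bigr (fun nu : 'I__ => ((k : nat) == mu')%:R * (G * F a b c d (e, val
    al, val be) (f, val k, val nu))
    * ((nu : nat) == nu')%:R)) => [|l _]; first by rewrite sum_dltr mulrC.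
  have -> : G = gamma b * gamma c / gamma f * (gamma a * gamma f / gamma d).
    by rewrite /G; field; rewrite !g0.
  by ring.
- move=> a b c mu nu; rewrite !perm1.
  rewrite (eq_bigr (fun k : 'I__ => ((mu : nat) == k)%:R * (gamma b * gamma a / gamma
    c * Rs a b c k nu))) => [|k _].
    rewrite sum_dltl (eq_bigr (fun k : 'I__ => gamma b * gamma a / gamma c * Rs a b c
      mu k * ((k : nat) == nu)%:R)).
      by rewrite sum_dltr.
    by move=> k _; ring.
  by ring.
Qed.

Lemma cut_id n : @cut R[i] n n (fun mu nu => (mu == nu)%:R) = @fid _ _.
Proof. by []. Qed.

Lemma aut_id_AutLR : AutLR psi (aut_id B).
Proof.
have [[h1 h2 h3 h4 h5 h6 h7] h8] : AutLR psi (nat_iso (fun _ : obj B => 1 : R[i])).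
  by apply: nat_iso_AutLR => [a||]; rewrite ?mulr1 // /phase normr1.
have e : (fun (a b c : obj B) (mu nu : nat) => 1 * 1 / 1 * (mu == nu)%:R) = (fun a b
  c mu nu => (mu == nu)%:R) :> (_ -> _ -> _ -> _ -> _ -> R[i]).
  apply/funext => a; apply/funext => b; apply/funext => c.
  by apply/funext => mu; apply/funext => nu; rewrite !mulr1 divr1 mul1r.
move: h1 h2 h3 h4 h5 h6 h7 h8; rewrite /nat_iso e => *.
by split.
Qed.

Lemma aut_compA phi chi xi : AutLR psi phi -> AutLR psi chi -> AutLR psi xi ->
  eqLR psi (aut_comp phi (aut_comp chi xi)) (aut_comp (aut_comp phi chi) xi).
Proof.
move=> h1 h2 h3; have v1 := AutLR_vi h1; have v2 := AutLR_vi h2; have v3 := AutLR_vi h3.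
have h4 := AutLR_comp hB h1 h2 hpp; have h5 := AutLR_comp hB h4 h3 hpp.
have h6 := AutLR_comp hB h2 h3 hpp; have v6 := AutLR_vi h6.
apply: eqLR_cut => //=; first by rewrite mulgA.
  by rewrite addbA.
move=> a b c.
rewrite -[LHS]/(cut (vertex_comp (pact (aut_comp chi xi)) (anti phi) (U (aut_comp chi
  xi)) (U phi) a b c)).
rewrite (vertex_comp_cut v6) //.
rewrite -[RHS]/(cut (vertex_comp (pact xi) (anti phi (+) anti chi) (U xi) (U
  (aut_comp phi chi)) a b c)).
rewrite (vertex_comp_cut v3) //.
rewrite -[X in fconj _ X]/(cut (vertex_comp (pact xi) (anti chi) (U xi) (U chi) a b c)).
rewrite (vertex_comp_cut v3) // fconjM fconj_comp -fmulA; congr (fmul _ _).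
rewrite -[RHS]/(cut (vertex_comp (pact chi) (anti phi) (U chi) (U phi) (pact xi a)
  (pact xi b) (pact xi c))).
by rewrite (vertex_comp_cut v2) ?(vi_N v3) //= !permM.
Qed.

Lemma aut_comp_idl phi : AutLR psi phi -> eqLR psi (aut_comp (aut_id B) phi) phi.
Proof.
move=> h1; have v1 := AutLR_vi h1.
apply: eqLR_cut => //=; first by rewrite mulg1.
move=> a b c.
rewrite -[LHS]/(cut (vertex_comp (pact phi) false (U phi) (U (aut_id B)) a b c)).
by rewrite (vertex_comp_cut v1) // cut_id fmul1r.
Qed.

Lemma aut_comp_invl phi : AutLR psi phi ->
  eqLR psi (aut_comp (aut_inv phi) phi) (aut_id B).
Proof.
move=> h1; have v1 := AutLR_vi h1.
apply: eqLR_cut => //=; first exact: aut_id_AutLR.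
- by rewrite mulgV.
- by rewrite addbb.
move=> a b c.
rewrite -[LHS]/(cut (vertex_comp (pact phi) (anti phi) (U phi) (U (aut_inv phi)) a b
  c)).
rewrite (vertex_comp_cut v1) //.
rewrite -[cut (U (aut_inv phi) _ _ _)]/(cut (vertex_inv (pact phi)^-1%g (anti phi) (U
  phi) (pact phi a) (pact phi b) (pact phi c))).
rewrite vertex_inv_cut !permK -fconjM; have [-> _] := vi_unitary v1 a b c.
by rewrite fconj_id cut_id.
Qed.

Lemma Upsilon_AutLR : psi != vac B -> AutLR psi (Upsilon psi).
Proof.
move=> pv; apply: nat_iso_AutLR => [a||].
- by rewrite /phase; case: eqP; rewrite ?normrN1 ?normr1.
- by rewrite eq_sym (negbTE pv).
- by rewrite eqxx mulrNN mulr1.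
Qed.

Lemma respects_locality_eqLR phi : AutLR psi phi ->
  respects_locality psi phi <-> eqLR psi phi (aut_id B).
Proof.
move=> hphi; rewrite (eqLR_gauge _ aut_id_AutLR); split.
  case=> gamma [ph gpsi [e1 e2 e3]]; split=> //.
  by exists gamma; split=> // a b c mu nu; rewrite e3.
by case=> e1 e2 [gamma [ph gpsi e3]]; exists gamma; split=> //; split.
Qed.

(** Classes are predicates restricted to [AutLR], on which [eqLR] is an equivalence relation. The
    fusion facts are parameters of the type so that a group structure can be attached to it. *)
Definition LRclass (_ : fusion_axioms B) (_ : N psi psi (vac B) = 1%N) : Type :=
  {P : autData B -> Prop |
    exists2 phi, AutLR psi phi & P = (fun chi => AutLR psi chi /\ eqLR psi phi chi)}.

HB.instance Definition _ := gen_eqMixin (LRclass hB hpp).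
HB.instance Definition _ := gen_choiceMixin (LRclass hB hpp).

Lemma cls_subproof (phi : autData B) :
  let chi := if `[< AutLR psi phi >] then phi else aut_id B in
  exists2 xi, AutLR psi xi &
   (fun x => AutLR psi x /\ eqLR psi chi x) = (fun x => AutLR psi x /\ eqLR psi xi x).
Proof.
case: asboolP => h /=; [by exists phi|exists (aut_id B) => //].
exact: aut_id_AutLR.
Qed.

(* Junk value: the trivial class when [phi] is not in Aut_LR. *)
Definition cls (phi : autData B) : LRclass hB hpp := exist _ _ (cls_subproof phi).

Definition cls_repr (q : LRclass hB hpp) : autData B := s2val (cid2 (svalP q)).

Lemma cls_repr_AutLR q : AutLR psi (cls_repr q).
Proof. exact: s2valP. Qed.

Lemma clsP phi chi : AutLR psi phi -> AutLR psi chi ->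
  cls phi = cls chi <-> eqLR psi phi chi.
Proof.
move=> h1 h2; split=> [/(congr1 sval) /=|h].
  rewrite !asboolT // => /(congr1 (fun P => P chi)) e.
  have : AutLR psi chi /\ eqLR psi chi chi by split=> //; apply: eqLR_refl.
  by rewrite -e => -[].
apply: eq_exist; rewrite !asboolT //; apply/funext => x; apply/propext.
split=> -[hx e]; split=> //.
  by apply: eqLR_trans e => //; apply: eqLR_sym.
exact: eqLR_trans e.
Qed.

Lemma cls_reprK q : cls (cls_repr q) = q.
Proof.
case: q => P hP; apply: eq_exist; rewrite /cls_repr /=.
by case: cid2 => /= phi h1 ->; rewrite asboolT.
Qed.

Lemma cls_repr_eqLR phi : AutLR psi phi -> eqLR psi (cls_repr (cls phi)) phi.
Proof. by move=> h; apply/clsP; rewrite ?cls_reprK //; apply: cls_repr_AutLR. Qed.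

Definition cls_mul p q := cls (aut_comp (cls_repr p) (cls_repr q)).
Definition cls_inv p := cls (aut_inv (cls_repr p)).
Definition cls_one := cls (aut_id B).

Let rA := cls_repr_AutLR.
Let cA x y hx hy := @AutLR_comp R B psi hB x y hx hy hpp.
Let iA x hx := @AutLR_inv R B psi hB x hx hpp.

Lemma cls_mulE phi chi : AutLR psi phi -> AutLR psi chi ->
  cls_mul (cls phi) (cls chi) = cls (aut_comp phi chi).
Proof.
move=> h1 h2; apply/clsP; try exact: cA.
by apply: eqLR_comp => //; apply: cls_repr_eqLR.
Qed.

Lemma cls_mulA : associative cls_mul.
Proof.
move=> x y z; rewrite -[x]cls_reprK -[y]cls_reprK -[z]cls_reprK.
rewrite !cls_mulE //; try exact: cA; try exact: rA.
by apply/clsP; try exact: aut_compA; do ?apply: cA.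
Qed.

Lemma cls_mul1 : left_id cls_one cls_mul.
Proof.
move=> x; rewrite -[x]cls_reprK cls_mulE //; last exact: aut_id_AutLR.
apply/clsP => //; last exact: aut_comp_idl.
by apply: cA => //; apply: aut_id_AutLR.
Qed.

Lemma cls_mulV : left_inverse cls_one cls_inv cls_mul.
Proof.
move=> x; rewrite -{2}[x]cls_reprK cls_mulE //; last exact: iA.
apply/clsP; first exact: cA (iA (rA _)) (rA _).
  exact: aut_id_AutLR.
exact: aut_comp_invl.
Qed.

Lemma cls_mulVr : right_inverse cls_one cls_inv cls_mul.
Proof.
move=> x; rewrite -[LHS]cls_mul1 -{1}(cls_mulV (cls_inv x)) -cls_mulA.
by rewrite (cls_mulA (cls_inv x)) cls_mulV cls_mul1 cls_mulV.
Qed.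

Lemma cls_mul1r : right_id cls_one cls_mul.
Proof. by move=> x; rewrite -(cls_mulV x) cls_mulA cls_mulVr cls_mul1. Qed.

HB.instance Definition _ := isGroup.Build (LRclass hB hpp)
  cls_mulA cls_mul1 cls_mul1r cls_mulV cls_mulVr.

Lemma clsM phi chi : AutLR psi phi -> AutLR psi chi ->
  cls (aut_comp phi chi) = (cls phi * cls chi)%g.
Proof. by move=> *; rewrite -cls_mulE. Qed.

Lemma cls1 : cls (aut_id B) = 1%g. Proof. by []. Qed.

Lemma clsV phi : AutLR psi phi -> cls (aut_inv phi) = (cls phi)^-1%g.
Proof.
move=> h; apply: (mulIg (cls phi)); have hi := iA h.
rewrite mulVg -clsM //.
by apply/clsP; [apply: cA | apply: aut_id_AutLR | apply: aut_comp_invl].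
Qed.

End GroupLaws.

(** * Independence of the choice of lifts *)

Section LiftObstruction.
Local Open Scope group_scope.
Variables (Q H G : groupType) (L : Q -> H -> Prop).
Hypothesis LM : forall x y a b, L x a -> L y b -> L (x * y) (a * b).
Hypothesis LV : forall x a, L x a -> L x^-1 a^-1.
Variable k : Q.
Hypothesis Lk : L k 1.
Hypothesis k1 : k != 1.
Hypothesis kerL : forall x, L x 1 -> x = 1 \/ x = k.

Let kk : k * k = 1.
Proof.
have := LM Lk Lk; rewrite mulg1 => /kerL[//|e].
by move: k1; rewrite -(inj_eq (mulgI k)) e mulg1 eqxx.
Qed.

Let kC x a : L x a -> k * x = x * k.
Proof.
move=> Lx; have := LM (LM Lx Lk) (LV Lx); rewrite mulg1 mulgV.
case/kerL => e.
  by move: k1; rewrite -(inj_eq (mulgI x)) mulg1 -(inj_eq (mulIg x^-1)) e mulgV eqxx.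
by rewrite -{1}e -!mulgA mulVg mulg1.
Qed.

Let kpow (b : bool) : Q := if b then k else 1.

Let kpowD b c : kpow (b (+) c) = kpow b * kpow c.
Proof. by case: b c => -[]; rewrite /= ?kk ?mulg1 ?mul1g. Qed.

Let kpow_eq1 b : (kpow b != 1) = b.
Proof. by case: b; rewrite /= ?eqxx. Qed.

Let kpowC b x a : L x a -> kpow b * x = x * kpow b.
Proof. by move=> Lx; case: b; rewrite /= ?(kC Lx) ?mul1g ?mulg1. Qed.

Let ker_kpow x : L x 1 -> x = kpow (x != 1).
Proof. by move=> /kerL[]->; rewrite /= ?eqxx ?k1. Qed.

(** [L x a] stands for x restricting to a, and [u] for the Upsilon correction, common to both
    choices. With r1 g = k^{b g} r2 g, all powers of the central k are collected on the left. *)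
Lemma lift_obstruction_cohomologous (rho : G -> H) (r1 r2 : G -> Q) (u : G -> G -> Q) :
  (forall g, L (r1 g) (rho g)) -> (forall g, L (r2 g) (rho g)) ->
  (forall g h, L (r1 (g * h) * (r1 h)^-1 * (r1 g)^-1 * u g h) 1) ->
  (forall g h, L (r2 (g * h) * (r2 h)^-1 * (r2 g)^-1 * u g h) 1) ->
  cohomologous (fun g h => r1 (g * h) * (r1 h)^-1 * (r1 g)^-1 * u g h != 1)
               (fun g h => r2 (g * h) * (r2 h)^-1 * (r2 g)^-1 * u g h != 1).
Proof.
move=> h1 h2 k1' k2'; pose b g := r1 g * (r2 g)^-1 != 1.
have r12 g : r1 g = kpow (b g) * r2 g.
  by rewrite -ker_kpow ?mulgKV // -(mulgV (rho g)); apply: LM (LV _).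
have kV c : (kpow c)^-1 = kpow c.
  by apply/eqP; rewrite -(inj_eq (mulgI (kpow c))) mulgV -kpowD addbb.
exists b => g h.
suff e : r1 (g * h) * (r1 h)^-1 * (r1 g)^-1 * u g h =
  kpow (b g (+) b h (+) b (g * h)) * (r2 (g * h) * (r2 h)^-1 * (r2 g)^-1 * u g h).
  rewrite e [X in kpow _ * X](ker_kpow (k2' g h)) -kpowD kpow_eq1.
  by rewrite -addbA addbb addbF.
rewrite !r12 !invgM !kV -(kpowC (b h) (LV (h2 h))) -(kpowC (b g) (LV (h2 g))) !mulgA.
rewrite -(mulgA _ (r2 (g * h)) (kpow _)) -(kpowC _ (h2 _)) !mulgA.
rewrite -(mulgA _ (r2 h)^-1 (kpow _)) -(kpowC _ (LV (h2 h))) !mulgA.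
rewrite -(mulgA _ (r2 (g * h)) (kpow _)) -(kpowC _ (h2 _)) !mulgA.
by rewrite -!kpowD addbC addbA addbAC.
Qed.

End LiftObstruction.

(** * Restriction to C and the obstruction as an element of its kernel *)

Section Restriction.
Variables (R : realType) (C M : braidData R) (psi : obj C).
Variables (i : obj C -> obj M).
Hypothesis hi : full_braided_subcategory i.

Lemma is_restriction_comp phi chi phi0 chi0 :
  AutLR psi chi0 -> is_restriction i phi phi0 -> is_restriction i chi chi0 ->
  is_restriction i (aut_comp phi chi) (aut_comp phi0 chi0).
Proof.
move=> h0 [p1 p2 p3] [c1 c2 c3]; split=> [a||a b c mu la] /=.
- by rewrite !permM c1 p1.
- by rewrite p2 c2.
have NE := vi_N (AutLR_vi h0) a b c.
rewrite !c1 (sub_N hi) p2; apply: eq_bigr => nu _.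
have lnu : (nu < N a b c)%N by rewrite -NE.
have lla : (la < N (pact chi0 a) (pact chi0 b) (pact chi0 c))%N by rewrite NE.
have := c3 _ _ _ mu (Ordinal lnu) => /= ->.
by have := p3 _ _ _ nu (Ordinal lla) => /= ->.
Qed.

Lemma is_restriction_inv phi phi0 :
  AutLR psi phi0 -> is_restriction i phi phi0 ->
  is_restriction i (aut_inv phi) (aut_inv phi0).
Proof.
move=> h0 [p1 p2 p3].
have e a : (pact phi)^-1%g (i a) = i ((pact phi0)^-1%g a).
  by apply: (@perm_inj _ (pact phi)); rewrite permKV p1 permKV.
split=> //= a b c mu nu; have NE := AutLR_NV a b c h0.
have lmu : (mu < N ((pact phi0)^-1%g a) ((pact phi0)^-1%g b) ((pact phi0)^-1%g c))%N.
  by rewrite NE.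
have lnu : (nu < N ((pact phi0)^-1%g a) ((pact phi0)^-1%g b) ((pact phi0)^-1%g c))%N.
  by rewrite NE.
by rewrite !e p2; have := p3 _ _ _ (Ordinal lnu) (Ordinal lmu) => /= ->.
Qed.

Lemma is_restriction_id : is_restriction i (aut_id M) (aut_id C).
Proof. by split=> // a; rewrite /= !perm1. Qed.

Lemma is_restriction_Upsilon_pow q :
  is_restriction i (Upsilon_pow (i psi) q) (Upsilon_pow psi q).
Proof.
case: q; last exact: is_restriction_id.
split=> //= [a|a b c mu nu]; first by rewrite !perm1.
by rewrite !(inj_eq (sub_inj hi)).
Qed.

End Restriction.

Section Obstruction.
Variables (R : realType) (C : braidData R) (psi : obj C).
Hypothesis hC : super_modular psi.
Variables (M : braidData R) (i : obj C -> obj M).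
Hypothesis hM : minimal_modular_extension i.

Let fC : fusion_axioms C. Proof. by case: hC => /ubf_fusion. Qed.
Let fM : fusion_axioms M. Proof. by case: hM => -[/ubf_fusion]. Qed.
Let nC : N psi psi (vac C) = 1%N.
Proof. by case: hC => _ _ _ _ ->; rewrite eqxx. Qed.
Let nM : N (i psi) (i psi) (vac M) = 1%N.
Proof. by rewrite (ext_N_fermion hC hM) eqxx. Qed.
Let hi : full_braided_subcategory i. Proof. by case: hM. Qed.
Let psi_vac : psi != vac C. Proof. by case: hC => _ /eqP. Qed.

Let QC := LRclass fC nC.
Let QM := LRclass fM nM.
Let clC (phi : autData C) : QC := cls fC nC phi.
Let clM (phi : autData M) : QM := cls fM nM phi.

(** The graph of r on classes; as a relation it only needs one representative that restricts
    strictly. *)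
Definition lifts (x : QM) (a : QC) : Prop := exists phi phi0,
  [/\ AutLR (i psi) phi, AutLR psi phi0, is_restriction i phi phi0,
      clM phi = x & clC phi0 = a].

Lemma lifts1 : lifts 1%g 1%g.
Proof.
exists (aut_id M), (aut_id C); split=> //; try exact: aut_id_AutLR.
exact: is_restriction_id.
Qed.

Lemma liftsM x y a b : lifts x a -> lifts y b -> lifts (x * y)%g (a * b)%g.
Proof.
case=> phi [phi0 [p1 p2 p3 <- <-]] [chi [chi0 [c1 c2 c3 <- <-]]].
exists (aut_comp phi chi), (aut_comp phi0 chi0).
split; try exact: AutLR_comp; try exact: clsM.
exact: is_restriction_comp c2 p3 c3.
Qed.

Lemma liftsV x a : lifts x a -> lifts x^-1%g a^-1%g.
Proof.
case=> phi [phi0 [p1 p2 p3 <- <-]]; exists (aut_inv phi), (aut_inv phi0).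
split; try exact: AutLR_inv; try exact: clsV.
exact: is_restriction_inv p2 p3.
Qed.

Lemma restricts_to_lifts phi chi : AutLR (i psi) phi -> AutLR psi chi ->
  restricts_to psi i phi chi -> lifts (clM phi) (clC chi).
Proof.
by move=> h1 h2 [phi0 [p1 p2 p3]]; exists phi, phi0; split=> //; apply/clsP.
Qed.

Lemma lifts_ker x : lifts x 1%g -> exists2 phi, in_ker_r psi i phi & clM phi = x.
Proof.
have h1 : AutLR psi (aut_id C) by apply: aut_id_AutLR.
case=> phi [phi0 [p1 p2 p3 p4 /(clsP fC nC p2 h1) p5]]; exists phi => //.
by split=> //; exists phi0.
Qed.

Variables (G : groupType) (s1 : G -> bool) (w : G -> G -> bool).
Variable rho : G -> autData C.
Hypothesis hrho : fermionic_symmetry_action psi s1 w rho.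

Let loc (B : braidData R) (p : obj B) : bool := `[< respects_locality p (Upsilon p) >].
(** The two cases of the homomorphism law, and of the definition of o_2, are merged by a correction
    that is trivial when Upsilon respects locality. *)
Let twC (q : bool) : QC := if loc psi then 1%g else clC (Upsilon_pow psi q).
Let twM (q : bool) : QM := if loc (i psi) then 1%g else clM (Upsilon_pow (i psi) q).

Let Upow_AutLR_C q : AutLR psi (Upsilon_pow psi q).
Proof. by case: q; [apply: Upsilon_AutLR | apply: aut_id_AutLR]. Qed.

Let Upow_AutLR_M q : AutLR (i psi) (Upsilon_pow (i psi) q).
Proof.
case: q; last exact: aut_id_AutLR.
by apply: Upsilon_AutLR => //; apply: ext_fermion_vac.
Qed.

Let loc_sub : loc (i psi) -> loc psi.
Proof.
move=> /asboolP[gamma [g1 g2 [e1 e2 e3]]]; apply/asboolP.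
exists (gamma \o i); split=> [a||]; [exact: g1|exact: g2|split=> // a b c mu nu].
have lmu : (mu < N (i a) (i b) (i c))%N by rewrite (sub_N hi).
have lnu : (nu < N (i a) (i b) (i c))%N by rewrite (sub_N hi).
have := e3 _ _ _ (Ordinal lmu) (Ordinal lnu).
by rewrite /= !(inj_eq (sub_inj hi)).
Qed.

Let twC_loc q : loc psi -> clC (Upsilon_pow psi q) = 1%g.
Proof.
move=> /asboolP h; case: q => //; apply/clsP.
- exact: (@Upow_AutLR_C true).
- exact: aut_id_AutLR.
- by apply/respects_locality_eqLR => //; apply: (@Upow_AutLR_C true).
Qed.

Let lifts_tw q : lifts (twM q) (twC q).
Proof.
have lU : lifts (clM (Upsilon_pow (i psi) q)) (clC (Upsilon_pow psi q)).
  exists (Upsilon_pow (i psi) q), (Upsilon_pow psi q); split=> //.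
  exact: is_restriction_Upsilon_pow.
rewrite /twM /twC; case: ifP => lM; first by rewrite loc_sub //; apply: lifts1.
(* In the mixed case Upsilon respects locality in C but not in M; its class on M then restricts to
   the trivial one. *)
by case: ifP => // lC; rewrite -(twC_loc q lC).
Qed.

Let rA g : AutLR psi (rho g). Proof. exact: fsa_aut hrho g. Qed.

Let rho_tw g h : (twC (w g h) * clC (rho g) * clC (rho h))%g = clC (rho (g * h)%g).
Proof.
rewrite /twC; case: ifP => [/asboolP hl|/negbT/asboolP hl].
  rewrite mul1g /clC -clsM //; apply/clsP => //; last exact: fsa_hom hrho hl g h.
  exact: AutLR_comp.
have h1 : AutLR psi (aut_comp (Upsilon_pow psi (w g h)) (rho g)).
  exact: AutLR_comp.
rewrite /clC -!clsM //; apply/clsP => //; last exact: fsa_twisted_hom hrho hl g h.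
exact: AutLR_comp.
Qed.

Let twC2 q : (twC q * twC q)%g = 1%g.
Proof.
rewrite /twC; case: ifP => _; first by rewrite mulg1.
case: q; last by rewrite /clC /= cls1 mulg1.
rewrite /clC -clsM //; try exact: (@Upow_AutLR_C true).
have hU : AutLR psi (Upsilon psi) by apply: (@Upow_AutLR_C true).
apply/clsP; [exact: AutLR_comp | exact: aut_id_AutLR |].
apply: eqLR_cut => //=; first exact: aut_id_AutLR.
  by rewrite mulg1.
move=> a b c; apply/funext => mu; apply/funext => nu; rewrite /cut /= !perm1.
set t := _ / _.
have t2 : t * t = 1.
  rewrite /t; do 3 case: ifP => _; rewrite ?invrN ?invr1; ring.
rewrite (eq_bigr (fun k : 'I__ => t * ((mu : nat) == k)%:R * t * ((k : nat) ==
  nu)%:R)) => [|k _].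
  by rewrite sum_dltr mulrAC t2 mul1r.
by rewrite mulrA.
Qed.

Variable rhoM : G -> autData M.
Hypothesis hrhoM : is_lift psi i rho rhoM.

Let rMA g : AutLR (i psi) (rhoM g). Proof. by case: (hrhoM g). Qed.

Lemma lifts_rhoM g : lifts (clM (rhoM g)) (clC (rho g)).
Proof. by case: (hrhoM g) => h1 h2; apply: restricts_to_lifts. Qed.

Let o2_cls g h := (clM (rhoM (g * h)) * (clM (rhoM h))^-1 * (clM (rhoM g))^-1 * twM
  (w g h))%g.

Lemma o2_aut_AutLR g h : AutLR (i psi) (o2_aut (i psi) w rhoM g h).
Proof.
rewrite /o2_aut; case: asboolP => _; last apply: AutLR_comp => //.
all: by do ! (first [exact: AutLR_inv | apply: AutLR_comp => //]).
Qed.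

Lemma o2_clsE g h : o2 (i psi) w rhoM g h = (o2_cls g h != 1%g).
Proof.
have <- : clM (o2_aut (i psi) w rhoM g h) = o2_cls g h.
  rewrite /o2_cls /twM /o2_aut /loc.
  have a1 x : AutLR (i psi) (aut_inv (rhoM x)) by apply: AutLR_inv.
  have a2 : AutLR (i psi) (aut_comp (rhoM (g * h)%g) (aut_inv (rhoM h))) by apply:
    AutLR_comp.
  have a3 : AutLR (i psi) (aut_comp (aut_comp (rhoM (g * h)%g) (aut_inv (rhoM h)))
    (aut_inv (rhoM g))).
    exact: AutLR_comp.
  by case: asboolP => _; rewrite /clM ?clsM // !clsV // ?mulg1.
rewrite /o2 /ker_r_to_Z2; congr (~~ _).
have h1 := o2_aut_AutLR g h; have h2 : AutLR (i psi) (aut_id M) by apply: aut_id_AutLR.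
by apply/asboolP/eqP => /(clsP fM nM h1 h2).
Qed.

(** Downstairs rho_gh rho_h^-1 rho_g^-1 equals the correction, and the correction squares to 1. *)
Lemma o2_cls_ker g h : lifts (o2_cls g h) 1%g.
Proof.
have <- : (clC (rho (g * h)) * (clC (rho h))^-1 * (clC (rho g))^-1 * twC (w g h))%g =
  1%g.
  by rewrite -rho_tw mulgK mulgK twC2.
apply: liftsM; last exact: lifts_tw.
by do !apply: liftsM; try apply: liftsV; apply: lifts_rhoM.
Qed.

End Obstruction.

Lemma o2_cohomologous (R : realType) (C : braidData R) (psi : obj C)
    (hC : super_modular psi) (M : braidData R) (i : obj C -> obj M)
    (hM : minimal_modular_extension i) (hker : ker_r_Z2_permuting psi i)
    (G : groupType) (s1 : G -> bool) (w : G -> G -> bool) (rho : G -> autData C)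
    (hrho : fermionic_symmetry_action psi s1 w rho)
    (rhoM rhoM' : G -> autData M) :
  is_lift psi i rho rhoM -> is_lift psi i rho rhoM' ->
  cohomologous (o2 (i psi) w rhoM) (o2 (i psi) w rhoM').
Proof.
move=> h1 h2.
have e r (hr : is_lift psi i rho r) : o2 (i psi) w r = _ :=
  funext (fun g => funext (fun h => o2_clsE hC hM w hr g h)).
rewrite (e _ h1) (e _ h2) {e}.
case: hker => k [k1 k2 k3 _].
have kA : AutLR (i psi) k by case: k1.
have nM : N (i psi) (i psi) (vac M) = 1%N by rewrite (ext_N_fermion hC hM) eqxx.
have Lk : @lifts _ _ _ hC _ _ hM (cls _ _ k) 1%g.
  have idC : AutLR psi (aut_id C) by apply: aut_id_AutLR; case: hC => /ubf_fusion.
  by case: k1 => _ kr; exact: (restricts_to_lifts hC hM kA idC kr).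
have fM : fusion_axioms M by case: (hM) => -[/ubf_fusion].
have idA : AutLR (i psi) (aut_id M) by apply: aut_id_AutLR.
apply: (lift_obstruction_cohomologous (@liftsM _ _ _ hC _ _ hM)
  (@liftsV _ _ _ hC _ _ hM) Lk _ _ (lifts_rhoM hC hM hrho h1) (lifts_rhoM hC hM hrho h2)
  (o2_cls_ker hC hM hrho h1) (o2_cls_ker hC hM hrho h2)).
- by apply/eqP => e; apply: k2; exact: (clsP _ _ kA idA).1 e.
- move=> x /lifts_ker[phi hphi <-]; have pA : AutLR (i psi) phi by case: hphi.
  by case: (k3 phi hphi) => h; [left|right]; apply/clsP.
Qed.

(** * Transport of lifts between extensions *)

Lemma vi_braids_trivially (R : realType) (A B : braidData R) (f : obj A -> obj B) q V
    (hA : fusion_axioms A) :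
  vertex_iso f q V -> braid_compat (fun _ _ => false) f q V ->
  forall a b, braids_trivially a b -> braids_trivially (f a) (f b).
Proof.
move=> hV hR a b hab z; case: (vi_bij hV) => g fK gK; rewrite -(gK z).
move: (g z) => c; rewrite !(vi_N hV).
have nC : N b a c = N a b c by case: hA.
have := braid_compat_cut hR (erefl (N b a c)) (erefl (N a b c)).
have := braid_compat_cut hR (erefl (N a b c)) (erefl (N b a c)).
rewrite !expr0 !fscale1.
have [U1 U1'] := vi_cut_unitary hV (erefl (N a b c)).
have [U2 U2'] := vi_cut_unitary hV (erefl (N b a c)).
move: U1 U1' U2 U2'.
set Vab := cut (V a b c); set Vba := cut (V b a c); set R1 := cut (Rs a b c).
set R2 := cut (Rs b a c); set R1' := cut (Rs (f a) _ _); set R2' := cut (Rs (f b) _ _).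
move=> U1 U1' U2 U2' h2 h1.
have RR : fmul R1 R2 = @fid _ _.
  by apply/funext => i; apply/funext => j; apply: hab.
have : fmul R1' R2' = @fid _ _.
  rewrite -[LHS]fmul1l -U2' -fmulA (fmulA Vba) h1 -fmulA h2 (fmulA _ _ Vba).
  by rewrite -fconjM RR fconj_id fmul1l U2'.
by move=> h mu la; exact: (congr1 (fun X : 'I_(N b a c) -> 'I_(N b a c) -> R[i] => X
  mu la) h).
Qed.

(** An autoequivalence fixes psi and preserves trivial braiding; its inverse gives the converse. *)
Lemma AutLR_grade (R : realType) (B : braidData R) (p : obj B)
    (hB : fusion_axioms B) (n1 : N p p (vac B) = 1%N) (phi : autData B) a :
  AutLR p phi -> grade p (pact phi a) = grade p a.
Proof.
move=> hphi; congr (~~ _); apply/asboolP/asboolP => h.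
  have [/autoequivalenceP[v1 v2 v3] _] := AutLR_inv hB hphi n1.
  have := vi_braids_trivially hB v1 v3 h.
  by rewrite /= (AutLR_psiV hphi) permK.
have [/autoequivalenceP[v1 v2 v3] _] := hphi.
by have := vi_braids_trivially hB v1 v3 h; rewrite v2.
Qed.

Section Transport.
Variables (R : realType) (M M' : braidData R).
Variables (f : obj M -> obj M') (V : obj M -> obj M -> obj M -> nat -> nat -> R[i]).
Variables (s : obj M -> obj M -> bool) (p : obj M) (p' : obj M').
Hypothesis hV : vertex_iso f false V.
Hypothesis hR : braid_compat s f false V.
Hypothesis fM : fusion_axioms M.
Hypothesis fM' : fusion_axioms M'.
Hypothesis nM : N p p (vac M) = 1%N.
Hypothesis nM' : N p' p' (vac M') = 1%N.
Hypothesis fp : f p = p'.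
Hypothesis pv : p != vac M.
Hypothesis hVp : V p p (vac M) 0%N 0%N = 1.
Hypothesis hs : forall phi a b, AutLR p phi ->
  s (pact phi a) (pact phi b) = s a b.

Let f_inj : injective f. Proof. exact: bij_inj (vi_bij hV). Qed.

(** The square of phi and phi' with V, where phi' conjugates the coefficients of V when anti-linear.
    As a relation it composes without evaluating V^-1. *)
Definition conjugate (phi : autData M) (phi' : autData M') : Prop :=
  [/\ forall a, f (pact phi a) = pact phi' (f a),
      anti phi' = anti phi
    & forall a b c,
      fmul (fconj (anti phi) (cut (n := N a b c) (m := N a b c) (V a b c)))
           (cut (U phi' (f a) (f b) (f c)))
      = fmul (cut (m := N a b c) (U phi a b c))
             (cut (m := N a b c) (V (pact phi a) (pact phi b) (pact phi c)))].

Lemma conjugate_comp phi phi' chi chi' :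
  AutLR p chi -> AutLR p' chi' ->
  conjugate phi phi' -> conjugate chi chi' ->
  conjugate (aut_comp phi chi) (aut_comp phi' chi').
Proof.
move=> hc hc' [p1 p2 p3] [c1 c2 c3]; split=> [a||a b c] /=.
- by rewrite !permM p1 c1.
- by rewrite p2 c2.
have v := AutLR_vi hc; have v' := AutLR_vi hc'.
rewrite -[X in fmul _ X = _]/(cut (vertex_comp (pact chi') (anti phi') (U chi') (U
  phi') (f a) (f b) (f c))).
rewrite (vertex_comp_cut v') ?(vi_N hV) // -!c1 p2 -fconj_comp fmulA -fconjM c3
  fconjM -fmulA.
rewrite -[X in _ = fmul X _]/(cut (vertex_comp (pact chi) (anti phi) (U chi) (U phi)
  a b c)).
rewrite (vertex_comp_cut v) // -[RHS]fmulA; congr (fmul _ _); rewrite !permM.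
by have := p3 (pact chi a) (pact chi b) (pact chi c); rewrite (vi_N v).
Qed.

Lemma conjugate_inv phi phi' : AutLR p phi -> AutLR p' phi' ->
  conjugate phi phi' -> conjugate (aut_inv phi) (aut_inv phi').
Proof.
move=> h h' [p1 p2 p3].
have e a : f ((pact phi)^-1%g a) = (pact phi')^-1%g (f a).
  by apply: (@perm_inj _ (pact phi')); rewrite permKV -p1 permKV.
have v := AutLR_vi h; have v' := AutLR_vi h'.
split=> //= a b c.
rewrite -[X in fmul _ X = _]/(cut (vertex_inv (pact phi')^-1%g (anti phi') (U phi')
  (f a) (f b) (f c))).
rewrite -[X in _ = fmul X _]/(cut (vertex_inv (pact phi)^-1%g (anti phi) (U phi) a b
  c)).
rewrite !vertex_inv_cut p2 -!e.
have NE := AutLR_NV a b c h.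
have := p3 ((pact phi)^-1%g a) ((pact phi)^-1%g b) ((pact phi)^-1%g c).
rewrite !permKV NE.
set x := (pact phi)^-1%g a in NE *; set y := (pact phi)^-1%g b in NE *; set z :=
  (pact phi)^-1%g c in NE *.
have [U1 U1'] := vi_cut_unitary v NE.
have NE' : N (f x) (f y) (f z) = N a b c by rewrite (vi_N hV).
have [U2 U2'] := vi_cut_unitary v' NE'.
move: U1 U1' U2 U2'; set Up := cut (U phi x y z); set Up' := cut (U phi' _ _ _).
move=> U1 U1' U2 U2' /(congr1 (fun X => fconj (anti phi) (fmul (fmul (fadj Up) X)
  (fadj Up')))).
rewrite !fmulA U1' fmul1l -!fmulA U2 fmul1r !fconjM fconjK => ->.
by [].
Qed.

Lemma conjugate_nat_iso (g : obj M -> R[i]) (g' : obj M' -> R[i]) :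
  (forall a, g' (f a) = g a) -> conjugate (nat_iso g) (nat_iso g').
Proof.
move=> gg; split=> [a||a b c] //=; first by rewrite !perm1.
apply/funext => i; apply/funext => j; rewrite /fmul /cut /fconj /= !perm1 !gg.
rewrite (eq_bigr (fun k : 'I__ => (g a * g b / g c * V a b c i k) * ((k : nat) ==
  j)%:R)) => [|k _].
  rewrite sum_dltr [RHS](eq_bigr (fun k : 'I__ => ((i : nat) == k)%:R * (g a * g b /
    g c * V a b c k j))) => [|k _].
    by rewrite sum_dltl.
  by rewrite mulrAC mulrC.
by rewrite mulrCA mulrA.
Qed.

Lemma conjugate_id : conjugate (aut_id M) (aut_id M').
Proof.
split=> [a||a b c] //; first by rewrite !perm1.
rewrite [X in fmul _ X](_ : _ = @fid _ _) // [X in _ = fmul X _](_ : _ = @fid _ _) //.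
by rewrite fmul1l fmul1r !perm1.
Qed.

Lemma conjugate_Upsilon_pow q : conjugate (Upsilon_pow p q) (Upsilon_pow p' q).
Proof.
case: q; last exact: conjugate_id.
by apply: conjugate_nat_iso => a; rewrite -fp (inj_eq f_inj).
Qed.

(** A gauge factor is a scalar on each vertex space: it commutes with V, and its phases are carried
    along f or its inverse. *)
Lemma conjugate_eqLR phi phi' chi chi' : AutLR p phi -> AutLR p chi -> AutLR p' phi' ->
  AutLR p' chi' -> conjugate phi phi' -> conjugate chi chi' ->
  eqLR p phi chi <-> eqLR p' phi' chi'.
Proof.
move=> h1 h2 h3 h4 [p1 p2 p3] [c1 c2 c3].
have cutP A (g : obj A -> R[i]) (a b c : obj A) n (X Y : nat -> nat -> R[i]) : 
  (forall mu nu : 'I_n, X mu nu = g a * g b / g c * Y mu nu) <->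
    cut (n := n) (m := n) X = fscale (g a * g b / g c) (cut Y).
  split=> [h|h mu nu]; first by apply/funext => i; apply/funext => j; apply: h.
  exact: (congr1 (fun X => X mu nu) h).
split=> [/(eqLR_gauge _ h2)|/(eqLR_gauge _ h4)] [q1 q2 [g [g1 g2 g3]]].
  apply/(eqLR_gauge _ h4); case: (vi_bij hV) => f' fK f'K; split.
  - by apply/permP => x; rewrite -(f'K x) -p1 -c1 q1.
  - by rewrite p2 c2.
  exists (g \o f'); split=> [a||a b c]; first exact: g1.
    by rewrite /= -fp fK.
  rewrite -(f'K a) -(f'K b) -(f'K c); move: (f' a) (f' b) (f' c) => {}a {}b {}c.
  apply/cutP; rewrite /= !fK (vi_N hV).
  have /cutP e := g3 a b c.
  have [_ W] : funitary (fconj (anti phi) (cut (n := N a b c) (m := N a b c) (V a b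
    c))).
    by apply: fconj_unitary; apply: vi_unitary hV _ _ _.
  rewrite -[LHS]fmul1l -W -fmulA p3 e q1 fscalel -c3 -q2 fscaler fmulA W fmul1l.
  by [].
apply/(eqLR_gauge _ h2); split.
- by apply/permP => x; apply: f_inj; rewrite p1 c1 q1.
- by rewrite -p2 -c2.
exists (g \o f); split=> [a||a b c]; first exact: g1.
  by rewrite /= fp.
apply/cutP => /=; have /cutP := g3 (f a) (f b) (f c); rewrite (vi_N hV) => e.
have pq : pact phi = pact chi by apply/permP => x; apply: f_inj; rewrite p1 c1 q1.
have [W _] : funitary (cut (n := N a b c) (m := N a b c) (V (pact phi a) (pact phi b)
  (pact phi c))).
  by apply: vi_cut_unitary hV _ _ _ _ _; rewrite (vi_N (AutLR_vi h1)).
rewrite -[LHS]fmul1r -W fmulA -p3 e -p2 q2 c2 fscaler c3 -pq -fscalel -fmulA W fmul1r.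
by [].
Qed.

Lemma conjugate_exists phi : AutLR p phi ->
  exists2 phi', AutLR p' phi' & conjugate phi phi'.
Proof.
move=> h; case: (vi_bij hV) => g fK gK.
have [/autoequivalenceP[v1 v2 v3] h2] := h.
have w1 := vertex_iso_inv fM fK gK hV.
have w3 := braid_compat_inv fK gK hV hR.
have x1 := vertex_iso_comp fM' w1 v1.
have x3 := braid_compat_comp w1 v1 w3 v3.
have y1 := vertex_iso_comp fM' x1 hV.
have y3 := braid_compat_comp x1 hV x3 hR.
(* The vertex map of V phi V^-1. *)
set W := vertex_comp _ false _ V in y1 y3.
have inj : injective (f \o (pact phi \o g)) by apply: bij_inj (vi_bij y1).
pose phi' := AutData (perm inj) (anti phi) W.
have e a : pact phi' a = f (pact phi (g a)) by rewrite permE.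
have cj : conjugate phi phi'.
  split=> [a||a b c] //; first by rewrite e fK.
  have NE : N (f a) (f b) (f c) = N a b c by rewrite (vi_N hV).
  rewrite /= /W (vertex_comp_cut x1 _ _ NE) (vertex_comp_cut w1 _ _ NE)
    vertex_inv_cut /= !fK.
  have [h0 h0'] : funitary (fconj (anti phi) (cut (n := N a b c) (m := N a b c) (V a
    b c))).
    by apply: fconj_unitary; apply: vi_unitary hV _ _ _.
  have c0 n m (X : 'I_n -> 'I_m -> R[i]) : fconj false X = X by [].
  by rewrite !c0 !fmulA fconj_adj h0 fmul1l.
exists phi' => //; split; last first.
  (* On the vertex of psi, psi and the vacuum, V is 1 by [hVp], so phi' still acts trivially
     there. *)
  case: cj => _ _ /(_ p p (vac M)).
  rewrite nM fp (vi_vac hV) v2 (vi_vac v1) => /(congr1 (fun X => X ord0 ord0)).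
  by rewrite /fmul !big_ord1 /cut /fconj h2 hVp conj_if1 !mul1r.
apply/autoequivalenceP; split.
- case: y1 => z1 z2 z3 z4 z5 z6; split=> //.
  + by apply: eq_bij z1 _ _ => x; rewrite e.
  + by rewrite e.
  + by move=> a b c; rewrite !e z3.
  + move=> a b c d x y al be mu nu; rewrite !e.
    by have := z6 a b c d x y al be mu nu; rewrite /= addbF.
- by rewrite e -fp fK v2.
- move=> a b c mu nu; rewrite !e /=.
  (* The sign from V^-1 at (a, b) and the one from V at the images under phi agree by [hs] and
     cancel, so phi' is braided although V need not be. *)
  have := y3 a b c mu nu; rewrite /= addbF hs // => ->.
  by rewrite addbF addbb.
Qed.

Variables (C : braidData R) (psi : obj C) (i : obj C -> obj M) (j : obj C -> obj M').
Hypothesis hi : full_braided_subcategory i.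
Hypothesis fi : forall a, f (i a) = j a.
Hypothesis Vi : forall (a b c : obj C) (mu nu : 'I_(N a b c)),
  V (i a) (i b) (i c) mu nu = (mu == nu)%:R.

Lemma conjugate_restriction phi phi' phi0 : AutLR psi phi0 -> conjugate phi phi' ->
  is_restriction i phi phi0 -> is_restriction j phi' phi0.
Proof.
move=> h0 [p1 p2 p3] [r1 r2 r3]; split=> [a||a b c mu nu].
- by rewrite -!fi -p1 r1.
- by rewrite p2.
have := p3 (i a) (i b) (i c); rewrite !fi (sub_N hi) !r1.
have cV a' b' c' n : N a' b' c' = n ->
    cut (n := n) (m := n) (V (i a') (i b') (i c')) = @fid _ _.
  by move=> <-; apply/funext => x; apply/funext => y; apply: Vi.
rewrite !cV ?(vi_N (AutLR_vi h0)) // fconj_id fmul1l fmul1r.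
by move=> /(congr1 (fun X => X mu nu)); rewrite /cut => ->; apply: r3.
Qed.

Variables (G : groupType) (w : G -> G -> bool) (rho : G -> autData C).
Variable rhoM : G -> autData M.
Hypothesis ip : i psi = p.
Hypothesis jp : j psi = p'.

Lemma transport_lift : is_lift psi i rho rhoM ->
  exists2 rhoM', is_lift psi j rho rhoM' &
    o2 p w rhoM = o2 p' w rhoM'.
Proof.
rewrite /is_lift ip jp => hl.
have pv' : p' != vac M' by rewrite -fp -(vi_vac hV) (inj_eq f_inj).
(* Conjugates are chosen for each g separately; no compatibility is asked, since o_2 is compared
   through [conjugate_eqLR]. *)
have /choice[r hr] g : exists x, AutLR p' x /\ conjugate (rhoM g) x.
  by have [h _] := hl g; have [x x1 x2] := conjugate_exists h; exists x.
exists r => [g|].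
  have [h1 h2] := hr g; split=> //; have [_ [phi0 [k1 k2 k3]]] := hl g.
  by exists phi0; split=> //; apply: conjugate_restriction h2 k2.
have A1 g : AutLR p (rhoM g) by case: (hl g).
have A2 g : AutLR p' (r g) by case: (hr g).
have A3 g : conjugate (rhoM g) (r g) by case: (hr g).
have I1 : AutLR p (aut_id M) by apply: aut_id_AutLR.
have I2 : AutLR p' (aut_id M') by apply: aut_id_AutLR.
have B1 g : AutLR p (aut_inv (rhoM g)) by apply: AutLR_inv.
have B2 g : AutLR p' (aut_inv (r g)) by apply: AutLR_inv.
have C1 x y : AutLR p x -> AutLR p y -> AutLR p (aut_comp x y).
  by move=> *; apply: AutLR_comp.
have C2 x y : AutLR p' x -> AutLR p' y -> AutLR p' (aut_comp x y).
  by move=> *; apply: AutLR_comp.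
have U1 q : AutLR p (Upsilon_pow p q) by case: q => //; apply: Upsilon_AutLR.
have U2 q : AutLR p' (Upsilon_pow p' q) by case: q => //; apply: Upsilon_AutLR.
have loc : respects_locality p (Upsilon p) <-> respects_locality p' (Upsilon p').
  rewrite (respects_locality_eqLR fM (U1 true)).
  rewrite (respects_locality_eqLR fM' (U2 true)).
  exact: (conjugate_eqLR (U1 true) I1 (U2 true) I2 (conjugate_Upsilon_pow true)
    conjugate_id).
have CC x x' y y' : AutLR p y -> AutLR p' y' -> conjugate x x' -> conjugate y y' ->
   conjugate (aut_comp x y) (aut_comp x' y').
  by move=> *; apply: conjugate_comp.
have CV g : conjugate (aut_inv (rhoM g)) (aut_inv (r g)) by apply: conjugate_inv.
apply/funext => g; apply/funext => h; rewrite /o2 /ker_r_to_Z2; congr (~~ _).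
suff [h1 h2 h3] : [/\ AutLR p (o2_aut p w rhoM g h), AutLR p' (o2_aut p' w r g h)
    & conjugate (o2_aut p w rhoM g h) (o2_aut p' w r g h)].
  have E := conjugate_eqLR h1 I1 h2 I2 h3 conjugate_id.
  by apply/asboolP/asboolP => /E.
rewrite /o2_aut (asbool_equiv_eq loc); case: asboolP => _.
  by split; [do !apply: (C1) => // | do !apply: (C2) => // | do !apply: (CC) => //].
split; [do !apply: (C1) => // | do !apply: (C2) => // | ].
by do !apply: (CC) => //; apply: conjugate_Upsilon_pow.
Qed.

End Transport.

(** * Central charges *)

Section CentralCharge.
Variable R : realType.

Definition gauss_angle (c : R) : R := 2%:R * pi * c / 8%:R.

Lemma trig_eq_mod8 (x y : R) : eq_mod8 x y ->
  cos (gauss_angle x) = cos (gauss_angle y) /\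
  sin (gauss_angle x) = sin (gauss_angle y).
Proof.
have per (u v : R) n : u = v + pi *+ 2 *+ n -> cos u = cos v /\ sin u = sin v.
  by move=> ->; rewrite (periodicn (@cosD2pi R)) (periodicn (@sinD2pi R)).
case=> -[] n /eqP; rewrite subr_eq /gauss_angle => /eqP xy.
  by apply: (per _ _ n); rewrite xy /=; field.
(* For a negative number of turns, x and y exchange roles. *)
have [|-> ->] := per (2%:R * pi * y / 8%:R) (2%:R * pi * x / 8%:R) n.+1; last by [].
by rewrite xy NegzE mulrNz /= -[n.+1%:~R]/(n.+1%:R); field.
Qed.

(** For 0 < n < 8 the angle lies in (0, pi), for 8 < n < 16 in (pi, 2 pi). *)
Lemma sin_pi8_eq0 (n : nat) : (n < 16)%N -> sin (pi * n%:R / 8%:R) = 0 :> R ->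
  n = 0%N \/ n = 8%N.
Proof.
move=> n16 h; have pi0 := pi_gt0 R.
case: n n16 h => [|n] n16 h; [by left|right].
have n0 : 0 < n.+1%:R :> R by rewrite ltr0n.
have [n8|n8|//] := ltngtP n.+1 8.
  have n8' : n.+1%:R < 8%:R :> R by rewrite ltr_nat.
  suff : 0 < sin (pi * n.+1%:R / 8%:R) :> R by rewrite h ltxx.
  by apply: sin_gt0_pi; apply/andP; split; nra.
have n8' : 8%:R < n.+1%:R :> R by rewrite ltr_nat.
have n16' : n.+1%:R < 16%:R :> R by rewrite ltr_nat.
suff : 0 < sin (pi * n.+1%:R / 8%:R - pi) :> R.
  by rewrite sinB h cospi sinpi mul0r mulr0 subr0 ltxx.
by apply: sin_gt0_pi; apply/andP; split; nra.
Qed.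

Lemma sin_pi8_diff (m n : nat) : (m < 16)%N -> (n < 16)%N ->
  sin (pi * (m%:R - n%:R) / 8%:R) = 0 :> R ->
  [\/ m = n, m = n + 8 | n = m + 8]%N.
Proof.
wlog nm : m n / (n <= m)%N.
  move=> H hm hn h; have [nm|/ltnW mn] := leqP n m; first exact: H.
  have h' : sin (pi * (n%:R - m%:R) / 8%:R) = 0 :> R.
    by rewrite -opprB mulrN mulNr sinN h oppr0.
  by case: (H _ _ mn hn hm h') => ->; [constructor 1|constructor 3|constructor 2].
move=> hm hn; rewrite -natrB // => /(sin_pi8_eq0 (leq_ltn_trans (leq_subr _ _) hm)).
by case=> h; [constructor 1|constructor 2]; lia.
Qed.

Lemma cos_pi8_diff (m n : nat) : (m < 16)%N -> (n < 16)%N ->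
  cos (pi * (m%:R - n%:R) / 8%:R) = -1 :> R -> (m = n + 8 \/ n = m + 8)%N.
Proof.
move=> hm hn h.
have /sin_pi8_diff : sin (pi * (m%:R - n%:R) / 8%:R) = 0 :> R.
  by apply: cos1sin0; rewrite h normrN1.
case=> // [e|->|->]; [|by left|by right].
move: h; rewrite e subrr mulr0 mul0r cos0 => /eqP.
by rewrite -subr_eq0 opprK -(natrD _ 1 1) pnatr_eq0.
Qed.

Lemma total_dim2_ge0 (B : braidData R) : 0 <= total_dim2 B.
Proof.
by apply: sumr_ge0 => a _; rewrite exprn_ge0 // /qdim invr_ge0 normr_ge0.
Qed.

(** The normalising factor is real, so the right-hand side equals its own conjugate. *)
Lemma central_charge_real (B : braidData R) c : central_charge B c ->
  (gauss B)^* = gauss B -> sin (gauss_angle c) = 0.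
Proof.
move=> hc hg; have := congr1 Num.conj hc.
rewrite rmorphM fmorphV /= -/(gauss B) hg.
have -> : (sqrtC (total_dim2 B))^* = sqrtC (total_dim2 B).
  by apply: geC0_conj; rewrite sqrtC_ge0 total_dim2_ge0.
rewrite -/(gauss B) in hc; rewrite hc => -[] /eqP.
by rewrite -addr_eq0 -mulr2n mulrn_eq0 /= => /eqP.
Qed.

Lemma central_charge_opp (A B : braidData R) c d :
  central_charge A c -> central_charge B d -> total_dim2 A = total_dim2 B ->
  gauss B = - gauss A ->
  cos (gauss_angle d) = - cos (gauss_angle c) /\
  sin (gauss_angle d) = - sin (gauss_angle c).
Proof.
rewrite /central_charge -/(gauss A) -/(gauss B) => hA hB e1 e2.
by move: hB; rewrite -e1 e2 mulrN hA => -[-> ->].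
Qed.

(** Half a unit of central charge per step of nu is an angle of pi / 8. *)
Lemma angle_diff (c d : R) (m n : nat) : eq_mod8 (c - d) ((m%:R - n%:R) / 2%:R) ->
  cos (gauss_angle c - gauss_angle d) = cos (pi * (m%:R - n%:R) / 8%:R) /\
  sin (gauss_angle c - gauss_angle d) = sin (pi * (m%:R - n%:R) / 8%:R).
Proof.
move=> /trig_eq_mod8; rewrite /gauss_angle.
have -> : 2%:R * pi * (c - d) / 8%:R = 2%:R * pi * c / 8%:R - 2%:R * pi * d / 8%:R by
  ring.
by have -> : 2%:R * pi * ((m%:R - n%:R) / 2%:R) / 8%:R = pi * (m%:R - n%:R) / 8%:R :>
  R by field.
Qed.

End CentralCharge.

(** * Anti-unitary lifts and the comparison of two extensions *)

Lemma is_lift_anti (R : realType) (C M : braidData R) (psi : obj C) (i : obj C -> obj M)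
    (G : groupType) (s1 : G -> bool) (w : G -> G -> bool) (rho : G -> autData C)
    (hrho : fermionic_symmetry_action psi s1 w rho) (rhoM : G -> autData M) g :
  is_lift psi i rho rhoM -> anti (rhoM g) = s1 g.
Proof.
move=> h; have [_ [phi0 [_ [_ -> _] e]]] := h g.
by have [_ -> _] := (eqLR_gauge _ (fsa_aut hrho g)).1 e; apply: fsa_anti hrho g.
Qed.

(* An anti-unitary lift makes the Gauss sum of the extension real. *)
Lemma lift_central_charge (R : realType) (C M : braidData R) (psi : obj C) (i : obj C
  -> obj M)
    (hM : minimal_modular_extension i) (c : R) (hc : central_charge M c)
    (G : groupType) (s1 : G -> bool) (w : G -> G -> bool) (rho : G -> autData C)
    (hrho : fermionic_symmetry_action psi s1 w rho) (rhoM : G -> autData M) g :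
  is_lift psi i rho rhoM -> s1 g = true -> sin (gauss_angle c) = 0.
Proof.
move=> h sg; apply: central_charge_real hc _.
have [[/autoequivalenceP[v1 _ v3] _] _] := h g.
have fM : fusion_axioms M by case: hM => -[/ubf_fusion].
by have := vi_gauss fM fM v1 v3; rewrite (is_lift_anti hrho g h) sg /= => <-.
Qed.

Theorem mainTheorem6 (R : realType) (C : braidData R) (psi : obj C)
    (hC : super_modular psi)
    (G : groupType) (s1 : G -> bool) (hs1 : Z2_homomorphism s1)
    (w : G -> G -> bool) (hw : cocycle2 w)
    (rho : G -> autData C) (hrho : fermionic_symmetry_action psi s1 w rho)
    (hanti : exists g : G, s1 g = true)
    (M : 'Z_16 -> braidData R) (inc : forall nu : 'Z_16, obj C -> obj (M nu))
    (cc : 'Z_16 -> R) (hM : sixteenfold_way psi inc cc)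
    (nu nu' : 'Z_16)
    (hker : ker_r_Z2_permuting psi (inc nu))
    (hker' : ker_r_Z2_permuting psi (inc nu'))
    (rhoM : G -> autData (M nu)) (hrhoM : is_lift psi (inc nu) rho rhoM)
    (rhoM' : G -> autData (M nu'))
    (hrhoM' : is_lift psi (inc nu') rho rhoM') :
  cohomologous (o2 (inc nu psi) w rhoM) (o2 (inc nu' psi) w rhoM').
Proof.
have [e|nn] := eqVneq nu nu'.
  by subst nu'; apply: o2_cohomologous hC _ _ (sw_ext hM nu) hker _ _ _ _ hrho _ _ _ _.
have hE := sw_ext hM nu.
have [mu [[Phi [P1 P2 P3 P4]] _]] := sw_all hM (twist_extension hC hE).
have [f [V [v1 v2 fi Vi]]] := equivalence_vertex_iso P1 P2 P3 P4.
have hT := twist_extension hC hE.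
have fT : fusion_axioms (twist (grade (inc nu psi))) by case: hT => -[/ubf_fusion].
have fB k : fusion_axioms (M k) by case: (sw_ext hM k) => -[/ubf_fusion].
have muE : mu = nu'.
  have [g sg] := hanti.
  have s0 := lift_central_charge hE (sw_cc hM nu) hrho hrhoM sg.
  have s0' := lift_central_charge (sw_ext hM nu') (sw_cc hM nu') hrho hrhoM' sg.
  have dE : total_dim2 (M nu) = total_dim2 (M mu).
    by case: hE => _ _ ->; case: (sw_ext hM mu) => _ _ ->.
  have gE : gauss (M mu) = - gauss (M nu).
    by rewrite (vi_gauss fT (fB mu) v1 v2) /= (gauss_twist hC hE).
  have [c1 c2] := central_charge_opp (sw_cc hM nu) (sw_cc hM mu) dE gE.
  have [_ d2] := angle_diff (sw_cc_diff hM nu nu').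
  have [d3 _] := angle_diff (sw_cc_diff hM mu nu).
  have lt16 (k : 'Z_16) : (k < 16)%N by apply: ltn_ord.
  (* Both sines vanish, hence so does the sine of the difference of the two angles. *)
  have q1 : [\/ (nu : nat) = nu', (nu : nat) = (nu' + 8)%N | (nu' : nat) = (nu + 8)%N].
    by apply: (@sin_pi8_diff R); rewrite ?lt16 // -d2 sinB s0 s0' mul0r mulr0 subrr.
  (* The twist reversed cosine and sine, so the cosine of the difference is - cos^2 - sin^2 = -1. *)
  have q2 : ((mu : nat) = nu + 8 \/ (nu : nat) = mu + 8)%N.
    apply: (@cos_pi8_diff R); rewrite ?lt16 // -d3 cosB c1 c2 !mulNr -opprD.
    by rewrite -!expr2 cos2Dsin2.
  apply: val_inj => /=; have := lt16 nu; have := lt16 nu'; have := lt16 mu.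
  (* Both mu and nu' differ from nu by 8; below 16 there is only one such index. *)
  by case: q1 => [/val_inj e||]; [rewrite e eqxx in nn|lia|lia].
subst nu'.
(* Only the R-symbols distinguish the twist from [M nu]; for them the sign moves into [s]. *)
have w1 : @vertex_iso R (M nu) (M mu) f false V by case: v1; split.
pose s (a b : obj (M nu)) := grade (inc nu psi) a && grade (inc nu psi) b.
have w2 : @braid_compat R (M nu) (M mu) s f false V.
  move=> a b c x y; have := v2 a b c x y => /= ->; rewrite expr0 mul1r mulr_sumr.
  by apply: eq_bigr => z _; rewrite mulrA.
have nB k : N (inc k psi) (inc k psi) (vac (M k)) = 1%N.
  by rewrite (ext_N_fermion hC (sw_ext hM k)) eqxx.
have hi : full_braided_subcategory (inc nu) by case: hE.
have hVp : V (inc nu psi) (inc nu psi) (vac (M nu)) 0%N 0%N = 1.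
  have n1 : (0 < N psi psi (vac C))%N by case: (hC) => _ _ _ _ ->; rewrite eqxx.
  (* The equivalence is the identity on C, in particular on the vertex of two fermions. *)
  by rewrite -(sub_vac hi); have := Vi _ _ _ (Ordinal n1) (Ordinal n1); rewrite eqxx.
have hs phi a b : AutLR (inc nu psi) phi -> s (pact phi a) (pact phi b) = s a b.
  by move=> hphi; rewrite /s !(AutLR_grade (fB nu) (nB nu) _ hphi).
have [rho2 l2 ->] := transport_lift w1 w2 (fB nu) (fB mu) (nB nu) (nB mu) (fi psi)
  (ext_fermion_vac hC hE) hVp hs hi fi Vi w (erefl _) (erefl _) hrhoM.
exact: o2_cohomologous hC _ _ (sw_ext hM mu) hker' _ _ _ _ hrho _ _ l2 hrhoM'.
Qed.
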